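(* Let $\Omega\subset\mathbb{R}^n$ be open and bounded, let $L$ be the elliptic operator described in the context, and assume that its coefficients $b_i$, $V$ satisfy either Assumption A or Assumption B of the context. Then the equation $Lu=0$ has the strong unique continuation property in $\Omega$: for every nonnegative weak solution $u\in H^1_0(\Omega)$ of $Lu=0$ which vanishes of infinite order at some $x_0\in\Omega$, one has $u\equiv0$ in $B(x_0,r)$ for some $r>0$.
   Context: A function $w\in L^1_{\rm loc}(\Omega)$, $w\ge0$ in $\Omega$, vanishes of infinite order at $x_0\in\Omega$ if $\lim_{r\to0}\frac1{|B(x_0,r)|^k}\int_{B(x_0,r)}w(x)\,dx=0$ for all $k>0$. As usual, $u\equiv0$ means equality almost everywhere. $H^1(\Omega)$ is the Sobolev space of $u\in L^2(\Omega)$ with all weak derivatives $\frac{\partial u}{\partial x_i}\in L^2(\Omega)$, with norm $\|u\|_{L^2(\Omega)}+\sum_i\|\frac{\partial u}{\partial x_i}\|_{L^2(\Omega)}$; $H^1_0(\Omega)$ is the closure of $C_0^\infty(\Omega)$ in $H^1(\Omega)$. Operator: $$Lu:=-\sum_{i,j=1}^n\frac{\partial}{\partial x_i}\left(a_{ij}\frac{\partial u}{\partial x_j}\right)+\sum_{i=1}^n b_i\frac{\partial u}{\partial x_i}+Vu$$ on $H^1_0(\Omega)$, where $a_{ij}\in L^\infty(\Omega)$, and $b_i$ ($i=1,\dots,n$) and $V$ are real-valued measurable functions on $\mathbb{R}^n$. The matrix $a(x)=(a_{ij}(x))$ is symmetric on $\Omega$ and for some $\lambda>0$, $\lambda|\xi|^2\le\sum_{i,j}a_{ij}(x)\xi_i\xi_j\le\lambda^{-1}|\xi|^2$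 for all $\xi\in\mathbb{R}^n$ and almost all $x\in\Omega$. Weak solution: $u\in H^1_0(\Omega)$ is a weak solution of $Lu=0$ if $$\int_\Omega\left(\sum_{i,j=1}^n a_{ij}\frac{\partial u}{\partial x_i}\frac{\partial\psi}{\partial x_j}+\sum_{i=1}^n b_i\frac{\partial u}{\partial x_i}\psi+Vu\psi\right)dx=0\quad\text{for all }\psi\in H^1_0(\Omega).$$ Function classes: For $\varphi:(0,\infty)\to(0,\infty)$ and $1\le p<\infty$, $L^{p,\varphi}$ is the set of $f\in L^p_{\rm loc}(\mathbb{R}^n)$ with $\|f\|_{L^{p,\varphi}}:=\sup_{x\in\mathbb{R}^n,r>0}\left(\frac1{\varphi(r)}\int_{|x-y|<r}|f(y)|^p\,dy\right)^{1/p}<\infty$. For $0<\alpha<n$, $\tilde S_\alpha$ is the set of $f\in L^1_{\rm loc}(\mathbb{R}^n)$ with $\eta_\alpha f(r):=\sup_{x\in\mathbb{R}^n}\int_{|x-y|<r}\frac{|f(y)|}{|x-y|^{n-\alpha}}\,dy<\infty$ for all $r>0$. Assumption A: $1<\alpha\le2$, $\alpha<n$, $1<p<\frac n\alpha$; $\varphi:(0,\infty)\to(0,\infty)$ satisfies, for some positive constants $C_1,C_2,C_3$: (1) $s\le t\Rightarrow\varphi(s)\le C_1\varphi(t)$; (2) $s\le t\Rightarrow\frac{\varphi(s)}{s^n}\ge C_2\frac{\varphi(t)}{t^n}$; (3) $\int_\delta^\infty\frac{\varphi(t)}{t^{(n+1)-\frac p2(\alpha+1)}}\,dt\le C_3\delta^{\frac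 p2(1-\alpha)}$ for every $\delta>0$; and $b_i^2\in L^{p,\varphi}$ for $i=1,\dots,n$, $V\in L^{p,\varphi}\cap L^2_{\rm loc}(\mathbb{R}^n)$. Assumption B: $1\le\alpha\le2$ (with $\alpha<n$), $b_i^2\in\tilde S_\alpha$ for $i=1,\dots,n$, and $V\in\tilde S_\alpha$. *)

(* Defs.v *)
From HB Require Import structures.
From mathcomp Require Import all_boot all_order all_algebra.
From mathcomp Require Import all_classical all_reals all_analysis.

Set Implicit Arguments.
Unset Strict Implicit.
Unset Printing Implicit Defensive.
Import Order.TTheory GRing.Theory Num.Theory.
Import numFieldNormedType.Exports.

Local Open Scope classical_set_scope.
Local Open Scope ring_scope.

Section borel.
Context (R : realType) (n : nat).

(* R^n with the product of the Borel sigma-algebras of its coordinates. *)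
Definition borel_rV : Type := 'rV[R]_n.
Definition coor_rV (i : 'I_n) (x : borel_rV) : measurableTypeR R := x ord0 i.

Let set0P : g_sigma_preimage coor_rV set0.
Proof. exact: sigma_algebra0. Qed.
Let setCP A : g_sigma_preimage coor_rV A -> g_sigma_preimage coor_rV (~` A).
Proof. exact: sigma_algebraC. Qed.
Let bigcupP (F : (set borel_rV)^nat) : (forall i, g_sigma_preimage coor_rV (F i)) ->
  g_sigma_preimage coor_rV (\bigcup_i (F i)).
Proof. exact: sigma_algebra_bigcup. Qed.

HB.instance Definition _ := Pointed.copy borel_rV 'rV[R]_n.
HB.instance Definition _ := @isMeasurable.Build default_measure_display
  borel_rV (g_sigma_preimage coor_rV) set0P setCP bigcupP.

Lemma measurable_coor_rV i : measurable_fun setT (coor_rV i).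
Proof.
move=> _ Y mY; rewrite setTI; apply: sub_sigma_algebra => /=.
rewrite -bigcup_seq/=; exists i => /=; first by rewrite mem_index_enum.
by exists Y => //; rewrite setTI.
Qed.

Lemma measurable_fun_borel_rV d (T : measurableType d) (f : T -> borel_rV) :
  (forall i, measurable_fun setT (coor_rV i \o f)) -> measurable_fun setT f.
Proof.
move=> mf _ A mA; rewrite setTI.
suff : g_sigma_preimage coor_rV `<=` [set B | measurable (f @^-1` B)] by exact.
apply: smallest_sub => [|B].
  split => /=; first by rewrite preimage_set0.
  - by move=> B mB; rewrite setTD preimage_setC; exact: measurableC.
  - by move=> F mF; rewrite preimage_bigcup; exact: bigcupT_measurable.
rewrite -bigcup_seq => -[i _ [C mC <-]] /=.
by rewrite setTI -comp_preimage -[X in measurable X]setTI; exact: mf.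
Qed.

End borel.

Section lebesgue.
Context (R : realType).

Definition cons_rV (n : nat) (xv : measurableTypeR R * borel_rV R n) :
  borel_rV R n.+1 :=
  \row_j (if unlift ord0 j is Some k then xv.2 ord0 k else xv.1).

Lemma measurable_cons_rV n : measurable_fun setT (@cons_rV n).
Proof.
apply: measurable_fun_borel_rV => i.
case: (unliftP ord0 i) => [k ik|i0].
- rewrite (_ : _ \o _ = coor_rV k \o snd).
    by apply: measurableT_comp => //; exact: measurable_coor_rV.
  by apply/funext => x /=; rewrite /coor_rV mxE ik liftK.
- rewrite (_ : _ \o _ = fst); first exact: measurable_fst.
  by apply/funext => x /=; rewrite /coor_rV mxE i0 unlift_none.
Qed.

Section step.
Context (n : nat) (m : {sigma_finite_measure set (borel_rV R n) -> \bar R}).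

Definition lebesgue_step : set (borel_rV R n.+1) -> \bar R :=
  pushforward (@lebesgue_measure R \x m)%E (@cons_rV n).

Let step0 : lebesgue_step set0 = 0%E.
Proof. by rewrite /lebesgue_step /pushforward preimage_set0 measure0. Qed.

Let step_ge0 A : (0 <= lebesgue_step A)%E.
Proof. by rewrite /lebesgue_step /pushforward; exact: measure_ge0. Qed.

Let step_sigma_additive : semi_sigma_additive lebesgue_step.
Proof.
have mpre A : measurable A -> measurable (@cons_rV n @^-1` A).
  by move=> mA; rewrite -[X in measurable X]setTI; exact: measurable_cons_rV.
move=> F mF tF mUF; rewrite /lebesgue_step /pushforward preimage_bigcup.
apply: measure_semi_sigma_additive; [by move=> k; exact: mpre| |].
- apply/trivIsetP => /= i j _ _ ij; rewrite -preimage_setI.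
  by move/trivIsetP : tF => /(_ _ _ _ _ ij) ->//; rewrite preimage_set0.
- by rewrite -preimage_bigcup; exact: mpre.
Qed.

HB.instance Definition _ := isMeasure.Build _ _ _
  lebesgue_step step0 step_ge0 step_sigma_additive.

Let step_sigma_finite : sigma_finite setT lebesgue_step.
Proof.
have /sigma_finiteP[F [TF ndF Foo]] := sigma_finiteT (@lebesgue_measure R).
have /sigma_finiteP[G [TG ndG Goo]] := sigma_finiteT m.
pose uncons (x : borel_rV R n.+1) : measurableTypeR R * borel_rV R n :=
  (x ord0 ord0, \row_j x ord0 (lift ord0 j)).
have consK : cancel (@cons_rV n) uncons.
  move=> [t x]; rewrite /uncons /cons_rV; congr pair.
    by rewrite mxE unlift_none.
  by apply/rowP => j; rewrite !mxE liftK.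
have muncons : measurable_fun setT uncons.
  apply: measurable_fun_pair; first exact: (measurable_coor_rV ord0).
  apply: measurable_fun_borel_rV => i.
  rewrite (_ : _ \o _ = coor_rV (lift ord0 i)); first exact: measurable_coor_rV.
  by apply/funext => x; rewrite /= /coor_rV mxE.
exists (fun k => uncons @^-1` (F k `*` G k)).
  rewrite -preimage_bigcup (_ : \bigcup_k _ = setT) ?preimage_setT//.
  rewrite -subTset => -[t x] _.
  have [k _ Fkt] : (\bigcup_k F k) t by rewrite -TF.
  have [l _ Glx] : (\bigcup_k G k) x by rewrite -TG.
  exists (maxn k l) => //; split.
  - by move: t Fkt; exact/subsetPset/ndF/leq_maxl.
  - by move: x Glx; exact/subsetPset/ndG/leq_maxr.
move=> k; have [mF Fk] := Foo k; have [mG Gk] := Goo k; split.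
  rewrite -[X in measurable X]setTI; apply: muncons => //.
  exact: measurableX.
rewrite /lebesgue_step /pushforward -comp_preimage.
rewrite (_ : _ \o _ = id); last by apply/funext => x /=; rewrite consK.
by rewrite preimage_id product_measure1E// lte_mul_pinfty// ge0_fin_numE.
Qed.

HB.instance Definition _ := @Measure_isSigmaFinite.Build _ _ _
  lebesgue_step step_sigma_finite.

End step.

(* n-fold product of the Lebesgue measure of R, on the product sigma-algebra. *)
Fixpoint borel_lebesgue (n : nat) :
    {sigma_finite_measure set (borel_rV R n) -> \bar R} :=
  match n with
  | 0 => @dirac _ (borel_rV R 0) (0 : 'rV[R]_0) R
  | m.+1 => lebesgue_step (borel_lebesgue m)
  end.

End lebesgue.

Section completion.
Context (R : realType) (n : nat).

Let rV_cara := caratheodory_type ((borel_lebesgue R n)^*)%mu.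

(* The sigma-algebra of 'rV[R]_n is that of the Lebesgue measurable sets, so
   [measurable_fun] below means Lebesgue measurable (for the Borel structure on
   the codomain) and [lebesgue_rV] is the complete Lebesgue measure. *)
HB.instance Definition _ := @isMeasurable.Build
  (caratheodory_display ((borel_lebesgue R n)^*)%mu) 'rV[R]_n
  (@measurable _ rV_cara) measurable0 (@measurableC _ rV_cara)
  (@bigcupT_measurable _ rV_cara).

Definition lebesgue_rV : set 'rV[R]_n -> \bar R :=
  @completed_measure_extension _ _ _ (borel_lebesgue R n).

HB.instance Definition _ := isMeasure.Build _ _ _ lebesgue_rV
  (@measure0 _ rV_cara _ (@completed_measure_extension _ _ _ (borel_lebesgue R n)))
  (@measure_ge0 _ rV_cara _ (@completed_measure_extension _ _ _ (borel_lebesgue R n)))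
  (@measure_semi_sigma_additive _ rV_cara _ (@completed_measure_extension _ _ _ (borel_lebesgue R n))).

HB.instance Definition _ := Measure_isSigmaFinite.Build _ _ _ lebesgue_rV
  (@completed_measure_extension_sigma_finite _ _ _ (borel_lebesgue R n)
     (sigma_finiteT (borel_lebesgue R n))).

End completion.

Arguments lebesgue_rV {R n}.

Lemma lebesgue_rV_box (R : realType) (n : nat) (A : 'I_n -> set R) :
  (forall i, measurable (A i)) ->
  lebesgue_rV [set x : 'rV[R]_n | forall i, A i (x ord0 i)] =
  (\prod_(i < n) lebesgue_measure (A i))%E.
Proof.
move=> mA; pose box k (B : 'I_k -> set R) : set (borel_rV R k) :=
  [set x | forall i, B i (coor_rV i x)].
have mbox k (B : 'I_k -> set R) :
    (forall i, measurable (B i)) -> measurable (box k B).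
  move=> mB; rewrite (_ : box k B = \bigcap_i (coor_rV i @^-1` B i)).
    apply: fin_bigcap_measurable => [|i _]; first exact: finite_finset.
    rewrite -[X in measurable X]setTI.
    exact: (measurable_coor_rV i measurableT (mB i)).
  by rewrite predeqE => x; split=> [Bx i _|Bx i]; exact: Bx.
rewrite /lebesgue_rV /completed_measure_extension measurable_mu_extE; last exact: mbox.
rewrite -/(box n A); elim: n A mA => [|n IH] A mA.
  by rewrite big_ord0 /= diracE mem_set// => -[].
rewrite big_ord_recl -(IH (fun i => A (lift ord0 i))); last by move=> i; exact: mA.
rewrite -product_measure1E; [|exact: mA|exact: mbox].
rewrite [in RHS](_ : _ `*` _ = @cons_rV R n @^-1` box n.+1 A)//.
rewrite predeqE => -[t x] /=; split=> [[At Ax] i|Ax].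
  rewrite /coor_rV mxE; case: (unliftP ord0 i) => [j ->|->//].
  exact: Ax.
split=> [|i]; first by have := Ax ord0; rewrite /coor_rV mxE unlift_none.
by have := Ax (lift ord0 i); rewrite /coor_rV mxE liftK.
Qed.

Section euclidean.
Context (R : realType) (n : nat).
Implicit Types (x y : 'rV[R]_n) (r : R).

(* The norm `|x| of the library on row vectors is the sup norm. *)
Definition enorm x : R := Num.sqrt (\sum_i x ord0 i ^+ 2).

Definition eball x r : set 'rV[R]_n := [set y | enorm (x - y) < r].

End euclidean.

Section Lp_spaces.
Context (R : realType) (n : nat).
Implicit Types (D : set 'rV[R]_n) (p : \bar R) (f : 'rV[R]_n -> R).

Definition Lpnorm D p f : \bar R := ('N[lebesgue_rV]_p [EFin \o (f \_ D)])%E.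

Definition Lp D p f : Prop := measurable_fun D f /\ (Lpnorm D p f < +oo)%E.

Definition Lp_loc D p f : Prop :=
  forall K, compact K -> K `<=` D -> Lp K p f.

End Lp_spaces.

Section sobolev.
Context (R : realType) (n : nat).
Implicit Types (D : set 'rV[R]_n) (u g phi : 'rV[R]_n -> R) (i : 'I_n).

Definition partial i phi : 'rV[R]_n -> R :=
  fun x => 'D_(delta_mx ord0 i) phi x.

Definition smooth phi : Prop := forall s : seq 'I_n,
  continuous (foldr partial phi s) /\
  forall i x, derivable (foldr partial phi s) x (delta_mx ord0 i).

Definition test_function D phi : Prop :=
  let supp := closure [set x | phi x != 0] in
  [/\ smooth phi, compact supp & supp `<=` D].

Definition is_weak_partial D i u g : Prop :=
  [/\ Lp_loc D 1 u, Lp_loc D 1 g &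
   forall phi, test_function D phi ->
     \int[lebesgue_rV]_(x in D) (u x * partial i phi x) =
     - \int[lebesgue_rV]_(x in D) (g x * phi x)].

(* A weak derivative is unique up to a null set only; when there is none,
   this is the zero function. *)
Definition weak_partial D i u : 'rV[R]_n -> R :=
  xget (cst 0) [set g | is_weak_partial D i u g].

Definition H1 D u : Prop :=
  Lp D 2 u /\ forall i, exists2 g, is_weak_partial D i u g & Lp D 2 g.

Definition H1norm D u : \bar R :=
  (Lpnorm D 2 u + \sum_(i < n) Lpnorm D 2 (weak_partial D i u))%E.

Definition H10 D u : Prop :=
  H1 D u /\
  forall e : R, 0 < e ->
    exists2 phi, test_function D phi & (H1norm D (u \- phi)%R < e%:E)%E.

End sobolev.

Section operator.
Context (R : realType) (n : nat) (Omega : set 'rV[R]_n).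
Context (a : 'rV[R]_n -> 'M[R]_n) (b : 'I_n -> 'rV[R]_n -> R)
  (V : 'rV[R]_n -> R).

Definition elliptic : Prop :=
  [/\ forall i j, Lp Omega +oo (fun x => a x i j),
      forall x, Omega x -> (a x)^T = a x &
      exists2 lambda : R, 0 < lambda &
        {ae lebesgue_rV, forall x, Omega x -> forall xi : 'rV[R]_n,
          lambda * enorm xi ^+ 2
            <= \sum_i \sum_j a x i j * xi ord0 i * xi ord0 j
            <= lambda^-1 * enorm xi ^+ 2}].

Definition weak_integrand (u psi : 'rV[R]_n -> R) (x : 'rV[R]_n) : R :=
  \sum_i \sum_j
      a x i j * weak_partial Omega i u x * weak_partial Omega j psi x
  + \sum_i b i x * weak_partial Omega i u x * psi x
  + V x * u x * psi x.

(* The integral of a non-integrable function is a junk value, so integrability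
   has to be part of the statement that the integral vanishes. *)
Definition weak_solution (u : 'rV[R]_n -> R) : Prop :=
  H10 Omega u /\
  forall psi, H10 Omega psi ->
    lebesgue_rV.-integrable Omega (EFin \o weak_integrand u psi) /\
    \int[lebesgue_rV]_(x in Omega) weak_integrand u psi x = 0.

End operator.

Section infinite_order.
Context (R : realType) (n : nat).

Definition vanishes_infinite_order (Omega : set 'rV[R]_n)
    (w : 'rV[R]_n -> R) (x0 : 'rV[R]_n) : Prop :=
  [/\ Lp_loc Omega 1 w, {ae lebesgue_rV, forall x, Omega x -> 0 <= w x}, Omega x0 &
   forall k : R, 0 < k ->
     (fine (lebesgue_rV (eball x0 r)) `^ k)^-1 * \int[lebesgue_rV]_(x in eball x0 r) w x
       @[r --> 0^'+] --> (0 : R)].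

End infinite_order.

Section classes.
Context (R : realType) (n : nat).
Implicit Types (phi : R -> R) (p alpha r : R) (f V : 'rV[R]_n -> R)
  (b : 'I_n -> 'rV[R]_n -> R).

Definition morrey_norm p phi f : \bar R :=
  ereal_sup [set q | exists x r, 0 < r /\
    q = (((phi r)^-1%:E * \int[lebesgue_rV]_(y in eball x r) (`|f y| `^ p)%:E)
           `^ p^-1)%E].

Definition morrey p phi f : Prop :=
  Lp_loc setT p%:E f /\ (morrey_norm p phi f < +oo)%E.

(* Since 0^-1 = 0, the integrand is 0 at y = x, a null set. *)
Definition stummel_eta alpha f r : \bar R :=
  ereal_sup [set (\int[lebesgue_rV]_(y in eball x r)
      (`|f y| / enorm (x - y) `^ (n%:R - alpha))%:E)%E | x in setT].

Definition stummel alpha f : Prop :=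
  Lp_loc setT 1 f /\ forall r, 0 < r -> (stummel_eta alpha f r < +oo)%E.

(* phi is not assumed to be measurable: for a nonnegative integrand the integral
   of the library is the supremum over the simple functions below it, which is
   the Lebesgue integral whenever the latter makes sense. *)
Definition growth alpha p phi (C1 C2 C3 : R) : Prop :=
  [/\ forall s t, 0 < s -> s <= t -> phi s <= C1 * phi t,
      forall s t, 0 < s -> s <= t -> C2 * (phi t / t ^+ n) <= phi s / s ^+ n &
      forall d, 0 < d ->
        (\int[lebesgue_measure]_(t in `]d, +oo[)
           (phi t / t `^ (n.+1%:R - p / 2 * (alpha + 1)))%:E
         <= (C3 * d `^ (p / 2 * (1 - alpha)))%:E)%E].

Definition assumption_A alpha p phi b V : Prop :=
  [/\ [/\ 1 < alpha <= 2, alpha < n%:R & 1 < p < n%:R / alpha],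
      forall t, 0 < t -> 0 < phi t,
      exists C1 C2 C3,
        [/\ 0 < C1, 0 < C2, 0 < C3 & growth alpha p phi C1 C2 C3],
      forall i, morrey p phi (fun x => b i x ^+ 2) &
      morrey p phi V /\ Lp_loc setT 2 V].

Definition assumption_B alpha b V : Prop :=
  [/\ 1 <= alpha <= 2, alpha < n%:R,
      forall i, stummel alpha (fun x => b i x ^+ 2) & stummel alpha V].

End classes.

(* Main.v *)
Require Import Defs.
From mathcomp Require Import all_boot all_order all_algebra.
From mathcomp Require Import all_classical all_reals all_analysis.
From mathcomp Require Import measurable_realfun lra ring.

(** The solution [u] vanishes on a whole cube around [x0] because its logarithm has
    bounded mean oscillation there, on all scales: the averages of [u] over the
    cubes of radius [r0 / 2^k] then decay at most geometrically, at a fixed rate,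
    unless [u] is zero, whereas vanishing of infinite order makes them decay faster
    than every geometric rate.

    The energy estimate. Both assumptions on the coefficients imply that
    [b_i ^ 2] and [|V|] have integrals of at most a multiple of [r^(n-2)] over the
    cubes of radius [r <= 1] ([stummel_growth], [morrey_growth]). Testing the equation with
    [chi^2 / u], for a cutoff [chi] of the cube, gives
    [integral chi^2 |grad log u|^2 <= C r^(n-2)]: the derivative of [1 / u] produces
    the term to be estimated, half of which absorbs the gradient of [chi], a quarter
    the drift, and [V u / u = V]. To make sense of it, [1 / u] is replaced by
    [gtest delta u] and [log u] by [vlog delta u], with constants independent of
    [delta] ([energy_pointwise]). These are smooth functions on the line, so that
    [gtest delta (phi_k)] is an admissible test function for test functions [phi_k]
    that approximate [u]. When the [phi_k] converge to [u] fast enough, the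
    functions and their partials converge almost everywhere under an integrable
    majorant ([H10_sequence]), and dominated convergence gives the estimate for [u]
    ([energy_limit], [energy_cube]).

    The mean oscillation. The Poincare inequality in L1 holds for functions of class
    C1 on cubes, by induction on the dimension ([poincare_borel]), and passes to the
    limit along [vlog delta (phi_k)] ([poincare_log]). With the energy estimate, the
    mean oscillation of [vlog delta u] over cubes around [x0] is at most a constant
    [K] ([log_oscillation_cube]).

    The conclusion. The means of [vlog delta u] over consecutive cubes differ by at
    most [2^n K], so they decrease at most linearly in [k] ([mean_log_decay]). If
    [u >= e > 0] on a set of positive measure, the first of them is bounded below
    independently of [delta] ([mean_lower_bound]). Jensen's inequality
    ([jensen_expR]) and [delta -> 0] then give a geometric lower bound for the means
    of [u] ([mean_lower_decay]), which contradicts the decay of infinite order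
    ([mean_upper_decay], [geometric_contradiction]). Hence [u] is zero almost
    everywhere on the first cube. *)

Set Implicit Arguments.
Unset Strict Implicit.
Unset Printing Implicit Defensive.
Import Order.TTheory GRing.Theory Num.Theory.
Import numFieldNormedType.Exports.

Local Open Scope classical_set_scope.
Local Open Scope ring_scope.

(** * Lebesgue measure: cubes and slices *)

Section cubes.
Context (R : realType) (n : nat).
Implicit Types (x q : 'rV[R]_n) (r : R) (U : set 'rV[R]_n).

(** Cubes serve as neighbourhoods instead of Euclidean balls: they are products,
    so that measures and integrals over them reduce to one-dimensional slices. *)
Definition cube q r : set 'rV[R]_n :=
  [set x | forall i, `|x ord0 i - q ord0 i| <= r].

Lemma cube_box q r :
  cube q r = [set x | forall i, [set` `[q ord0 i - r, q ord0 i + r]] (x ord0 i)].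
Proof.
by apply/seteqP; split=> x /= cx i; have := cx i; rewrite in_itv/= ler_distl.
Qed.

Lemma subset_cube q r s : r <= s -> cube q r `<=` cube q s.
Proof. by move=> rs x cx i; exact: le_trans rs. Qed.

Lemma borel_cube q r : measurable (cube q r : set (borel_rV R n)).
Proof.
have -> : cube q r =
  \bigcap_i (@coor_rV R n i @^-1` [set` `[q ord0 i - r, q ord0 i + r]]).
  by rewrite cube_box predeqE => x; split=> [Bx i _|Bx i]; exact: Bx.
apply: fin_bigcap_measurable => [|i _]; first exact: finite_finset.
rewrite -[X in measurable X]setTI.
exact: (measurable_coor_rV i measurableT (measurable_itv _)).
Qed.

Lemma compact_cube q r : compact (cube q r).
Proof.
rewrite cube_box.
apply: (@rV_compact R n (fun i => [set` `[q ord0 i - r, q ord0 i + r]])) => i.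
exact: segment_compact.
Qed.

Lemma open_cube_subset U x : open U -> U x ->
  exists2 r, 0 < r & cube x r `<=` U.
Proof.
move=> oU Ux; have /nbhs_ballP[e /= e0 eU] : nbhs x U by exact: open_nbhs_nbhs.
exists (e / 2); first by rewrite divr_gt0.
move=> y cy; apply: eU; split=> // i j; rewrite ord1 /ball/= distrC.
by apply: (le_lt_trans (cy j)); rewrite ltr_pdivrMr// ltr_pMr// ltr1n.
Qed.

(** The factor 2 leaves room for a cutoff that equals one on the small cube and
    vanishes outside of the large one. *)
Lemma open_rat_cube U x : open U -> U x ->
  exists q : 'rV[rat]_n * rat, [/\ 0 < ratr q.2 :> R,
    cube (map_mx ratr q.1) (ratr q.2) x &
    cube (map_mx ratr q.1) (2 * ratr q.2) `<=` U].
Proof.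
move=> oU Ux; have [e e0 eU] := open_cube_subset oU Ux.
have e3 : 0 < e / 3 by rewrite divr_gt0.
have [r] := rat_in_itvoo e3; rewrite in_itv/= => /andP[r0 re].
have rq (i : 'I_n) : exists q : rat, `|x ord0 i - ratr q| <= ratr r.
  have [|q] := @rat_in_itvoo R (x ord0 i - ratr r) (x ord0 i + ratr r).
    by rewrite ltrD2l gtrN.
  rewrite in_itv/= => /andP[q1 q2]; exists q; rewrite ler_distl.
  by rewrite lerBlDr (ltW q2)/= -lerBlDr (ltW q1).
pose q := \row_i projT1 (cid (rq i)).
exists (q, r); split => //=.
  by move=> i; rewrite !mxE; case: cid.
move=> y cy; apply: eU => i; have := cy i; rewrite !mxE; case: cid => /= p xp yp.
rewrite (_ : _ - _ = (y ord0 i - ratr p) - (x ord0 i - ratr p)); last by ring.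
rewrite (le_trans (ler_normB _ _))// (le_trans (lerD yp xp))//; lra.
Qed.

Lemma open_bigcup_cube U : open U ->
  U = \bigcup_(q : 'rV[rat]_n * rat)
        if `[< 0 < ratr q.2 :> R /\
               cube (map_mx ratr q.1) (2 * ratr q.2) `<=` U >]
        then cube (map_mx ratr q.1) (ratr q.2) else set0.
Proof.
move=> oU; apply/seteqP; split=> [x Ux|x [q _]].
  have [q [q0 qx qU]] := open_rat_cube oU Ux.
  by exists q => //; case: ifPn => // /asboolPn; case.
case: ifPn => // /asboolP[q0 qU] qx; apply/qU/(subset_cube _ qx).
by rewrite ler_peMl ?(ltW q0)// ler1n.
Qed.

(** The Borel sigma-algebra is generated here by the coordinates; an open set
    belongs to it as a countable union of rational cubes. *)
Lemma open_borel U : open U -> measurable (U : set (borel_rV R n)).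
Proof.
move=> oU; rewrite (open_bigcup_cube oU).
apply: countable_bigcupT_measurable; first exact: countableP.
by move=> q; case: ifP => // _; exact: borel_cube.
Qed.

Lemma borel_measurable (A : set 'rV[R]_n) :
  measurable (A : set (borel_rV R n)) -> measurable A.
Proof. exact: caratheodory_measurable_mu_ext. Qed.

Lemma measurable_cube q r : measurable (cube q r).
Proof. by apply: borel_measurable; exact: borel_cube. Qed.

Lemma open_measurable_rV U : open U -> measurable U.
Proof. by move=> oU; apply: borel_measurable; exact: open_borel. Qed.

Lemma compact_measurable_rV (K : set 'rV[R]_n) : compact K -> measurable K.
Proof.
move=> cK; rewrite -(setCK K); apply: measurableC; apply: open_measurable_rV.
by rewrite openC; apply: compact_closed => //; exact: norm_hausdorff.
Qed.

Lemma continuous_borel (f : 'rV[R]_n -> R) : continuous f ->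
  measurable_fun setT (f : borel_rV R n -> R).
Proof.
move=> /continuousP cf; apply: (measurability _ (measurable_realfun.RGenOpens.measurableE R)).
move=> _ [_ [a [b ->] <-]]; rewrite setTI; apply: open_borel.
exact/cf/interval_open.
Qed.

Lemma borel_measurable_fun d (T : measurableType d) (D : set 'rV[R]_n)
    (f : 'rV[R]_n -> T) :
  measurable_fun (D : set (borel_rV R n)) (f : borel_rV R n -> T) ->
  measurable D -> measurable (D : set (borel_rV R n)) -> measurable_fun D f.
Proof.
by move=> mf mD mD' _ Y mY; apply: borel_measurable; exact: mf.
Qed.

Lemma continuous_measurable_rV (D : set 'rV[R]_n) (f : 'rV[R]_n -> R) :
  continuous f -> measurable_fun D f.
Proof.
move=> cf; apply: measurable_funTS; apply: borel_measurable_fun => //.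
exact: continuous_borel.
Qed.

Lemma lebesgue_rV_borel (A : set 'rV[R]_n) :
  measurable (A : set (borel_rV R n)) -> lebesgue_rV A = borel_lebesgue R n A.
Proof. exact: measurable_mu_extE. Qed.

Lemma lebesgue_cube q r : 0 <= r ->
  lebesgue_rV (cube q r) = ((2 * r) ^+ n)%:E.
Proof.
move=> r0; rewrite cube_box.
rewrite (@lebesgue_rV_box R n (fun i => [set` `[q ord0 i - r, q ord0 i + r]]));
  last by move=> i; exact: measurable_itv.
under eq_bigr do rewrite lebesgue_measure_itv/= lte_fin.
rewrite (eq_bigr (fun=> (2 * r)%:E)) => [|i _].
  by rewrite prodEFin prodr_const card_ord.
have [r1|r1] := ltP 0 r; last first.
  have -> : r = 0 by apply/eqP; rewrite eq_le r0 r1.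
  by rewrite subr0 addr0 ltxx mulr0.
rewrite ifT; last by rewrite ltrD2l gtrN.
by rewrite -EFinD; congr EFin; ring.
Qed.

(** Borel covers whose measure is within [1 / (k + 1)] of the outer measure of
    [E] are intersected. *)
Lemma borel_hull (E : set 'rV[R]_n) : (lebesgue_rV E < +oo)%E ->
  exists B : set 'rV[R]_n, [/\ measurable (B : set (borel_rV R n)), E `<=` B &
    lebesgue_rV B = lebesgue_rV E].
Proof.
move=> Efin.
have E0 : (0 <= lebesgue_rV E)%E by exact: outer_measure_ge0.
have Ef : lebesgue_rV E \is a fin_num by rewrite ge0_fin_numE.
have H (k : nat) : exists B : set 'rV[R]_n, [/\ measurable (B : set (borel_rV R n)), E `<=` B &
    (lebesgue_rV B <= lebesgue_rV E + k.+1%:R^-1%:E)%E].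
  have k0 : 0 < k.+1%:R^-1 :> R by [].
  have [_ [F [mF EF] <-] /ltW FE] := lb_ereal_inf_adherent k0 Ef.
  exists (\bigcup_j F j); split=> //.
    exact: bigcupT_measurable.
  apply: le_trans FE; rewrite lebesgue_rV_borel; last exact: bigcupT_measurable.
  by apply: measure_sigma_subadditive => //; exact: bigcupT_measurable.
have /choice[B HB] := H.
have mB : measurable (\bigcap_k B k : set (borel_rV R n)).
  by apply: bigcapT_measurable => k; have [] := HB k.
exists (\bigcap_k B k); split=> //.
  by move=> x Ex k _; have [_ + _] := HB k; exact.
apply/eqP; rewrite eq_le; apply/andP; split; last first.
  apply: le_outer_measure => x Ex k _; have [_ + _] := HB k; exact.
apply/lee_addgt0Pr => e e0.
have [k ke] : exists k : nat, k.+1%:R^-1 < e.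
  near \oo => k; exists k; near: k; exact: near_infty_natSinv_lt (PosNum e0).
have [_ _ BE] := HB k.
apply: (@le_trans _ _ (lebesgue_rV (B k))); last first.
  by rewrite (le_trans BE)// leeD2l// lee_fin ltW.
by apply: le_outer_measure => x; exact.
Unshelve. all: by end_near. Qed.

(** The identity is measurable from the Lebesgue to the Borel structure, and it
    pushes the complete measure forward to the product measure: on Borel
    functions the two integrals agree, and Tonelli's theorem becomes available. *)
Lemma ge0_integral_borel (D : set 'rV[R]_n) (f : 'rV[R]_n -> \bar R) :
  measurable (D : set (borel_rV R n)) ->
  @measurable_fun _ _ (borel_rV R n) (\bar R) D f ->
  (forall x, D x -> (0 <= f x)%E) ->
  (\int[lebesgue_rV]_(x in D) f x = \int[borel_lebesgue R n]_(x in D) f x)%E.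
Proof.
move=> mD mf f0; pose phi : 'rV[R]_n -> borel_rV R n := id.
have mphi : measurable_fun setT phi.
  by move=> _ Y mY; rewrite setTI; exact: borel_measurable.
rewrite -[LHS](@ge0_integral_pushforward _ _ _ _ _ phi mphi lebesgue_rV D f)//.
  by apply: eq_measure_integral => A mA _; exact: lebesgue_rV_borel.
by move=> x; rewrite inE; exact: f0.
Qed.

Lemma integral_borel (D : set 'rV[R]_n) (f : 'rV[R]_n -> \bar R) :
  measurable (D : set (borel_rV R n)) ->
  @measurable_fun _ _ (borel_rV R n) (\bar R) D f ->
  (\int[lebesgue_rV]_(x in D) f x = \int[borel_lebesgue R n]_(x in D) f x)%E.
Proof.
move=> mD mf; rewrite integralE [RHS]integralE.
by congr (_ - _)%E; apply: ge0_integral_borel => //;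
  [exact: measurable_funepos|exact: measurable_funeneg].
Qed.

End cubes.

Section slices.
Context (R : realType) (n : nat).
Implicit Types (f : 'rV[R]_n.+1 -> \bar R).
Local Notation mu := (@lebesgue_measure R).
Local Notation m := (borel_lebesgue R n).

(** The measure in dimension [n.+1] is the pushforward of a product measure under
    [cons_rV], so this is Tonelli's theorem. *)
Lemma ge0_integral_cons f :
  @measurable_fun _ _ (borel_rV R n.+1) (\bar R) setT f ->
  (forall x, 0 <= f x)%E ->
  (\int[borel_lebesgue R n.+1]_x f x =
   \int[mu]_t \int[m]_x f (cons_rV (t, x)))%E.
Proof.
move=> mf f0.
have mfc : @measurable_fun _ _ (measurableTypeR R * borel_rV R n)%type (\bar R) setT (f \o @cons_rV R n).
  exact: (measurableT_comp mf (@measurable_cons_rV R n)).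
rewrite [LHS](@ge0_integral_pushforward _ _ _ _ _ (@cons_rV R n)
  (@measurable_cons_rV R n) (mu \x m)%E setT f)//.
by rewrite preimage_setT fubini_tonelli1// => x; exact: f0.
Qed.

Lemma ge0_integral_cons2 f :
  @measurable_fun _ _ (borel_rV R n.+1) (\bar R) setT f ->
  (forall x, 0 <= f x)%E ->
  (\int[borel_lebesgue R n.+1]_x f x =
   \int[m]_x \int[mu]_t f (cons_rV (t, x)))%E.
Proof.
move=> mf f0; rewrite ge0_integral_cons//.
apply: (@fubini_tonelli _ _ _ _ _ mu m (f \o @cons_rV R n)) => //.
  exact: (measurableT_comp mf (@measurable_cons_rV R n)).
by move=> x; exact: f0.
Qed.

Lemma integrable_cons f : (borel_lebesgue R n.+1).-integrable setT f ->
  (mu \x m)%E.-integrable setT (f \o @cons_rV R n).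
Proof.
move=> /integrableP[mf foo].
have mfc : @measurable_fun _ _ (measurableTypeR R * borel_rV R n)%type (\bar R) setT (f \o @cons_rV R n).
  exact: (measurableT_comp mf (@measurable_cons_rV R n)).
apply/integrableP; split => //; move: foo.
rewrite [in X in X -> _](@ge0_integral_pushforward _ _ _ _ _ (@cons_rV R n)
  (@measurable_cons_rV R n) (mu \x m)%E setT)//.
exact: measurableT_comp.
Qed.

Lemma integral_cons f : (borel_lebesgue R n.+1).-integrable setT f ->
  (\int[borel_lebesgue R n.+1]_x f x =
   \int[mu]_t \int[m]_x f (cons_rV (t, x)))%E.
Proof.
move=> fi; have fci := integrable_cons fi.
rewrite [LHS](@integral_pushforward _ _ _ _ _ (@cons_rV R n)
  (@measurable_cons_rV R n) (mu \x m)%E setT f)//.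
- by rewrite preimage_setT -integral12_prod_meas1.
- by case/integrableP : fi.
Qed.

Lemma integral_cons2 f : (borel_lebesgue R n.+1).-integrable setT f ->
  (\int[borel_lebesgue R n.+1]_x f x =
   \int[m]_x \int[mu]_t f (cons_rV (t, x)))%E.
Proof.
move=> fi; rewrite integral_cons//.
exact: (Fubini (integrable_cons fi)).
Qed.

End slices.

(** * Functions of class Ck and cutoffs *)

Section lines.
Context (R : realType) (V : normedModType R).

(** The difference quotients of [f] in the direction [v] are those of its
    restriction to the line: one-variable calculus applies to partials. *)
Lemma is_derive_line (f : V -> R) (v y : V) (t d : R) :
  is_derive (t *: v + y) v f d <-> is_derive t 1 (fun h : R => f (h *: v + y)) d.
Proof.
have E : (fun h : R => h^-1 *: ((f \o shift (t *: v + y)) (h *: v)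
            - f (t *: v + y))) =
         (fun h : R => h^-1 *: (((fun h : R => f (h *: v + y)) \o shift t) (h *: 1)
            - (fun h : R => f (h *: v + y)) t)).
  apply/funext => h /=; congr (_ *: (f _ - _)).
  by rewrite addrA -scalerDl /GRing.scale/= mulr1.
split=> -[df dE]; split.
- by move: df; rewrite /derivable E.
- by rewrite -dE /derive E.
- by rewrite /derivable E.
- by rewrite -dE /derive E.
Qed.

Lemma is_derive_line0 (f : V -> R) (v y : V) (d : R) :
  is_derive y v f d <-> is_derive (0 : R) 1 (fun h : R => f (h *: v + y)) d.
Proof.
by have := is_derive_line f v y 0 d; rewrite scale0r add0r.
Qed.

Lemma is_derive_comp1 (f : V -> R) (g : R -> R) (x v : V) (df dg : R) :
  is_derive x v f df -> is_derive (f x) 1 g dg ->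
  is_derive x v (g \o f) (dg * df).
Proof.
move=> /is_derive_line0 Df Dg; apply/is_derive_line0.
apply: (@is_derive1_comp R g (fun h => f (h *: v + x)) 0) => //.
by rewrite scale0r add0r.
Qed.

End lines.

Section continuous_fun.
Context (R : realType) (T : topologicalType).
Implicit Types f g : T -> R.

Lemma continuous_funD f g : continuous f -> continuous g ->
  continuous (fun x => f x + g x).
Proof. by move=> cf cg x; apply: cvgD; [exact: cf|exact: cg]. Qed.

Lemma continuous_funM f g : continuous f -> continuous g ->
  continuous (fun x => f x * g x).
Proof. by move=> cf cg x; apply: cvgM; [exact: cf|exact: cg]. Qed.

Lemma continuous_funV f : (forall x, f x != 0) -> continuous f ->
  continuous (fun x => (f x)^-1).
Proof. by move=> f0 cf x; apply: cvgV; [exact: f0|exact: cf]. Qed.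

Lemma continuous_fun_comp (U W : topologicalType) (f : T -> U) (g : U -> W) :
  continuous f -> continuous g -> continuous (g \o f).
Proof. by move=> cf cg x; apply: continuous_comp; [exact: cf|exact: cg]. Qed.

End continuous_fun.

Lemma continuous_affine (R : realType) (V : normedModType R) (c : R) (q : V) :
  continuous (fun x : V => c *: (x - q)).
Proof.
move=> x; apply: cvgZl_tmp; apply: cvgB; [exact: cvg_id|exact: cvg_cst].
Qed.

Section Ck.
Context (R : realType) (n : nat).
Implicit Types (f g : 'rV[R]_n -> R) (i j : 'I_n) (k : nat).
Local Notation ei i := (delta_mx ord0 i : 'rV[R]_n).

(** Unlike [smooth], this family of predicates supports induction on the order
    of differentiation, and hence the product, inverse and chain rules. *)
Fixpoint Ck k f : Prop := match k with
  | 0 => continuous f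
  | k.+1 => continuous f /\
     forall i, (forall x, derivable f x (ei i)) /\ Ck k (partial i f)
  end.

Lemma Ck_continuous k f : Ck k f -> continuous f.
Proof. by case: k => [//|k []]. Qed.

Lemma CkW k f : Ck k.+1 f -> Ck k f.
Proof.
elim: k f => [f []//|k IH f [cf fi]]; split=> // i.
by have [df Cf] := fi i; split => //; exact: IH.
Qed.

Lemma Ck_derivable k f i x : Ck k.+1 f -> is_derive x (ei i) f (partial i f x).
Proof. by move=> [_ /(_ i)[df _]]; split. Qed.

Lemma Ck_partial k f i : Ck k.+1 f -> Ck k (partial i f).
Proof. by move=> [_ /(_ i)[]]. Qed.

Lemma Ck_smooth f : (forall k, Ck k f) -> smooth f.
Proof.
move=> Cf s; elim/last_ind: s f Cf => [|s i IH] f Cf /=.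
  split=> [|i x]; first exact: (Ck_continuous (Cf 0)).
  by case: (Ck_derivable i x (Cf 1)).
by rewrite foldr_rcons; apply: IH => k; exact/Ck_partial/(Cf k.+1).
Qed.

Lemma smooth_partial f i : smooth f -> smooth (partial i f).
Proof. by move=> sf s; have := sf (rcons s i); rewrite foldr_rcons. Qed.

Lemma smooth_Ck k f : smooth f -> Ck k f.
Proof.
elim: k f => [|k IH] f sf; first by have [] := sf [::].
split; first by have [] := sf [::].
move=> i; split; first by have [_] := sf [::]; exact.
exact/IH/smooth_partial.
Qed.

Lemma Ck_intro k f (df : 'I_n -> 'rV[R]_n -> R) : continuous f ->
  (forall i x, is_derive x (ei i) f (df i x)) -> (forall i, Ck k (df i)) ->
  Ck k.+1 f.
Proof.
move=> cf Df Cdf; split=> // i; split; first by move=> x; case: (Df i x).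
by rewrite (_ : partial i f = df i)//; apply/funext => x; case: (Df i x).
Qed.

Lemma is_derive_partial f i x d : is_derive x (ei i) f d -> partial i f x = d.
Proof. by case. Qed.

Lemma Ck_cst k (c : R) : Ck k (cst c : 'rV[R]_n -> R).
Proof.
elim: k c => [|k IH] c; first exact: cst_continuous.
apply: (@Ck_intro _ _ (fun i => cst 0)) => //; first exact: cst_continuous.
Qed.

Lemma CkD k f g : Ck k f -> Ck k g -> Ck k (fun x => f x + g x).
Proof.
elim: k f g => [|k IH] f g Cf Cg.
  exact: continuous_funD.
apply: (@Ck_intro _ _ (fun i x => partial i f x + partial i g x)).
- by apply: continuous_funD; [exact: (Ck_continuous Cf)|exact: (Ck_continuous Cg)].
- by move=> i x; exact: (is_deriveD (Ck_derivable i x Cf) (Ck_derivable i x Cg)).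
- by move=> i; apply: IH; exact: Ck_partial.
Qed.

Lemma CkM k f g : Ck k f -> Ck k g -> Ck k (fun x => f x * g x).
Proof.
elim: k f g => [|k IH] f g Cf Cg.
  exact: continuous_funM.
apply: (@Ck_intro _ _ (fun i x => f x * partial i g x + g x * partial i f x)).
- by apply: continuous_funM; [exact: (Ck_continuous Cf)|exact: (Ck_continuous Cg)].
- by move=> i x; exact: (is_deriveM (Ck_derivable i x Cf) (Ck_derivable i x Cg)).
- by move=> i; apply: CkD; apply: IH; solve [exact: CkW|exact: Ck_partial].
Qed.

Lemma CkN k f : Ck k f -> Ck k (fun x => - f x).
Proof.
move=> /(CkM (Ck_cst k (-1))); congr Ck.
by apply/funext => x /=; rewrite mulN1r.
Qed.

Lemma CkB k f g : Ck k f -> Ck k g -> Ck k (fun x => f x - g x).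
Proof. by move=> Cf Cg; apply: CkD => //; exact: CkN. Qed.

Lemma CkV k f : (forall x, f x != 0) -> Ck k f -> Ck k (fun x => (f x)^-1).
Proof.
move=> f0; elim: k => [|k IH] Cf; first exact: continuous_funV.
apply: (@Ck_intro _ _ (fun i x => - ((f x)^-1 * (f x)^-1 * partial i f x))).
- by apply: continuous_funV => //; exact: (Ck_continuous Cf).
- move=> i x; have [df dE] := Ck_derivable i x Cf.
  split; first exact: derivableV.
  by rewrite deriveV// dE /GRing.scale/= mulNr -exprVn expr2.
- move=> i; apply/CkN/CkM; last exact: Ck_partial.
  by apply: CkM; apply: IH; exact: CkW.
Qed.

Lemma is_derive_coord i j (x : 'rV[R]_n) :
  is_derive x (ei i) (fun y : 'rV[R]_n => y ord0 j) (j == i)%:R.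
Proof.
apply/is_derive_line0.
rewrite (_ : (fun _ => _) = (fun h : R => h * (j == i)%:R + x ord0 j)); last first.
  by apply/funext => h; rewrite !mxE eqxx.
apply: is_derive_eq.
by rewrite /GRing.scale/= !(mulr0, mulr1, addr0, add0r).
Qed.

Lemma Ck_coord k j : Ck k (fun y : 'rV[R]_n => y ord0 j).
Proof.
have cj : continuous (fun y : 'rV[R]_n => y ord0 j) by exact: coord_continuous.
case: k => [//|k]; apply: (Ck_intro cj (is_derive_coord ^~ j)) => i.
exact: Ck_cst.
Qed.

Lemma Ck_prod k (I : Type) (s : seq I) (F : I -> 'rV[R]_n -> R) :
  (forall a, Ck k (F a)) -> Ck k (fun x => \prod_(a <- s) F a x).
Proof.
move=> CF; elim: s => [|i s IH].
  under eq_fun do rewrite big_nil; exact: Ck_cst.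
by under eq_fun do rewrite big_cons; exact: CkM.
Qed.

Lemma Ck_scale k f (c : R) (q : 'rV[R]_n) : Ck k f ->
  Ck k (fun x => f (c *: (x - q))).
Proof.
have cc : continuous (fun x : 'rV[R]_n => c *: (x - q)).
  by apply: continuous_affine.
elim: k f => [|k IH] f Cf.
  exact: (continuous_fun_comp cc Cf).
apply: (@Ck_intro _ _ (fun i x => c * partial i f (c *: (x - q)))).
- exact: (continuous_fun_comp cc (Ck_continuous Cf)).
- move=> i x; apply/is_derive_line0.
  have /is_derive_line0 Df := Ck_derivable i (c *: (x - q)) Cf.
  have Dc : is_derive (0 : R) 1 (fun h : R => c * h) c.
    apply: is_derive_eq.
    by rewrite /GRing.scale/= !(mulr0, mulr1, addr0, add0r).
  have := @is_derive1_comp R (fun h => f (h *: ei i + c *: (x - q)))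
    (fun h => c * h) 0 _ _ _ Dc; rewrite mulr0 => /(_ _ Df).
  rewrite mulrC; congr is_derive; apply/funext => h /=; congr f.
  by rewrite -scalerA -scalerDr addrA.
- by move=> i; apply: CkM; [exact: Ck_cst|apply: IH; exact: Ck_partial].
Qed.

Lemma partial_eq0 f (A : set 'rV[R]_n) i : closed A ->
  (forall x, ~ A x -> f x = 0) -> forall x, ~ A x -> partial i f x = 0.
Proof.
move=> cA f0 x Ax; have oA : open (~` A) by rewrite openC.
have xA : \forall y \near x, f y = cst 0 y.
  by apply: filterS (open_nbhs_nbhs (conj oA Ax)) => y; exact: f0.
rewrite /partial (near_eq_derive _ xA) ?derive_cst//.
Qed.

End Ck.

Section flat.
Context (R : realType).

(** The functions [t^-k exp(-1/t)], extended by zero: each is smooth because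
    the derivative of one of them is a combination of the next two. *)
Definition flat (k : nat) (t : R) : R :=
  if 0 < t then t^-1 ^+ k * expR (- t^-1) else 0.

Lemma flat_ge0 k t : 0 <= flat k t.
Proof.
rewrite /flat; case: ifPn => // t0.
by rewrite mulr_ge0 ?expR_ge0// exprn_ge0// invr_ge0 ltW.
Qed.

Lemma flat_gt0 t : 0 < t -> 0 < flat 0 t.
Proof. by move=> t0; rewrite /flat t0 expr0 mul1r expR_gt0. Qed.

Lemma flat_le0 k t : t <= 0 -> flat k t = 0.
Proof. by rewrite /flat leNgt => /negbTE ->. Qed.

(** [exp s >= (s / (k + 1)) ^ (k + 1)] for [s = 1 / t]. Applied to [flat k.+1],
    the difference quotient of [flat k] at 0, it shows that the latter has
    derivative 0 there. *)
Lemma flat_bound k t : flat k t <= k.+1%:R ^+ k.+1 * `|t|.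
Proof.
rewrite /flat; case: ifPn => [t0|_]; last by rewrite mulr_ge0// exprn_ge0.
rewrite (gtr0_norm t0); set s := t^-1; have s0 : 0 < s by rewrite invr_gt0.
have -> : t = s^-1 by rewrite invrK.
rewrite ler_pdivlMr// mulrAC -exprSr expRN -ler_pdivlMr ?invr_gt0 ?expR_gt0//.
rewrite invrK -ler_pdivrMl ?exprn_gt0// -exprVn -exprMn.
have -> : expR s = expR (k.+1%:R^-1 * s) ^+ k.+1.
  by rewrite -expRM_natl mulrA divff// mul1r.
rewrite lerXn2r ?nnegrE ?expR_ge0// ?mulr_ge0 ?(ltW s0)//.
by apply: le_trans (expR_ge1Dx _); rewrite lerDr.
Qed.

Lemma flat_is_derive k (t : R) :
  is_derive t 1 (flat k) (- k%:R * flat k.+1 t + flat k.+2 t).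
Proof.
have [t0|t0|->] := ltgtP t 0.
- have tE : \forall y \near t, cst 0 y = flat k y.
    have := open_nbhs_nbhs (conj (@open_lt R 0) t0).
    by apply: filterS => y /ltW /flat_le0 ->.
  rewrite !flat_le0 ?(ltW t0)// mulr0 addr0.
  exact: (near_eq_is_derive tE).
- have tE : \forall y \near t, (fun y => y^-1 ^+ k * expR (- y^-1)) y = flat k y.
    have := open_nbhs_nbhs (conj (@open_gt R 0) t0).
    by apply: filterS => y /= y0; rewrite /flat y0.
  apply: (near_eq_is_derive tE).
  have tn0 : t != 0 by rewrite gt_eqF.
  have DV := is_deriveV tn0 (is_derive_id t 1).
  have DE : is_derive t 1 (fun y => expR (- y^-1)) (expR (- t^-1) * (t ^- 2)).
    apply: (@is_derive1_comp R expR (fun y => - y^-1)) => //.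
    apply: is_derive_eq.
    by rewrite /GRing.scale/= mulr1 opprK.
  have DP : is_derive t 1 (fun y : R => y^-1 ^+ k) (- k%:R * t^-1 ^+ k.+1).
    case: k {tE} => [|k].
      by rewrite oppr0 mul0r; exact: is_derive_cst.
    rewrite (_ : (fun y => _) = (GRing.inv : R -> R) ^+ k.+1); last first.
      by apply/funext => y; rewrite exprfctE.
    apply: (is_derive_eq (is_deriveX k.+1 DV)).
    by rewrite -exprVn /GRing.scale/= !exprS; ring.
  apply: (is_derive_eq (is_deriveM DP DE)).
  by rewrite /flat t0 /GRing.scale/= -exprVn !exprS; ring.
- rewrite !flat_le0// mulr0 addr0.
  have fl0 : (fun h : R => h^-1 *: ((flat k \o shift 0) (h *: 1) - flat k 0))
      @ 0^' --> (0 : R).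
    apply/cvgr0Pnorm_le => e e0; near=> h.
    have hn0 : h != 0 by near: h; exact: nbhs_dnbhs_neq.
    rewrite /= addr0 (@flat_le0 k 0)// subr0 /GRing.scale/= mulr1.
    have -> : h^-1 * flat k h = flat k.+1 h.
      by rewrite /flat; case: ifP; rewrite ?mulr0// mulrA -exprS.
    rewrite ger0_norm ?flat_ge0//; apply: le_trans (flat_bound _ _) _.
    rewrite -ler_pdivlMl ?exprn_gt0//.
    near: h; apply: dnbhs0_le.
    by rewrite mulr_gt0// invr_gt0 exprn_gt0.
  by split; [apply/cvg_ex; exists 0|exact: cvg_lim].
Unshelve. all: by end_near. Qed.

Lemma Ck_flat n k l (f : 'rV[R]_n -> R) : Ck k f -> Ck k (flat l \o f).
Proof.
have cfl m : continuous (flat m).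
  by move=> t; apply/differentiable_continuous/derivable1_diffP;
    case: (flat_is_derive m t).
elim: k l f => [|k IH] l f Cf.
  exact: continuous_fun_comp.
apply: (@Ck_intro _ _ _ _ (fun i x =>
    (- l%:R * flat l.+1 (f x) + flat l.+2 (f x)) * partial i f x)).
- by apply: continuous_fun_comp => //; exact: (Ck_continuous Cf).
- by move=> i x; exact: (is_derive_comp1 (Ck_derivable i x Cf) (flat_is_derive l (f x))).
- move=> i; apply: CkM; last exact: Ck_partial.
  apply: CkD; last by apply: IH; exact: CkW.
  by apply: CkM; [exact: Ck_cst|apply: IH; exact: CkW].
Qed.

End flat.

Section cutoff.
Context (R : realType) (n : nat).
Implicit Types (x q : 'rV[R]_n) (r : R) (i : 'I_n).

(** [num] vanishes for [|t| >= 2], and the second summand of [den] for [|t| <= 1];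
    they do not vanish together, so the quotient is a smooth bump. *)
Let num (t : R) := flat 0 (4 - t * t).
Let den (t : R) := num t + flat 0 (t * t - 1).

Let den_gt0 t : 0 < den t.
Proof.
rewrite /den /num; have [t4|t4] := ltP (t * t) 4.
  by rewrite ltr_pwDl ?flat_ge0// flat_gt0// subr_gt0.
rewrite ltr_wpDl ?flat_ge0// flat_gt0// subr_gt0.
by apply: lt_le_trans t4; rewrite ltr1n.
Qed.

Definition unit_cutoff x : R := \prod_(i < n) (num (x ord0 i) / den (x ord0 i)).

Let factor_itv t : 0 <= num t / den t <= 1.
Proof.
rewrite divr_ge0 ?flat_ge0 ?(ltW (den_gt0 _))//=.
by rewrite ler_pdivrMr ?den_gt0// mul1r lerDl flat_ge0.
Qed.

Lemma Ck_unit_cutoff k : Ck k unit_cutoff.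
Proof.
apply: Ck_prod => i; have Ci := @Ck_coord R n k i.
have Cnum : Ck k (fun x : 'rV[R]_n => num (x ord0 i)).
  apply: (@Ck_flat R n k 0 (fun x => 4 - x ord0 i * x ord0 i)).
  by apply: CkB; [exact: Ck_cst|exact: CkM].
apply: CkM => //; apply: CkV; first by move=> x; rewrite gt_eqF// den_gt0.
apply: CkD => //.
apply: (@Ck_flat R n k 0 (fun x => x ord0 i * x ord0 i - 1)).
by apply: CkB; [exact: CkM|exact: Ck_cst].
Qed.

Lemma unit_cutoff_itv x : 0 <= unit_cutoff x <= 1.
Proof.
rewrite /unit_cutoff; elim/big_ind: _ => //; first by rewrite ler01 lexx.
by move=> a c /andP[a0 a1] /andP[c0 c1]; rewrite mulr_ge0//= mulr_ile1.
Qed.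

Lemma unit_cutoff1 x : cube 0 1 x -> unit_cutoff x = 1.
Proof.
move=> cx; rewrite /unit_cutoff big1// => i _.
have := cx i; rewrite mxE subr0 => x1.
rewrite /den (@flat_le0 _ 0 (_ - 1)) ?addr0 ?divff//.
  rewrite gt_eqF// flat_gt0// subr_gt0.
  by rewrite (@le_lt_trans _ _ 1) ?ltr1n// -expr2 -real_normK ?num_real// expr_le1.
by rewrite subr_le0 -expr2 -real_normK ?num_real// expr_le1.
Qed.

Lemma unit_cutoff0 x : ~ cube 0 2 x -> unit_cutoff x = 0.
Proof.
move=> /existsNP[i /negP]; rewrite mxE subr0 -ltNge => xi.
rewrite /unit_cutoff (bigD1 i)//= /num flat_le0 ?mul0r//.
rewrite subr_le0 -expr2 -real_normK ?num_real// (_ : 4 = 2 ^+ 2); last by ring.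
by rewrite lerXn2r// ?nnegrE// ltW.
Qed.

(** Every cutoff is a rescaled copy of this one, so that a bound [C] here gives
    the bound [C / r] at the scale [r], with [C] independent of the cube. *)
Lemma unit_cutoff_partial_bounded :
  exists2 C : R, 0 < C & forall i x, `|partial i unit_cutoff x| <= C.
Proof.
have cK := @compact_cube R n 0 2.
have B i : exists C : R, forall x, `|partial i unit_cutoff x| <= C.
  have cp : continuous (partial i unit_cutoff).
    by apply: (@Ck_continuous _ _ 0); exact/Ck_partial/Ck_unit_cutoff.
  have : bounded_set (partial i unit_cutoff @` cube 0 2).
    apply: compact_bounded; apply: continuous_compact => //.
    exact: continuous_subspaceT.
  move=> [M [_ MC]]; exists (Num.max 0 (M + 1)) => x.
  have [cx|cx] := pselect (cube 0 2 x).
    rewrite le_max (MC (M + 1)) ?orbT ?ltrDl//.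
  rewrite (@partial_eq0 _ _ _ (cube 0 2)) ?normr0 ?le_max ?lexx//.
  - exact: (compact_closed (@norm_hausdorff _ _)).
  - exact: unit_cutoff0.
have /choice[C HC] := B; exists (1 + \sum_i `|C i|).
  by rewrite ltr_pwDl// sumr_ge0.
move=> i x; rewrite (le_trans (HC i x))// (le_trans (ler_norm _))//.
by rewrite (bigD1 i)//= addrCA lerDl addr_ge0// sumr_ge0.
Qed.

Definition cutoff q r x : R := unit_cutoff (r^-1 *: (x - q)).

Lemma Ck_cutoff k q r : Ck k (cutoff q r).
Proof. exact/Ck_scale/Ck_unit_cutoff. Qed.

Lemma cutoff_itv q r x : 0 <= cutoff q r x <= 1.
Proof. exact: unit_cutoff_itv. Qed.

Let cube_scale q r s x : 0 < r ->
  cube 0 s (r^-1 *: (x - q)) <-> cube q (s * r) x.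
Proof.
move=> r0; split=> cx i; have := cx i; rewrite !mxE subr0 normrM normfV (gtr0_norm r0).
  by rewrite ler_pdivrMl// mulrC.
by move=> xs; rewrite ler_pdivrMl// mulrC.
Qed.

Lemma cutoff1 q r x : 0 < r -> cube q r x -> cutoff q r x = 1.
Proof.
move=> r0 cx; apply: unit_cutoff1; apply/(cube_scale _ _ _ r0).
by rewrite mul1r.
Qed.

Lemma cutoff0 q r x : 0 < r -> ~ cube q (2 * r) x -> cutoff q r x = 0.
Proof.
by move=> r0 cx; apply: unit_cutoff0 => /(cube_scale _ _ _ r0).
Qed.

Lemma partial_cutoff q r i x :
  partial i (cutoff q r) x = r^-1 * partial i unit_cutoff (r^-1 *: (x - q)).
Proof.
apply: is_derive_partial.
apply/is_derive_line0.
have /is_derive_line0 Df :=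
  Ck_derivable i (r^-1 *: (x - q)) (Ck_unit_cutoff 1).
have Dc : is_derive (0 : R) 1 (fun h : R => r^-1 * h) r^-1.
  apply: is_derive_eq.
  by rewrite /GRing.scale/= !(mulr0, mulr1, addr0, add0r).
have := @is_derive1_comp R (fun h => unit_cutoff (h *: delta_mx ord0 i +
  r^-1 *: (x - q))) (fun h => r^-1 * h) 0 _ _ _ Dc; rewrite mulr0 => /(_ _ Df).
rewrite mulrC; congr is_derive; apply/funext => h /=; rewrite /cutoff; congr unit_cutoff.
by rewrite -scalerA -scalerDr addrA.
Qed.

End cutoff.

(** * Test functions and the vanishing of integrals of partials *)

Section compact_support.
Context (R : realType) (n : nat).
Implicit Types (f g : 'rV[R]_n -> R) (K D : set 'rV[R]_n).

Lemma continuous_compact_bound f K : continuous f -> compact K ->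
  exists2 C, 0 <= C & forall x, K x -> `|f x| <= C.
Proof.
move=> cf cK; have : bounded_set (f @` K).
  apply: compact_bounded; apply: continuous_compact => //.
  exact: continuous_subspaceT.
move=> [M [_ MC]]; exists (Num.max 0 (M + 1)); first by rewrite le_max lexx.
by move=> x Kx; rewrite le_max (MC (M + 1)) ?orbT ?ltrDl//; exists x.
Qed.

Lemma compact_sub_cube K : compact K -> exists2 M, 0 < M & K `<=` cube 0 M.
Proof.
move=> cK.
have /choice[C HC] : forall i : 'I_n, exists C : R,
    0 <= C /\ forall x, K x -> `|x ord0 i| <= C.
  move=> i; have [] := @continuous_compact_bound (fun x => x ord0 i) K.
  - exact: coord_continuous.
  - exact: cK.
  - by move=> C C0 HC; exists C.
exists (1 + \sum_i C i).
  by rewrite ltr_pwDl// sumr_ge0// => i _; have [] := HC i.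
move=> x Kx i; rewrite mxE subr0; have [C0 /(_ _ Kx)/le_trans->//] := HC i.
by rewrite (bigD1 i)//= addrCA lerDl addr_ge0// sumr_ge0// => j _; have [] := HC j.
Qed.

Lemma compact_finite_measure K : compact K -> (lebesgue_rV K < +oo)%E.
Proof.
move=> cK; have [M M0 KM] := compact_sub_cube cK.
apply: (@le_lt_trans _ _ (lebesgue_rV (cube 0 M))).
  by apply: le_measure; rewrite ?inE//;
    [exact: compact_measurable_rV|exact: measurable_cube].
by rewrite lebesgue_cube ?ltry// ltW.
Qed.

Lemma continuous_integrable f K : continuous f -> compact K ->
  lebesgue_rV.-integrable K (EFin \o f).
Proof.
move=> cf cK; apply: measurable_bounded_integrable.
- exact: compact_measurable_rV.
- exact: compact_finite_measure.
- exact: continuous_measurable_rV.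
- have [C C0 fC] := continuous_compact_bound cf cK.
  exists C; split; first exact: num_real.
  by move=> M CM x Kx; apply: (le_trans (fC x Kx)); exact: ltW.
Qed.

Lemma integral_off (D E : set 'rV[R]_n) (f : 'rV[R]_n -> \bar R) : E `<=` D ->
  (forall x, D x -> ~ E x -> f x = 0%E) ->
  (\int[lebesgue_rV]_(x in D) f x = \int[lebesgue_rV]_(x in E) f x)%E.
Proof.
move=> ED f0; rewrite integral_mkcond [RHS]integral_mkcond.
apply: eq_integral => x _; rewrite !patchE.
have [/set_mem Ex|/negP nEx] := boolP (x \in E); first by rewrite mem_set//; exact: ED.
case: ifPn => // /set_mem Dx; apply: f0 => // Ex; exact/nEx/mem_set.
Qed.

Lemma integrable_off (D E : set 'rV[R]_n) (f : 'rV[R]_n -> \bar R) :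
  measurable D -> measurable E -> E `<=` D ->
  (forall x, D x -> ~ E x -> f x = 0%E) ->
  lebesgue_rV.-integrable E f -> lebesgue_rV.-integrable D f.
Proof.
move=> mD mE ED f0 /(integrable_mkcond _ mE) fi; apply/integrable_mkcond => //.
rewrite (_ : f \_ D = f \_ E)//; apply/funext => x; rewrite !patchE.
have [/set_mem Ex|/negP nEx] := boolP (x \in E); first by rewrite mem_set//; exact: ED.
case: ifPn => // /set_mem Dx; apply: f0 => // Ex; exact/nEx/mem_set.
Qed.

(** A closed set outside of which [f] vanishes contains the support. *)
Lemma test_function_intro D K f : smooth f -> compact K -> K `<=` D ->
  (forall x, ~ K x -> f x = 0) -> test_function D f.
Proof.
move=> sf cK KD f0; have clK : closed K by exact: (compact_closed (@norm_hausdorff _ _)).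
have sK : closure [set x | f x != 0] `<=` K.
  rewrite (closure_id K).1//; apply: closure_subset => x /= fx.
  by apply: contrapT => /f0 /eqP; rewrite (negbTE fx).
split=> //; last exact: subset_trans KD.
by apply: (subclosed_compact _ cK) => //; exact: closed_closure.
Qed.

Lemma test_function_compact D f : test_function D f ->
  exists K, [/\ compact K, K `<=` D & forall x, ~ K x -> f x = 0].
Proof.
move=> [sf cK KD]; exists (closure [set x | f x != 0]); split => // x.
by move=> nx; apply/eqP; apply: contra_notT nx => fx; exact: subset_closure.
Qed.

Lemma test_function_smooth D f : test_function D f -> smooth f.
Proof. by case. Qed.

Lemma test_function_Ck D f k : test_function D f -> Ck k f.
Proof. by move=> /test_function_smooth; exact: smooth_Ck. Qed.

Lemma test_function_continuous D f : test_function D f -> continuous f.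
Proof. by move=> tf; exact: (test_function_Ck 0 tf). Qed.

Lemma test_function_partial D f i : test_function D f ->
  test_function D (partial i f).
Proof.
move=> tf; have [K [cK KD f0]] := test_function_compact tf.
apply: (test_function_intro _ cK KD).
  exact/smooth_partial/(test_function_smooth tf).
by apply: partial_eq0 => //; exact: (compact_closed (@norm_hausdorff _ _)).
Qed.

Lemma test_functionD D f g : test_function D f -> test_function D g ->
  test_function D (fun x => f x + g x).
Proof.
move=> tf tg; have [K [cK KD f0]] := test_function_compact tf.
have [L [cL LD g0]] := test_function_compact tg.
apply: (test_function_intro _ (compactU cK cL)).
- by apply: Ck_smooth => k; apply: CkD;
    [exact: test_function_Ck tf|exact: test_function_Ck tg].
- by move=> x []; [exact: KD|exact: LD].
- by move=> x /not_orP[/f0 -> /g0 ->]; rewrite addr0.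
Qed.

Lemma test_functionM D f g : smooth f -> test_function D g ->
  test_function D (fun x => f x * g x).
Proof.
move=> sf tg; have [L [cL LD g0]] := test_function_compact tg.
apply: (test_function_intro _ cL LD).
- by apply: Ck_smooth => k; apply: CkM;
    [exact: smooth_Ck|exact: test_function_Ck tg].
- by move=> x /g0 ->; rewrite mulr0.
Qed.

Lemma test_functionS D E f : D `<=` E -> test_function D f -> test_function E f.
Proof. by move=> DE [sf cK KD]; split => //; exact: subset_trans DE. Qed.

Lemma test_function0 D : test_function D (cst 0).
Proof.
apply: (test_function_intro _ (@compact0 _)) => //.
by apply: Ck_smooth => k; exact: Ck_cst.
Qed.

Lemma test_function_cutoff D q r : 0 < r -> cube q (2 * r) `<=` D ->
  test_function D (cutoff q r).
Proof.
move=> r0 qD; apply: (test_function_intro _ (@compact_cube _ _ q (2 * r))) => //.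
- by apply: Ck_smooth => k; exact: Ck_cutoff.
- by move=> x; exact: cutoff0.
Qed.

Lemma test_function_integrable D f : measurable D -> test_function D f ->
  lebesgue_rV.-integrable D (EFin \o f).
Proof.
move=> mD tf; have [K [cK KD f0]] := test_function_compact tf.
apply: (@integrable_off D K) => //.
- exact: compact_measurable_rV.
- by move=> x _ /f0 /= ->.
- by apply: continuous_integrable => //; exact: test_function_continuous tf.
Qed.

End compact_support.

Section cons_calculus.
Context (R : realType) (n : nat).
Implicit Types (f : 'rV[R]_n.+1 -> R) (x : 'rV[R]_n) (t : R).

Lemma cons_rV_tail t x (j : 'I_n) h :
  cons_rV (t, h *: delta_mx ord0 j + x) =
  h *: delta_mx ord0 (lift ord0 j) + cons_rV (t, x) :> 'rV[R]_n.+1.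
Proof.
apply/rowP => k; rewrite !mxE; case: (unliftP ord0 k) => [l ->|->].
  by rewrite /= !mxE (inj_eq lift_inj).
by rewrite (negbTE (neq_lift _ _)) andbF mulr0 add0r.
Qed.

Lemma cons_rV_head t x :
  cons_rV (t, x) = t *: delta_mx ord0 ord0 + cons_rV (0, x) :> 'rV[R]_n.+1.
Proof.
apply/rowP => k; rewrite !mxE; case: (unliftP ord0 k) => [l ->|->].
  by rewrite [lift _ _ == _]eq_sym (negbTE (neq_lift _ _)) andbF mulr0 add0r.
by rewrite !eqxx mulr1 addr0.
Qed.

Lemma continuous_cons_tail t : continuous (fun x => cons_rV (t, x) : 'rV[R]_n.+1).
Proof.
move=> x s /= /nbhs_ballP[e /= e0 es]; apply/nbhs_ballP; exists e => //= y [_ xy].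
apply: es; split=> // i k; rewrite !mxE.
case: (unliftP ord0 k) => [l _|_]; last exact: ballxx.
by have := xy ord0 l.
Qed.

Lemma continuous_cons_head x : continuous (fun t => cons_rV (t, x) : 'rV[R]_n.+1).
Proof.
move=> t s /= /nbhs_ballP[e /= e0 es]; apply/nbhs_ballP; exists e => //= y ty.
apply: es; split=> // i k; rewrite !mxE.
by case: (unliftP ord0 k) => [l _|_]; first exact: ballxx.
Qed.

Lemma is_derive_cons_tail f t x j d :
  is_derive (cons_rV (t, x) : 'rV[R]_n.+1) (delta_mx ord0 (lift ord0 j)) f d ->
  is_derive x (delta_mx ord0 j) (fun x => f (cons_rV (t, x))) d.
Proof.
move=> /is_derive_line0 Df; apply/is_derive_line0; move: Df.
by congr is_derive; apply/funext => h; rewrite cons_rV_tail.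
Qed.

Lemma is_derive_cons_head f t x d :
  is_derive (cons_rV (t, x) : 'rV[R]_n.+1) (delta_mx ord0 ord0) f d ->
  is_derive t 1 (fun t => f (cons_rV (t, x))) d.
Proof.
rewrite cons_rV_head => /is_derive_line; congr is_derive.
by apply/funext => h; rewrite -cons_rV_head.
Qed.

Lemma Ck_cons_tail k f t : Ck k f -> Ck k (fun x => f (cons_rV (t, x))).
Proof.
elim: k f => [|k IH] f Cf.
  by apply: (continuous_fun_comp _ Cf); exact: continuous_cons_tail.
apply: (@Ck_intro _ _ _ _ (fun j x => partial (lift ord0 j) f (cons_rV (t, x)))).
- apply: (continuous_fun_comp _ (Ck_continuous Cf)); exact: continuous_cons_tail.
- by move=> j x; apply: is_derive_cons_tail; exact: (Ck_derivable _ _ Cf).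
- by move=> j; apply: IH; exact: Ck_partial.
Qed.

Lemma partial_cons_tail f t j x : Ck 1 f ->
  partial j (fun x => f (cons_rV (t, x))) x = partial (lift ord0 j) f (cons_rV (t, x)).
Proof.
move=> Cf; apply: is_derive_partial; apply: is_derive_cons_tail.
exact: (Ck_derivable _ _ Cf).
Qed.

Lemma continuous_slice f x : continuous f ->
  continuous (fun t => f (cons_rV (t, x))).
Proof.
by move=> cf; apply: (continuous_fun_comp _ cf); exact: continuous_cons_head.
Qed.

Lemma cube_cons M t x : cube 0 M (cons_rV (t, x) : 'rV[R]_n.+1) <->
  `|t| <= M /\ cube 0 M x.
Proof.
split=> [c|[tM c] k].
  split; first by have := c ord0; rewrite !mxE unlift_none subr0.
  by move=> j; have := c (lift ord0 j); rewrite !mxE liftK !subr0.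
rewrite !mxE; case: (unliftP ord0 k) => [l _|_]; last by rewrite subr0.
by have := c l; rewrite mxE.
Qed.

Lemma FTC_slice f x (a b : R) : Ck 1 f -> a < b ->
  (\int[lebesgue_measure]_(t in `[a, b]) (partial ord0 f (cons_rV (t, x)))%:E =
   (f (cons_rV (b, x)) - f (cons_rV (a, x)))%:E)%E.
Proof.
move=> Cf ab; rewrite EFinB.
have cf : continuous (fun t => f (cons_rV (t, x))).
  by apply: continuous_slice; exact: Ck_continuous Cf.
have Df t : is_derive t 1 (fun t => f (cons_rV (t, x)))
    (partial ord0 f (cons_rV (t, x))).
  by apply: is_derive_cons_head; exact: (Ck_derivable _ _ Cf).
apply: (@continuous_FTC2 R (fun t => partial ord0 f (cons_rV (t, x)))
  (fun t => f (cons_rV (t, x))) a b ab).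
- apply: continuous_subspaceT; apply: continuous_slice.
  exact: (Ck_continuous (Ck_partial ord0 Cf)).
- split.
  + by move=> t _; case: (Df t).
  + by apply: cvg_at_right_filter; exact: cf.
  + by apply: cvg_at_left_filter; exact: cf.
- by move=> t _; rewrite derive1E; case: (Df t).
Qed.

End cons_calculus.

(** For the first coordinate this is the fundamental theorem of calculus on the
    slices; for the others, induction on the dimension applies to the slices. *)
Lemma integral_partial0 (R : realType) n (f : 'rV[R]_n -> R) M i :
  Ck 1 f -> (forall x, ~ cube 0 M x -> f x = 0) ->
  (\int[borel_lebesgue R n]_x (partial i f x)%:E = 0)%E.
Proof.
elim: n f i => [f [] //|n IH f i Cf f0].
have clM k : closed (cube 0 M : set 'rV[R]_k).
  apply: (compact_closed (@norm_hausdorff _ _)); exact: compact_cube.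
have df0 := partial_eq0 i (clM _) f0.
have cdf : continuous (partial i f) by exact: (Ck_continuous (Ck_partial i Cf)).
have fi : (borel_lebesgue R n.+1).-integrable setT (EFin \o partial i f).
  have [C C0 fC] := continuous_compact_bound cdf (@compact_cube _ _ 0 M).
  have mM := @borel_cube R n.+1 0 M.
  have E : (EFin \o partial i f : borel_rV R n.+1 -> \bar R) =
      (EFin \o partial i f) \_ (cube 0 M).
    apply/funext => x; rewrite patchE; case: ifPn => // /negP xM /=.
    by rewrite df0// => /mem_set.
  rewrite E; apply/(integrable_mkcond _ mM).
  apply: measurable_bounded_integrable => //.
  - have := compact_finite_measure (@compact_cube R n.+1 0 M).
    by rewrite lebesgue_rV_borel.
  - by apply: measurable_funTS; exact: continuous_borel.
  - exists C; split; first exact: num_real.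
    by move=> N CN x xM; apply: (le_trans (fC x xM)); exact: ltW.
case: (unliftP ord0 i) => [j ij|i0].
  rewrite integral_cons//= integral0_eq// => t _.
  transitivity (\int[borel_lebesgue R n]_x
      (partial j (fun x => f (cons_rV (t, x))) x)%:E)%E.
    by apply: eq_integral => x _; rewrite (partial_cons_tail t j x Cf) ij.
  apply: IH; first exact: Ck_cons_tail.
  by move=> x nx; apply: f0 => /cube_cons[].
rewrite integral_cons2//= integral0_eq// => x _.
pose N : R := `|M| + 1; have N0 : 0 < N by rewrite ltr_wpDl.
have ge_cube t : N <= `|t| -> ~ cube 0 M (cons_rV (t, x) : 'rV[R]_n.+1).
  move=> Nt /cube_cons[tM _]; have := le_trans Nt (le_trans tM (ler_norm M)).
  by rewrite leNgt ltrDl ltr01.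
transitivity (\int[lebesgue_measure]_(t in [set` `[(- N)%R, N]])
    (partial i f (cons_rV (t, x)))%:E)%E.
  rewrite [RHS]integral_mkcond; apply: eq_integral => t _; rewrite patchE.
  case: ifPn => // /negP tN; rewrite df0//; apply: ge_cube; rewrite leNgt.
  by apply/negP => /ltW; rewrite ler_norml => tN'; apply: tN; rewrite inE.
rewrite i0 FTC_slice//; last by rewrite gtrN.
by rewrite !f0 ?subrr//; apply: ge_cube; rewrite ?normrN gtr0_norm.
Qed.

(** * Weak derivatives *)

Section Lp.
Context (R : realType) (n : nat).
Implicit Types (f g : 'rV[R]_n -> R) (D K : set 'rV[R]_n).

Lemma Lp1_integrable D f : measurable D ->
  Lp D 1 f <-> lebesgue_rV.-integrable D (EFin \o f).
Proof.
move=> mD; have E : Lpnorm D 1 f = (\int[lebesgue_rV]_(x in D) `|(f x)%:E|)%E.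
  rewrite /Lpnorm Lnorm1 [RHS]integral_mkcond; apply: eq_integral => x _.
  by rewrite /= !patchE; case: ifP => //=; rewrite normr0.
rewrite /Lp E; split=> [[mf foo]|/integrableP[mf foo]].
  by apply/integrableP; split => //; exact/measurable_EFinP.
by split => //; exact/measurable_EFinP.
Qed.

Lemma Lpnorm2 D f :
  (Lpnorm D 2 f `^ 2 = \int[lebesgue_rV]_(x in D) (f x ^+ 2)%:E)%E.
Proof.
rewrite /Lpnorm poweR_Lnorm// [RHS]integral_mkcond.
apply: eq_integral => x _; rewrite /= !patchE; case: ifP => _ /=.
  by rewrite powR_mulrn// real_normK// num_real.
by rewrite normr0 powR0.
Qed.

Lemma Lp2_integrable D f : measurable D ->
  Lp D 2 f <-> measurable_fun D f /\
    lebesgue_rV.-integrable D (fun x => (f x ^+ 2)%:E).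
Proof.
move=> mD.
have E : (Lpnorm D 2 f < +oo)%E <->
    (\int[lebesgue_rV]_(x in D) (f x ^+ 2)%:E < +oo)%E.
  rewrite -Lpnorm2; split=> [foo|].
    by apply: poweR_lty; rewrite ?foo.
  have := Lnorm_ge0 lebesgue_rV 2%:E (EFin \o (f \_ D)).
  rewrite -/(Lpnorm D 2 f); case: (Lpnorm D 2 f) => //= [r _ _|_].
    exact: ltry.
  by rewrite pnatr_eq0.
rewrite /Lp E; split=> -[mf foo]; split => //.
  apply/integrableP; split.
    by apply/measurable_EFinP; exact: measurable_funX.
  under eq_integral do rewrite gee0_abs ?lee_fin ?sqr_ge0//.
  exact: foo.
move/integrableP : foo => [_].
by under eq_integral do rewrite gee0_abs ?lee_fin ?sqr_ge0//.
Qed.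

Lemma Lpnorm2_lt D f (c : R) : (Lpnorm D 2 f < c%:E)%E ->
  (\int[lebesgue_rV]_(x in D) (f x ^+ 2)%:E <= (c ^+ 2)%:E)%E.
Proof.
move=> fc; rewrite -Lpnorm2.
have := Lnorm_ge0 lebesgue_rV 2%:E (EFin \o (f \_ D)).
rewrite -/(Lpnorm D 2 f); case: (Lpnorm D 2 f) fc => //= r.
rewrite lte_fin !lee_fin => /ltW rc r0.
by rewrite powR_mulrn// lerXn2r// ?nnegrE// (le_trans r0).
Qed.

Lemma Lp_loc1P D f : Lp_loc D 1 f <->
  forall K, compact K -> K `<=` D -> lebesgue_rV.-integrable K (EFin \o f).
Proof.
split=> H K cK KD; first by apply/Lp1_integrable;
  [exact: compact_measurable_rV|exact: H].
by apply/Lp1_integrable; [exact: compact_measurable_rV|exact: H].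
Qed.

Lemma integrable_bounded_mul D g f : measurable D ->
  lebesgue_rV.-integrable D (EFin \o g) -> measurable_fun D f ->
  (exists C, forall x, D x -> `|f x| <= C) ->
  lebesgue_rV.-integrable D (fun x => (g x * f x)%:E).
Proof.
move=> mD gi mf [C fC].
have mg : measurable_fun D g by apply/measurable_EFinP; case/integrableP : gi.
apply: (@le_integrable _ _ _ _ _ mD _ (fun x => C%:E * (g x)%:E)%E).
- by apply/measurable_EFinP; exact: measurable_funM.
- move=> x Dx; rewrite -EFinM !abse_EFin lee_fin !normrM mulrC.
  by rewrite ler_wpM2r// (le_trans (fC x Dx))// ler_norm.
- exact: integrableZl.
Qed.

Lemma Lp_loc_test_integrable D g f : measurable D -> Lp_loc D 1 g ->
  test_function D f -> lebesgue_rV.-integrable D (fun x => (g x * f x)%:E).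
Proof.
move=> mD /Lp_loc1P gi tf; have [K [cK KD f0]] := test_function_compact tf.
have cf := test_function_continuous tf.
have mK : measurable K by exact: compact_measurable_rV.
apply: (integrable_off mD mK KD).
  by move=> x _ /f0 ->; rewrite mulr0.
apply: integrable_bounded_mul => //; first exact: gi.
  exact: continuous_measurable_rV.
by have [C C0 fC] := continuous_compact_bound cf cK; exists C.
Qed.

Lemma continuous_Lp_loc D f : continuous f -> Lp_loc D 1 f.
Proof.
by move=> cf; apply/Lp_loc1P => K cK KD; exact: continuous_integrable.
Qed.

Lemma Lp_locB D f g : Lp_loc D 1 f -> Lp_loc D 1 g ->
  Lp_loc D 1 (fun x => f x - g x).
Proof.
move=> /Lp_loc1P fi /Lp_loc1P gi; apply/Lp_loc1P => K cK KD.
have mK := compact_measurable_rV cK.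
rewrite (_ : _ \o _ = (EFin \o f) \- (EFin \o g))%E//.
by apply: integrableB => //; [exact: fi|exact: gi].
Qed.

End Lp.

Section integration_by_parts.
Context (R : realType) (n : nat).
Implicit Types (f g : 'rV[R]_n -> R) (D K : set 'rV[R]_n) (i : 'I_n).

Lemma integral_partial_test D f i : measurable D -> test_function D f ->
  (\int[lebesgue_rV]_(x in D) (partial i f x)%:E = 0)%E.
Proof.
move=> mD tf; have [K [cK KD f0]] := test_function_compact tf.
have clK : closed K by exact: (compact_closed (@norm_hausdorff _ _)).
have df0 := partial_eq0 i clK f0.
have [M M0 KM] := compact_sub_cube cK.
have C1 := test_function_Ck 1 tf.
rewrite (@integral_off _ _ D K) => //; last by move=> x _ /df0 ->.
rewrite -(@integral_off _ _ setT K) => //; last by move=> x _ /df0 ->.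
rewrite integral_borel//.
  apply: (integral_partial0 (M := M)) => //.
  by move=> x nx; apply: f0 => /KM.
apply/measurable_EFinP; apply: continuous_borel.
exact: (Ck_continuous (Ck_partial i C1)).
Qed.

(** Integration by parts: [integral_partial_test] applied to a product. *)
Lemma is_weak_partial_test D f i : open D -> test_function D f ->
  is_weak_partial D i f (partial i f).
Proof.
move=> oD tf; have mD := open_measurable_rV oD.
have tdf := test_function_partial i tf.
have cf := test_function_continuous tf.
have cdf := test_function_continuous tdf.
split; [exact: continuous_Lp_loc|exact: continuous_Lp_loc|].
move=> phi tphi; apply/eqP; rewrite -subr_eq0 opprK.
have tdphi := test_function_partial i tphi.
rewrite -RintegralD//; last 2 first.
- by apply: Lp_loc_test_integrable => //; exact: continuous_Lp_loc.
- by apply: Lp_loc_test_integrable => //; exact: continuous_Lp_loc.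
have tm := test_functionM (test_function_smooth tf) tphi.
apply/eqP; rewrite -[RHS](congr1 fine (integral_partial_test i mD tm)).
apply: eq_Rintegral => x _; apply/esym/is_derive_partial.
have Df := Ck_derivable i x (test_function_Ck 1 tf).
have Dphi := Ck_derivable i x (test_function_Ck 1 tphi).
by apply: (is_derive_eq (is_deriveM Df Dphi)); rewrite /GRing.scale/= [X in _ + X]mulrC.
Qed.

Lemma is_weak_partialB D i u v g h : open D ->
  is_weak_partial D i u g -> is_weak_partial D i v h ->
  is_weak_partial D i (u \- v) (fun x => g x - h x).
Proof.
move=> oD [u1 g1 ug] [v1 h1 vh]; have mD := open_measurable_rV oD.
split; [exact: Lp_locB|exact: Lp_locB|].
move=> phi tphi; have tdphi := test_function_partial i tphi.
transitivity (\int[lebesgue_rV]_(x in D) (u x * partial i phi x - v x * partial i phi x)).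
  by apply: eq_Rintegral => x _; rewrite /= mulrBl.
rewrite RintegralB//; last 2 first.
- exact: Lp_loc_test_integrable.
- exact: Lp_loc_test_integrable.
rewrite ug// vh//.
transitivity (- (\int[lebesgue_rV]_(x in D) (g x * phi x - h x * phi x))).
  rewrite RintegralB//; last 2 first.
  - exact: Lp_loc_test_integrable.
  - exact: Lp_loc_test_integrable.
  by rewrite opprB opprK addrC.
by congr (- _); apply: eq_Rintegral => x _; rewrite /= mulrBl.
Qed.

Lemma weak_partialP D i u g : is_weak_partial D i u g ->
  is_weak_partial D i u (weak_partial D i u).
Proof. by move=> ug; apply: (xgetPex _ (ex_intro _ g ug)). Qed.

End integration_by_parts.

Section du_bois_reymond.
Context (R : realType) (n : nat).
Implicit Types (f g : 'rV[R]_n -> R) (D K U : set 'rV[R]_n) (i : 'I_n).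

(** Smooth bumps on the rational cubes that are well inside [U] are combined
    by [a, b |-> a + b - a b], which preserves the values 0 and 1. *)
Lemma open_test_approx U : open U ->
  exists phi : nat -> 'rV[R]_n -> R, [/\ forall k, test_function U (phi k),
    forall k x, 0 <= phi k x <= 1 &
    forall x, U x -> \forall k \near \oo, phi k x = 1].
Proof.
move=> oU.
pose good (q : 'rV[rat]_n * rat) := `[< 0 < ratr q.2 :> R /\
  cube (map_mx ratr q.1) (2 * ratr q.2) `<=` U >].
pose beta (k : nat) : 'rV[R]_n -> R :=
  if @unpickle ('rV[rat]_n * rat)%type k is Some q then
    (if good q then cutoff (map_mx ratr q.1) (ratr q.2) else cst 0) else cst 0.
have tbeta k : test_function U (beta k).
  rewrite /beta; case: unpickle => [q|]; last exact: test_function0.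
  case: ifPn => [/asboolP[q0 qU]|_]; last exact: test_function0.
  exact: test_function_cutoff.
have beta01 k x : 0 <= beta k x <= 1.
  rewrite /beta; case: unpickle => [q|]; last by rewrite lexx ler01.
  case: ifPn => _; last by rewrite lexx ler01.
  exact: cutoff_itv.
pose phi := fix phi k : 'rV[R]_n -> R := if k is k'.+1 then
  (fun x => phi k' x + (1 - phi k' x) * beta k' x) else cst 0.
have tphi k : test_function U (phi k).
  elim: k => [|k IH]; first exact: test_function0.
  apply: (test_functionD IH); apply: test_functionM => //.
  apply: Ck_smooth => l; apply: CkB; first exact: Ck_cst.
  exact: test_function_Ck IH.
have phi01 k x : 0 <= phi k x <= 1.
  elim: k => [|k /andP[IH0 IH1]]; first by rewrite /= lexx ler01.
  have /andP[b0 b1] := beta01 k x; rewrite /=.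
  have c0 : 0 <= 1 - phi k x by rewrite subr_ge0.
  by rewrite addr_ge0 ?mulr_ge0//= -lerBrDl ler_piMr.
exists phi; split=> // x Ux.
have [q [q0 qx qU]] := open_rat_cube oU Ux.
have phi1 : phi (pickle q).+1 x = 1.
  have -> : phi (pickle q).+1 x =
    phi (pickle q) x + (1 - phi (pickle q) x) * beta (pickle q) x by [].
  rewrite /beta pickleK ifT; last by apply/asboolP.
  by rewrite cutoff1// mulr1 addrCA subrr addr0.
exists (pickle q).+1 => // k /= /subnK <-.
elim: (k - _)%N => [//|l IH]; rewrite addSn /= IH subrr mul0r addr0//.
Qed.

Lemma borel_open_sigma (A : set 'rV[R]_n) :
  measurable (A : set (borel_rV R n)) -> <<s (@open 'rV[R]_n) >> A.
Proof.
apply: smallest_sub; first exact: smallest_sigma_algebra.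
rewrite -bigcup_seq => B -[i _ [Y mY <-]]; rewrite setTI.
have cj : continuous (coor_rV i : 'rV[R]_n -> R) by exact: coord_continuous.
have : @measurable_fun _ _ (g_sigma_algebraType (@open 'rV[R]_n)) R setT (coor_rV i).
  apply: (measurability _ (measurable_realfun.RGenOpens.measurableE R)).
  move=> _ [_ [a [b ->] <-]]; rewrite setTI; apply: sub_sigma_algebra.
  by move/continuousP : cj; apply; exact: interval_open.
by move=> /(_ measurableT Y mY); rewrite setTI.
Qed.

(** The integral of [g] vanishes over open sets, by [open_test_approx] and dominated
    convergence; over Borel sets, by Dynkin's theorem; and over measurable sets, by
    [borel_hull]. The argument runs inside rational cubes, where [g] is integrable. *)
Lemma du_bois_reymond D g : open D -> Lp_loc D 1 g ->
  (forall phi, test_function D phi ->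
    \int[lebesgue_rV]_(x in D) (g x * phi x) = 0) ->
  {ae lebesgue_rV, forall x, D x -> g x = 0}.
Proof.
move=> oD g1 g0; have mD := open_measurable_rV oD.
pose good (q : 'rV[rat]_n * rat) := 0 < ratr q.2 :> R /\
  cube (map_mx ratr q.1) (2 * ratr q.2) `<=` D.
suff H q : good q ->
    {ae lebesgue_rV, forall x, cube (map_mx ratr q.1) (ratr q.2) x -> g x = 0}.
  have {}H k : {ae lebesgue_rV, forall x, forall q, @unpickle ('rV[rat]_n * rat)%type k = Some q ->
      good q -> cube (map_mx ratr q.1) (ratr q.2) x -> g x = 0}.
    case: (unpickle k) => [q|]; last exact: aeW.
    have [gq|ngq] := pselect (good q); last by apply: aeW => x _ [<-].
    by apply: filterS (H q gq) => x gx _ [<-].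
  move/ae_foralln : H; apply: filterS => x H Dx.
  have [q [q0 qx qD]] := open_rat_cube oD Dx.
  exact: (H (pickle q) q (pickleK _)).
move=> [q0 qD]; set c := map_mx _ _; set r := ratr _ in q0 qD *.
set K := cube c (2 * r) in qD; set O := interior K.
have oO : open O by exact: open_interior.
have mO := open_measurable_rV oO.
have OK : O `<=` K by exact: interior_subset.
have cK : compact K by exact: compact_cube.
have mK := compact_measurable_rV cK.
have giK : lebesgue_rV.-integrable K (EFin \o g) by move/Lp_loc1P : g1; exact.
have gi A : measurable A -> A `<=` K -> lebesgue_rV.-integrable A (EFin \o g).
  by move=> mA AK; exact: integrableS giK.
have open0 U : open U -> U `<=` O ->
    (\int[lebesgue_rV]_(x in U) (g x)%:E = 0)%E.
  move=> oU UO; have mU := open_measurable_rV oU.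
  have [phi [tphi phi01 phi1]] := open_test_approx oU.
  have tphiD k : test_function D (phi k).
    by apply: (test_functionS _ (tphi k)) => x /UO/OK/qD.
  have UD : U `<=` D by move=> x /UO/OK/qD.
  have phi_off k x : ~ U x -> phi k x = 0.
    move=> Ux; have [L [_ LU L0]] := test_function_compact (tphi k).
    by apply: L0 => /LU.
  have gphi0 k : (\int[lebesgue_rV]_(x in U) (g x * phi k x)%:E = 0)%E.
    have := g0 _ (tphiD k); rewrite /Rintegral.
    have /integrable_fin_num := Lp_loc_test_integrable mD g1 (tphiD k).
    move=> /(_ mD) /fineK E E0; rewrite -(integral_off UD).
      by rewrite -E E0.
    by move=> x _ /phi_off ->; rewrite mulr0.
  have UK : U `<=` K by exact: subset_trans OK.
  have mgU : measurable_fun U g.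
    by apply/measurable_EFinP; case/integrableP : (gi U mU UK).
  have := @dominated_convergence _ _ _ lebesgue_rV U mU
    (fun k x => (g x * phi k x)%:E) (EFin \o g) (fun x => `|(g x)%:E|)%E.
  case.
  - move=> k; apply/measurable_EFinP; apply: measurable_funM => //.
    exact/continuous_measurable_rV/(test_function_continuous (tphi k)).
  - exact/measurable_EFinP.
  - apply: aeW => x Ux; apply: cvg_near_cst.
    by apply: filterS (phi1 x Ux) => k ->; rewrite mulr1.
  - by apply: integrable_abse; exact: gi.
  - apply: aeW => x k Ux; rewrite abse_EFin normrM lee_fin ler_piMr//.
    by have /andP[p0 p1] := phi01 k x; rewrite ger0_norm.
  move=> _ _; rewrite (_ : (fun _ => _) = cst 0%E).
    by move=> /cvg_lim <-//; rewrite lim_cst.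
  by apply/funext => k; exact: gphi0.
have borel0 A : measurable (A : set (borel_rV R n)) ->
    (\int[lebesgue_rV]_(x in A `&` O) (g x)%:E = 0)%E.
  pose H := [set A : set 'rV[R]_n | measurable A /\
    (\int[lebesgue_rV]_(x in A `&` O) (g x)%:E = 0)%E].
  have dH : dynkin H.
    split.
    - by split=> //; rewrite setTI; exact: open0.
    - move=> B [mB B0]; have mnB := measurableC mB; split; first exact: mnB.
      have OE : O = (B `&` O) `|` (~` B `&` O) by rewrite -setIUl setUv setTI.
      have mBO := measurableI _ _ mB mO; have mnBO := measurableI _ _ mnB mO.
      have mgO : measurable_fun ((B `&` O) `|` (~` B `&` O)) (EFin \o g).
        by rewrite -OE; case/integrableP : (gi O mO OK).
      have dBO : [disjoint B `&` O & ~` B `&` O].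
        by apply/disj_setPS => x [[Bx _] [nBx _]].
      have := open0 O oO (@subset_refl _ _).
      by rewrite {1}OE (integral_setU _ mBO mnBO mgO dBO) B0 add0e.
    - move=> F tF HF; have mF k : measurable (F k) by have [] := HF k.
      split; first exact: bigcupT_measurable.
      rewrite setI_bigcupl integral_bigcup.
      + by apply: eseries0 => k _ _; have [] := HF k.
      + apply/trivIsetP => i j _ _ ij; rewrite setIACA setIid.
        by move/trivIsetP : tF => /(_ i j Logic.I Logic.I ij) ->; rewrite set0I.
      + by move=> k; exact: measurableI.
      + apply: gi; first by apply: bigcupT_measurable => k; exact: measurableI.
        by move=> x [k _ [_ /OK]].
  have subH : <<s (@open 'rV[R]_n) >> `<=` H.
    apply: lambda_system_subset => //.
    - by move=> X Y oX oY; exact: openI.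
    - exact/dynkin_lambda_system.
    - move=> U oU; split; first exact: open_measurable_rV.
      by apply: open0; [exact: openI|move=> x []].
  by move=> /borel_open_sigma/subH[].
have : ae_eq lebesgue_rV O (EFin \o g) (cst 0%E).
  apply: integral_ae_eq => //; first exact: gi.
  move=> E EO mE; rewrite integral_cst// mul0e.
  have EK : E `<=` K by exact: subset_trans OK.
  have Efin : (lebesgue_rV E < +oo)%E.
    apply: le_lt_trans (compact_finite_measure cK).
    by apply: le_measure; rewrite ?inE.
  have [B [mB EB BE]] := borel_hull Efin.
  have mB' := borel_measurable mB.
  have mBO : measurable (B `&` O) by exact: measurableI.
  rewrite -(borel0 B mB) [RHS](@negligible_integral _ _ _ _ _ ((B `&` O) `\` E))//.
  - congr (integral _ _ _); apply/seteqP; split=> [x Ex|x [[Bx Ox] nx]].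
      by split; [split; [exact: EB|exact: EO]|move=> [_]].
    by apply: contrapT => nEx; apply: nx.
  - exact: measurableD.
  - by apply: gi => // x [_ /OK].
  - apply/eqP; rewrite eq_le measure_ge0 andbT.
    apply: (@le_trans _ _ (lebesgue_rV (B `\` E))).
      by apply: le_measure; rewrite ?inE; [exact: measurableD|exact: measurableD|move=> x [[]]].
    have Bfin : (lebesgue_rV B < +oo)%E by rewrite BE.
    have -> : lebesgue_rV (B `\` E) = (lebesgue_rV B - lebesgue_rV (B `&` E))%E.
      exact: (measureD mB' mE Bfin).
    by rewrite (setIidr EB) BE subee// ge0_fin_numE// measure_ge0.
apply: filterS => x gx cx; have /gx[] // : O x.
apply: (@filterS _ (nbhs x)) (nbhsx_ballx x r q0) => y [_ xy] i.
have := xy ord0 i; rewrite /ball/= => xyi; have := cx i.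
rewrite (_ : y ord0 i - _ = (x ord0 i - c ord0 i) - (x ord0 i - y ord0 i)); last by ring.
move=> cxi; rewrite (le_trans (ler_normB _ _))//.
by rewrite (_ : 2 * r = r + r) ?lerD// ?(ltW xyi)//; ring.
Qed.

Lemma weak_partial_unique D i u g h : open D ->
  is_weak_partial D i u g -> is_weak_partial D i u h ->
  {ae lebesgue_rV, forall x, D x -> g x = h x}.
Proof.
move=> oD [_ g1 ug] [_ h1 uh]; have mD := open_measurable_rV oD.
have : {ae lebesgue_rV, forall x, D x -> g x - h x = 0}.
  apply: (du_bois_reymond oD (Lp_locB g1 h1)) => phi tphi.
  transitivity (\int[lebesgue_rV]_(x in D) (g x * phi x - h x * phi x)).
    by apply: eq_Rintegral => x _; rewrite /= mulrBl.
  rewrite RintegralB//; last 2 first.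
  - exact: Lp_loc_test_integrable.
  - exact: Lp_loc_test_integrable.
  by rewrite -[X in X - _]opprK -ug// -[X in _ - X]opprK -uh// opprK addNr.
by apply: filterS => x gh /gh /eqP; rewrite subr_eq0 => /eqP.
Qed.

End du_bois_reymond.

(** * Approximation by test functions *)

Section fast_convergence.
Context d (T : measurableType d) (R : realType) (mu : {measure set T -> \bar R}).
Implicit Types (D : set T) (F : nat -> T -> R).

(** The sum of the squares is integrable, hence finite almost everywhere: it
    forces convergence and provides a dominating function at the same time. *)
Lemma summable_squares_ae D F : measurable D ->
  (forall k, measurable_fun D (F k)) ->
  (forall k, (\int[mu]_(x in D) (F k x ^+ 2)%:E <= ((2^-1) ^+ k)%:E)%E) ->
  exists S : T -> R, [/\ mu.-integrable D (EFin \o S),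
    forall x, 0 <= S x &
    {ae mu, forall x, D x -> F ^~ x @ \oo --> (0 : R) /\
      forall k, F k x ^+ 2 <= S x}].
Proof.
move=> mD mF F2.
pose U x : \bar R := (\sum_(0 <= k <oo) (F k x ^+ 2)%:E)%E.
have F20 k x : (0 <= (F k x ^+ 2)%:E)%E by rewrite lee_fin sqr_ge0.
have mF2 k : measurable_fun D (fun x => (F k x ^+ 2)%:E).
  by apply/measurable_EFinP; exact: measurable_funX.
have U0 x : (0 <= U x)%E by apply: nneseries_ge0.
have mU : measurable_fun D U by apply: ge0_emeasurable_sum.
have IU : (\int[mu]_(x in D) U x < +oo)%E.
  rewrite /U integral_nneseries//.
  apply: (@le_lt_trans _ _ (\sum_(0 <= k <oo) ((2^-1) ^+ k)%:E)%E).
    by apply: lee_nneseries => // k _ _; apply: integral_ge0.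
  apply: (@le_lt_trans _ _ 2%:E); last exact: ltry.
  apply: lime_le.
    by apply: is_cvg_nneseries => k _ _; rewrite lee_fin exprn_ge0// invr_ge0.
  apply: nearW => k; rewrite sumEFin lee_fin.
  elim: k => [|k IH]; first by rewrite big_nil.
  rewrite big_nat_recl//= expr0.
  under eq_bigr do rewrite exprS.
  rewrite -mulr_sumr; apply: (@le_trans _ _ (1 + 2^-1 * 2)).
    by rewrite lerD2l ler_wpM2l// invr_ge0.
  by rewrite mulVf.
have iU : mu.-integrable D U.
  apply/integrableP; split => //.
  by under eq_integral do rewrite gee0_abs//.
exists (fine \o U); split.
- apply: (@le_integrable _ _ _ _ _ mD _ U) => //.
  + by apply/measurable_EFinP; apply: measurableT_comp.
  + by move=> x Dx /=; case: (U x) => [r||] //=; rewrite normr0 leey.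
- by move=> x; exact: fine_ge0.
have := integrable_ae mD iU; apply: filterS => x fx Dx; have Ux := fx Dx.
have UE : ((fine (U x))%:E = U x)%E by rewrite fineK.
have part k : \sum_(0 <= j < k) F j x ^+ 2 <= fine (U x).
  rewrite -lee_fin UE -sumEFin; exact: nneseries_lim_ge.
split.
  have cS : cvgn (series (fun k => F k x ^+ 2)).
    apply: nondecreasing_is_cvgn.
      by apply: nondecreasing_series => k _ _; exact: sqr_ge0.
    by exists (fine (U x)) => _ [k _ <-]; exact: part.
  have /cvgr0Pnorm_lt F0 := cvg_series_cvg_0 cS.
  apply/cvgr0Pnorm_lt => e e0; have e2 : 0 < e ^+ 2 by rewrite exprn_gt0.
  apply: filterS (F0 _ e2) => k; rewrite normrX.
  by rewrite ltr_pXn2r ?nnegrE// ltW.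
move=> k; apply: le_trans (part k.+1); rewrite big_nat_recr//= lerDr.
by apply: sumr_ge0 => j _; exact: sqr_ge0.
Qed.

End fast_convergence.

Section sobolev_approximation.
Context (R : realType) (n : nat).
Implicit Types (u f g : 'rV[R]_n -> R) (D : set 'rV[R]_n) (i : 'I_n).

Lemma Lp_loc_measurable D f : open D -> Lp_loc D 1 f -> measurable_fun D f.
Proof.
move=> oD f1 _ Y mY; rewrite {1}(open_bigcup_cube oD) setI_bigcupl.
apply: countable_bigcupT_measurable; first exact: countableP.
move=> q; case: ifPn => [/asboolP[q0 qD]|_]; last by rewrite set0I.
have [|mf _] := f1 (cube (map_mx ratr q.1) (ratr q.2)) (@compact_cube _ _ _ _).
  apply: subset_trans qD; apply: subset_cube.
  by rewrite ler_peMl ?(ltW q0)// ler1n.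
exact: (mf (measurable_cube _ _) _ mY).
Qed.

Lemma integral_sqr_ae D f g : measurable D -> measurable_fun D f ->
  measurable_fun D g -> {ae lebesgue_rV, forall x, D x -> f x = g x} ->
  (\int[lebesgue_rV]_(x in D) (f x ^+ 2)%:E =
   \int[lebesgue_rV]_(x in D) (g x ^+ 2)%:E)%E.
Proof.
move=> mD mf mg fg; apply: (@ae_eq_integral _ _ _ lebesgue_rV D (fun x => (g x ^+ 2)%:E)
  (fun x => (f x ^+ 2)%:E) mD).
- by apply/measurable_EFinP; exact: measurable_funX.
- by apply/measurable_EFinP; exact: measurable_funX.
- by apply: filterS fg => x fgx /fgx ->.
Qed.

Lemma Lpnorm2_eq0 D f : measurable D -> measurable_fun D f ->
  {ae lebesgue_rV, forall x, D x -> f x = 0} -> Lpnorm D 2 f = 0%E.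
Proof.
move=> mD mf f0; apply/eqP; have : (Lpnorm D 2 f `^ 2 = 0)%E.
  rewrite Lpnorm2 (integral_sqr_ae mD mf (measurable_cst (0 : R)) f0).
  by apply: integral0_eq => x _; rewrite expr0n.
by move/poweR_eq0_eq0 => ->//; exact: Lnorm_ge0.
Qed.

Lemma test_function_Lp2 D f : measurable D -> test_function D f -> Lp D 2 f.
Proof.
move=> mD tf; have cf := test_function_continuous tf.
apply/Lp2_integrable => //; split; first exact: continuous_measurable_rV.
under eq_fun do rewrite expr2.
exact: (test_function_integrable mD (test_functionM (test_function_smooth tf) tf)).
Qed.

Lemma H10_test D f : open D -> test_function D f -> H10 D f.
Proof.
move=> oD tf; have mD := open_measurable_rV oD.
have wf i := is_weak_partial_test i oD tf.
split.
  split; first exact: test_function_Lp2.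
  by move=> i; exists (partial i f) => //; exact/test_function_Lp2/test_function_partial.
move=> e e0; exists f => //; rewrite /H1norm.
have f0 : (f \- f) = cst 0 by apply/funext => x; rewrite /= subrr.
rewrite Lpnorm2_eq0//; first last.
- by apply: aeW => x _; rewrite f0.
- by rewrite f0.
rewrite add0e big1 ?lte_fin// => i _.
have w0 := is_weak_partialB oD (wf i) (wf i); have w1 := weak_partialP w0.
apply: (Lpnorm2_eq0 mD).
  by case: w1 => _ l1 _; exact: Lp_loc_measurable.
apply: filterS (weak_partial_unique oD w1 w0) => x w01 /w01 ->.
by rewrite subrr.
Qed.

Lemma H1_weak_partial D i u : H1 D u ->
  is_weak_partial D i u (weak_partial D i u).
Proof. by move=> [_ /(_ i)[g wg _]]; exact: weak_partialP wg. Qed.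

Lemma H1_weak_partial_Lp2 D i u : open D -> H1 D u ->
  Lp D 2 (weak_partial D i u).
Proof.
move=> oD Hu; have mD := open_measurable_rV oD; have wu := H1_weak_partial i Hu.
have [_ /(_ i)[g wg /(Lp2_integrable _ mD)[mg g2]]] := Hu.
have mw : measurable_fun D (weak_partial D i u).
  by case: wu => _ lu _; exact: Lp_loc_measurable.
apply/(Lp2_integrable _ mD); split=> //.
move/integrableP : g2 => [_ g2]; apply/integrableP; split.
  by apply/measurable_EFinP; exact: measurable_funX.
have E h : (fun x => `|(h x ^+ 2)%:E|)%E = (fun x => (h x ^+ 2)%:E) :> ('rV[R]_n -> \bar R).
  by apply/funext => x; rewrite gee0_abs// lee_fin sqr_ge0.
move: g2; rewrite !E.
by rewrite (integral_sqr_ae mD mw mg (weak_partial_unique oD wu wg)).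
Qed.

(** The norm in the definition of [H10] involves the selected weak derivative of
    [u \- phi]; by uniqueness it is that of [u] minus the classical partial of [phi]. *)
Lemma H10_approx D u e : open D -> H10 D u -> 0 < e ->
  exists2 phi, test_function D phi &
    (\int[lebesgue_rV]_(x in D) ((u x - phi x) ^+ 2)%:E <= (e ^+ 2)%:E)%E /\
    forall i, (\int[lebesgue_rV]_(x in D)
      ((weak_partial D i u x - partial i phi x) ^+ 2)%:E <= (e ^+ 2)%:E)%E.
Proof.
move=> oD [Hu uapp] e0; have mD := open_measurable_rV oD.
have [phi tphi] := uapp e e0; rewrite /H1norm => ue.
exists phi => //; split.
  apply: (@Lpnorm2_lt _ _ D (u \- phi)); apply: le_lt_trans ue.
  by rewrite leeDl// sume_ge0// => i _; exact: Lnorm_ge0.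
move=> i; have wu := H1_weak_partial i Hu.
have w0 := is_weak_partialB oD wu (is_weak_partial_test i oD tphi).
have w1 := weak_partialP w0.
have [_ l0 _] := w0; have [_ l1 _] := w1.
rewrite (integral_sqr_ae mD (Lp_loc_measurable oD l0) (Lp_loc_measurable oD l1)
  (weak_partial_unique oD w0 w1)).
apply: Lpnorm2_lt; apply: le_lt_trans ue.
rewrite (bigD1 i)//= addeCA leeDl// adde_ge0//; first exact: Lnorm_ge0.
by rewrite sume_ge0// => j _; exact: Lnorm_ge0.
Qed.

(** Approximations at the rate [2^-k] converge almost everywhere under a common
    integrable majorant. This allows dominated convergence in expressions that are
    nonlinear in the function. *)
Lemma H10_sequence D u : open D -> H10 D u ->
  exists (phi : nat -> 'rV[R]_n -> R) (M : 'rV[R]_n -> R),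
  [/\ forall k, test_function D (phi k),
      lebesgue_rV.-integrable D (EFin \o M),
      {ae lebesgue_rV, forall x, D x -> phi ^~ x @ \oo --> u x /\
        forall k, phi k x ^+ 2 <= M x} &
      forall i, {ae lebesgue_rV, forall x, D x ->
        (fun k => partial i (phi k) x) @ \oo --> weak_partial D i u x /\
        forall k, partial i (phi k) x ^+ 2 <= M x}].
Proof.
move=> oD Hu; have mD := open_measurable_rV oD.
have Hk (k : nat) : exists phi, test_function D phi /\
    ((\int[lebesgue_rV]_(x in D) ((u x - phi x) ^+ 2)%:E <= ((2^-1) ^+ k)%:E)%E /\
    forall i, (\int[lebesgue_rV]_(x in D)
      ((weak_partial D i u x - partial i phi x) ^+ 2)%:E <= ((2^-1) ^+ k)%:E)%E).
  have e0 : 0 < (2^-1) ^+ k :> R by rewrite exprn_gt0// invr_gt0.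
  have e2 : ((2^-1) ^+ k) ^+ 2 <= (2^-1) ^+ k :> R.
    rewrite expr2 ler_piMr ?(ltW e0)// ?exprn_ile1 ?invr_ge0 ?invf_le1// ?ler1n//.
  have [phi tphi [p0 pi]] := H10_approx oD Hu e0; exists phi; split=> //.
  split=> [|i]; first by apply: (le_trans p0); rewrite lee_fin.
  by apply: (le_trans (pi i)); rewrite lee_fin.
have /choice[phi Hphi] := Hk.
have tphi k : test_function D (phi k) by have [] := Hphi k.
have H1u : H1 D u by have [] := Hu.
have [/(Lp2_integrable _ mD)[mu2 iu2] _] := H1u.
have mp i : measurable_fun D (weak_partial D i u).
  by have /(Lp2_integrable _ mD)[] := H1_weak_partial_Lp2 i oD H1u.
have ip i : lebesgue_rV.-integrable D (fun x => (weak_partial D i u x ^+ 2)%:E).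
  by have /(Lp2_integrable _ mD)[] := H1_weak_partial_Lp2 i oD H1u.
have [||S0 [iS0 S00 aeS0]] :=
    @summable_squares_ae _ _ R lebesgue_rV D (fun k x => u x - phi k x) mD.
- move=> k; apply: measurable_funB => //.
  exact/continuous_measurable_rV/(test_function_continuous (tphi k)).
- by move=> k; have [_ []] := Hphi k.
have /choice[S HS] : forall i, exists S : 'rV[R]_n -> R,
    [/\ lebesgue_rV.-integrable D (EFin \o S), forall x, 0 <= S x &
    {ae lebesgue_rV, forall x, D x ->
      (fun k => weak_partial D i u x - partial i (phi k) x) @ \oo --> (0 : R) /\
      forall k, (weak_partial D i u x - partial i (phi k) x) ^+ 2 <= S x}].
  move=> i; apply: (summable_squares_ae mD).
  - move=> k; apply: measurable_funB => //; apply: continuous_measurable_rV.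
    exact: (test_function_continuous (test_function_partial i (tphi k))).
  - by move=> k; have [_ [_]] := Hphi k.
pose M x := 2 * (u x ^+ 2 + S0 x + \sum_i (weak_partial D i u x ^+ 2 + S i x)).
have sum0 x : 0 <= \sum_i (weak_partial D i u x ^+ 2 + S i x).
  by apply: sumr_ge0 => i _; rewrite addr_ge0 ?sqr_ge0//; have [_ ->] := HS i.
have sq2 (a c s : R) : (a - c) ^+ 2 <= s -> c ^+ 2 <= 2 * (a ^+ 2 + s).
  move=> acs; have := sqr_ge0 (2 * a - c); nra.
have cvg_sub (a : R) (s : nat -> R) : (fun k => a - s k) @ \oo --> (0 : R) ->
    s @ \oo --> a.
  move=> as0; have -> : s = (fun k => a - (a - s k)) by apply/funext => k; ring.
  by rewrite -[X in _ --> X]subr0; apply: cvgB as0; exact: cvg_cst.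
exists phi, M; split => //.
- rewrite (_ : EFin \o M = (fun x => 2%:E * ((u x ^+ 2)%:E + (S0 x)%:E +
    \sum_(i <- index_enum 'I_n) ((weak_partial D i u x ^+ 2)%:E + (S i x)%:E)))%E).
    apply: integrableZl => //; apply: integrableD => //.
      exact: integrableD.
    apply: integrable_sum => // i _; apply: integrableD => //.
    by have [] := HS i.
  by apply/funext => x; rewrite /M /= EFinM !EFinD sumEFin.
- apply: filterS aeS0 => x S0x /S0x[u0 uS]; split; first exact: cvg_sub.
  move=> k; apply: le_trans (sq2 _ _ _ (uS k)) _.
  by rewrite ler_wpM2l// lerDl.
- move=> i; have [_ _] := HS i; apply: filterS => x Sx /Sx[p0 pS].
  split; first exact: cvg_sub.
  move=> k; apply: le_trans (sq2 _ _ _ (pS k)) _.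
  rewrite ler_wpM2l// /M (bigD1 i)//= addrCA lerDl addr_ge0//.
    by rewrite addr_ge0 ?sqr_ge0.
  by apply: sumr_ge0 => j _; rewrite addr_ge0 ?sqr_ge0//; have [_ ->] := HS j.
Qed.

End sobolev_approximation.

(** * The pointwise energy inequality *)

Section elliptic_form.
Context (R : realType) (n : nat).
Implicit Types (xi eta p grad b : 'I_n -> R).

Definition sqnorm xi : R := \sum_i xi i ^+ 2.

Definition form (a : 'M[R]_n) xi eta : R := \sum_i \sum_j a i j * xi i * eta j.

Lemma sqnorm_ge0 xi : 0 <= sqnorm xi.
Proof. by apply: sumr_ge0 => i _; exact: sqr_ge0. Qed.

Lemma sqnormZ (c : R) xi : sqnorm (fun i => c * xi i) = c ^+ 2 * sqnorm xi.
Proof. by rewrite /sqnorm mulr_sumr; apply: eq_bigr => i _; rewrite exprMn. Qed.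

Lemma formDr a xi eta zeta :
  form a xi (fun j => eta j + zeta j) = form a xi eta + form a xi zeta.
Proof.
rewrite /form -big_split; apply: eq_bigr => i _; rewrite -big_split/=.
by apply: eq_bigr => j _; rewrite mulrDr.
Qed.

Lemma formZr a (c : R) xi eta :
  form a xi (fun j => c * eta j) = c * form a xi eta.
Proof.
rewrite /form mulr_sumr; apply: eq_bigr => i _; rewrite mulr_sumr.
by apply: eq_bigr => j _; ring.
Qed.

Lemma form_sym a xi eta : a^T = a -> form a xi eta = form a eta xi.
Proof.
move=> aT; rewrite /form exchange_big/=; apply: eq_bigr => i _.
by apply: eq_bigr => j _; rewrite -[in LHS]aT mxE; ring.
Qed.

Lemma form_square a (c : R) xi eta : a^T = a ->
  form a (fun i => xi i + c * eta i) (fun i => xi i + c * eta i) =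
  form a xi xi + 2 * c * form a xi eta + c ^+ 2 * form a eta eta.
Proof.
move=> aT; rewrite formDr formZr (@form_sym a _ xi aT) (@form_sym a _ eta aT).
by rewrite !formDr !formZr (@form_sym a eta xi aT); ring.
Qed.

Section bounds.
Context (a : 'M[R]_n) (lambda : R) (l0 : 0 < lambda) (aT : a^T = a).
Context (ell : forall xi : 'rV[R]_n,
  lambda * enorm xi ^+ 2 <= \sum_i \sum_j a i j * xi ord0 i * xi ord0 j
    <= lambda^-1 * enorm xi ^+ 2).

Let form_ell xi : lambda * sqnorm xi <= form a xi xi <= lambda^-1 * sqnorm xi.
Proof.
have := ell (\row_i xi i); rewrite /enorm sqr_sqrtr; last first.
  by apply: sumr_ge0 => i _; exact: sqr_ge0.
rewrite (eq_bigr (fun i => xi i ^+ 2)) => [|i _]; last by rewrite mxE.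
rewrite -/(sqnorm xi) (_ : \sum_i _ = form a xi xi)//.
by apply: eq_bigr => i _; apply: eq_bigr => j _; rewrite !mxE.
Qed.

(** Polarization: the form is nonnegative at [xi + eta] and at [xi - eta]. *)
Lemma form_bound xi eta :
  `|form a xi eta| <= lambda^-1 * (sqnorm xi + sqnorm eta).
Proof.
have pos c : 0 <= form a (fun i => xi i + c * eta i) (fun i => xi i + c * eta i).
  have /andP[+ _] := form_ell (fun i => xi i + c * eta i).
  by apply: le_trans; rewrite mulr_ge0 ?sqnorm_ge0// ltW.
have := pos 1; have := pos (-1); rewrite !form_square//.
have /andP[_ h1] := form_ell xi; have /andP[_ h2] := form_ell eta.
have L : 0 < lambda^-1 by rewrite invr_gt0.
have s1 : 0 <= lambda^-1 * sqnorm xi by rewrite mulr_ge0 ?sqnorm_ge0 ?ltW.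
have s2 : 0 <= lambda^-1 * sqnorm eta by rewrite mulr_ge0 ?sqnorm_ge0 ?ltW.
rewrite mulrDr ler_norml => q1 q2; apply/andP; split; lra.
Qed.

(** Absorption: the quadratic term produced by the decay of [g] controls the
    cross terms with the gradient of the cutoff and with the drift. *)
Lemma energy_pointwise (chi g dg : R) (grad p b : 'I_n -> R) (V u : R) :
  0 <= g -> dg <= - (g ^+ 2 / 4) -> 0 <= u * g <= 2 ->
  form a p (fun j => 2 * chi * grad j * g + chi ^+ 2 * (dg * p j))
    + \sum_i b i * p i * (chi ^+ 2 * g) + V * u * (chi ^+ 2 * g)
  <= - (lambda / 16) * (chi ^+ 2 * sqnorm (fun i => g * p i))
     + 8 / lambda * sqnorm grad + 4 / lambda * (chi ^+ 2 * sqnorm b)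
     + 2 * (chi ^+ 2 * `|V|).
Proof.
move=> g0 dgg /andP[ug0 ug2].
have -> : form a p (fun j => 2 * chi * grad j * g + chi ^+ 2 * (dg * p j)) =
    2 * (chi * g) * form a p grad + chi ^+ 2 * dg * form a p p.
  rewrite formDr; congr (_ + _); rewrite -formZr; congr form; apply/funext => j; ring.
have c2 : 0 <= chi ^+ 2 by exact: sqr_ge0.
have /andP[lp _] := form_ell p; have /andP[_ lg] := form_ell grad.
have pp0 : 0 <= form a p p.
  by apply: le_trans lp; rewrite mulr_ge0 ?sqnorm_ge0 ?(ltW l0).
have E1 : chi ^+ 2 * dg * form a p p <= - (g ^+ 2 / 4) * chi ^+ 2 * form a p p.
  by rewrite ler_wpM2r// [leLHS]mulrC ler_wpM2r.
(* Half of the decay term in [E1] pays for this cross term, a quarter of it for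
   the drift in [E3]; the last quarter is what remains. *)
have E2 : 16 * (chi * g) * form a p grad <=
    chi ^+ 2 * g ^+ 2 * form a p p + 64 * form a grad grad.
  have /andP[+ _] := form_ell (fun i => chi * g * p i + (-8) * grad i).
  move=> /(le_trans _) => /(_ 0); rewrite mulr_ge0 ?sqnorm_ge0 ?(ltW l0)//.
  rewrite form_square// (@form_sym a _ grad aT) !formZr.
  rewrite (@form_sym a _ p aT) formZr (@form_sym a grad p aT).
  by move=> /(_ isT); rewrite -subr_ge0 => h; rewrite -subr_ge0; lra.
have E3 : \sum_i b i * p i * (chi ^+ 2 * g) <=
    lambda / 16 * (chi ^+ 2 * sqnorm (fun i => g * p i)) +
    4 / lambda * (chi ^+ 2 * sqnorm b).
  rewrite /sqnorm !mulr_sumr -big_split/=; apply: ler_sum => i _.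
  rewrite -subr_ge0; have := sqr_ge0 (lambda / 4 * (g * p i) - 2 * b i).
  have -> : lambda / 16 * (chi ^+ 2 * (g * p i) ^+ 2) +
      4 / lambda * (chi ^+ 2 * b i ^+ 2) - b i * p i * (chi ^+ 2 * g) =
      chi ^+ 2 * lambda^-1 * (lambda / 4 * (g * p i) - 2 * b i) ^+ 2.
    by field; rewrite gt_eqF.
  by move=> sq0; rewrite mulr_ge0// mulr_ge0// invr_ge0 ltW.
have E4 : V * u * (chi ^+ 2 * g) <= 2 * (chi ^+ 2 * `|V|).
  have -> : V * u * (chi ^+ 2 * g) = chi ^+ 2 * (V * (u * g)) by ring.
  rewrite [leRHS]mulrCA ler_wpM2l// (le_trans (ler_norm _))// normrM mulrC.
  by rewrite ler_wpM2r// ger0_norm.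
have E5 : lambda * (chi ^+ 2 * sqnorm (fun i => g * p i)) <=
    chi ^+ 2 * g ^+ 2 * form a p p.
  rewrite sqnormZ mulrCA -[leRHS]mulrA ler_wpM2l//.
  by rewrite mulrCA ler_wpM2l// sqr_ge0.
have E6 : form a grad grad <= lambda^-1 * sqnorm grad by [].
move: E1 E2 E3 E4 E5 E6; lra.
Qed.

End bounds.

End elliptic_form.

(** * The regularized logarithm *)

Section log_test.
Context (R : realType) (d : R) (d0 : 0 < d).
Implicit Types t : R.

(** A positive quadratic polynomial on the whole line which lies between [t ^ 2] and
    [(t + d) ^ 2] for [t >= 0]. *)
Definition quad t := t * t + d * t + d * d.

(** Up to constants [1 / (t + d)] for [t >= 0], but smooth and bounded on the
    whole line: approximating test functions need not be nonnegative. *)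
Definition gtest t := (t + 2 * d) / quad t.
Definition dgtest t := - (t * t + 4 * d * t + d * d) / (quad t * quad t).

(** A regularization of [ln t], between [ln t] and [ln (t + d)] for [t > 0]. *)
Definition vlog t := ln (quad t) / 2.
Definition dvlog t := (t + d / 2) / quad t.

Lemma quad_gt0 t : 0 < quad t.
Proof.
have := sqr_ge0 (t + d / 2); have : 0 < d * d by rewrite mulr_gt0.
rewrite /quad; nra.
Qed.

Lemma quad_ge t : d * d / 2 <= quad t.
Proof. by have := sqr_ge0 (t + d / 2); have := d0; rewrite /quad; nra. Qed.

Let q0 t : quad t != 0. Proof. by rewrite gt_eqF ?quad_gt0. Qed.

Lemma is_derive_quad t : is_derive t 1 quad (2 * t + d).
Proof.
rewrite /quad; apply: is_derive_eq.
by rewrite /GRing.scale/= !(mulr1, mulr0, addr0); ring.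
Qed.

Lemma is_derive_gtest t : is_derive t 1 gtest (dgtest t).
Proof.
have DV := is_deriveV (q0 t) (is_derive_quad t).
have DN : is_derive t 1 (fun t => t + 2 * d) 1.
  by apply: is_derive_eq; rewrite addr0.
apply: (is_derive_eq (is_deriveM DN DV)).
by rewrite /dgtest /GRing.scale/= /quad; field; exact: q0.
Qed.

Lemma is_derive_vlog t : is_derive t 1 vlog (dvlog t).
Proof.
have DL := is_derive1_comp (is_derive1_ln (quad_gt0 t)) (is_derive_quad t).
have DH : is_derive t 1 (cst (2^-1 : R)) 0 by exact: is_derive_cst.
apply: (is_derive_eq (is_deriveM DL DH)).
by rewrite /dvlog /GRing.scale/= /quad; field; exact: q0.
Qed.

Let continuous_quad : continuous quad.
Proof.
move=> t; apply/differentiable_continuous/derivable1_diffP.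
by case: (is_derive_quad t).
Qed.

Lemma continuous_gtest : continuous gtest.
Proof.
move=> t; apply/differentiable_continuous/derivable1_diffP.
by case: (is_derive_gtest t).
Qed.

Lemma continuous_vlog : continuous vlog.
Proof.
move=> t; apply/differentiable_continuous/derivable1_diffP.
by case: (is_derive_vlog t).
Qed.

Let cid : continuous (fun t : R => t). Proof. by move=> t; exact: cvg_id. Qed.

Let ccst (c : R) : continuous (fun t : R => c).
Proof. exact: cst_continuous. Qed.

Lemma continuous_dgtest : continuous dgtest.
Proof.
rewrite /dgtest.
apply: (@continuous_funM R R (fun t => - (t * t + 4 * d * t + d * d))
  (fun t => (quad t * quad t)^-1)); last first.
  apply: continuous_funV; last exact: continuous_funM.
  by move=> t; rewrite mulf_neq0.
apply: (@continuous_fun_comp R _ _ (fun t => t * t + 4 * d * t + d * d) -%R);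
  last exact: oppr_continuous.
apply: continuous_funD; last exact: ccst.
apply: continuous_funD; first exact: continuous_funM.
by apply: continuous_funM => //; exact: ccst.
Qed.

Lemma continuous_dvlog : continuous dvlog.
Proof.
rewrite /dvlog.
apply: (@continuous_funM R R (fun t => t + d / 2) (fun t => (quad t)^-1)).
  by apply: continuous_funD => //; exact: ccst.
exact: continuous_funV.
Qed.

Lemma gtest_bound t : `|gtest t| <= 3 / d.
Proof.
rewrite normrM normfV (gtr0_norm (quad_gt0 t)) ler_pdivrMr ?quad_gt0//.
rewrite mulrAC ler_pdivlMr// mulrC -[X in X * _](gtr0_norm d0) -normrM ler_norml.
have s1 := sqr_ge0 (t + d); have s2 := sqr_ge0 t; have s3 := sqr_ge0 (t + 2 * d).
have s4 := sqr_ge0 d; rewrite /quad; apply/andP; split; lra.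
Qed.

Lemma dgtest_bound t : `|dgtest t| <= 8 / (d * d).
Proof.
have qt := quad_gt0 t; have qd := quad_ge t.
have dd : 0 < d * d by rewrite mulr_gt0.
rewrite /dgtest normrM normfV normrN (gtr0_norm (mulr_gt0 qt qt)).
rewrite ler_pdivrMr ?mulr_gt0//.
have h1 : `|t * t + 4 * d * t + d * d| <= 4 * quad t.
  have s1 := sqr_ge0 (t + d); have s2 := sqr_ge0 t; have s3 := sqr_ge0 d.
  rewrite ler_norml /quad; apply/andP; split; lra.
apply: (le_trans h1); have -> : 8 / (d * d) * (quad t * quad t) =
    4 * quad t * (quad t / (d * d / 2)) by field; rewrite gt_eqF.
rewrite ler_peMr ?mulr_ge0 ?(ltW qt)// ler_pdivlMr ?mul1r//.
by rewrite divr_gt0.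
Qed.

Lemma dvlog_bound t : `|dvlog t| <= 1 / d.
Proof.
rewrite normrM normfV (gtr0_norm (quad_gt0 t)) ler_pdivrMr ?quad_gt0//.
rewrite mulrAC ler_pdivlMr// mul1r mulrC -[X in X * _](gtr0_norm d0) -normrM ler_norml.
have s1 := sqr_ge0 (t + d); have s2 := sqr_ge0 t; have s3 := sqr_ge0 d.
rewrite /quad; apply/andP; split; lra.
Qed.

Section nonneg.
Context (t : R) (t0 : 0 <= t).

Lemma gtest_ge0 : 0 <= gtest t.
Proof.
by rewrite divr_ge0 ?(ltW (quad_gt0 _))// addr_ge0// mulr_ge0// ltW.
Qed.

(** The differential inequality [g' <= - g ^ 2 / 4]: tested with [g(u)], the
    equation bounds the energy of [log u] rather than that of [u]. *)
Lemma gtest_decay : dgtest t <= - (gtest t ^+ 2 / 4).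
Proof.
rewrite /dgtest /gtest mulNr lerN2 expr_div_n -expr2 mulrAC ler_wpM2r//.
  by rewrite invr_ge0 sqr_ge0.
have td := mulr_ge0 t0 (ltW d0); have t2 := sqr_ge0 t; lra.
Qed.

Lemma gtest_mul_le : 0 <= t * gtest t <= 2.
Proof.
rewrite mulr_ge0 ?gtest_ge0//= /gtest mulrA ler_pdivrMr ?quad_gt0// /quad.
have := d0; nra.
Qed.

Lemma dvlog_le_gtest : `|dvlog t| <= gtest t.
Proof.
rewrite ger0_norm /dvlog /gtest.
  by rewrite ler_wpM2r ?invr_ge0 ?(ltW (quad_gt0 _))//; have := d0; nra.
by rewrite divr_ge0 ?(ltW (quad_gt0 _))// addr_ge0// divr_ge0// ltW.
Qed.

Lemma expR_vlog_le : expR (vlog t) <= t + d.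
Proof.
have td : 0 < t + d by rewrite ltr_wpDl.
rewrite -[leRHS]lnK ?posrE// ler_expR /vlog ler_pdivrMr//.
rewrite mulr_natr -lnXn// ler_ln ?posrE ?quad_gt0 ?exprn_gt0//.
rewrite /quad; have td0 := mulr_ge0 t0 (ltW d0); have d2 := sqr_ge0 d; lra.
Qed.

Lemma ln_le_vlog : 0 < t -> ln t <= vlog t.
Proof.
move=> tp; rewrite /vlog ler_pdivlMr// mulr_natr -lnXn//.
rewrite ler_ln ?posrE ?quad_gt0 ?exprn_gt0//.
rewrite /quad; have td0 := mulr_ge0 t0 (ltW d0); have d2 := sqr_ge0 d; lra.
Qed.

End nonneg.

Lemma vlog_bound t : `|vlog t| <= `|vlog 0| + 1 / d * `|t|.
Proof.
have D (s : R) : is_derive s 1 vlog (dvlog s) by exact: is_derive_vlog.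
have cv := continuous_vlog.
have key a c : a <= c -> `|vlog c - vlog a| <= 1 / d * (c - a).
  rewrite le_eqVlt => /predU1P[->|ac]; first by rewrite !subrr normr0 mulr0.
  have [s _ ->] := MVT ac (fun x _ => D x) (continuous_subspaceT cv).
  by rewrite normrM ler_pM// ?dvlog_bound// gtr0_norm ?subr_gt0.
have : `|vlog t - vlog 0| <= 1 / d * `|t|.
  have [t0|/ltW t0] := leP 0 t.
    by apply: (le_trans (key _ _ t0)); rewrite subr0 ger0_norm.
  by rewrite distrC; apply: (le_trans (key _ _ t0)); rewrite sub0r ler0_norm.
move=> h; rewrite -[vlog t](subrK (vlog 0)) addrC.
by apply: (le_trans (ler_normD _ _)); rewrite lerD2l.
Qed.

End log_test.

(** * The energy inequality in the limit *)

Section real_integrable.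
Context d (T : measurableType d) (R : realType) (mu : {measure set T -> \bar R}).
Context (D : set T) (mD : measurable D).
Implicit Types f g : T -> R.
Local Notation I f := (mu.-integrable D (fun x => (f x)%:E)).

Lemma integrable_measurable f : I f -> measurable_fun D f.
Proof. by case/integrableP => mf _; apply/measurable_EFinP. Qed.

Lemma integrable_funD f g : I f -> I g -> I (fun x => f x + g x).
Proof. by move=> fi gi; exact: (integrableD mD fi gi). Qed.

Lemma integrable_funB f g : I f -> I g -> I (fun x => f x - g x).
Proof. by move=> fi gi; exact: (integrableB mD fi gi). Qed.

Lemma integrable_funZ (c : R) f : I f -> I (fun x => c * f x).
Proof. by move=> fi; exact: (integrableZl mD c fi). Qed.

Lemma integrable_funsum (J : finType) (h : J -> T -> R) :
  (forall j, I (h j)) -> I (fun x => \sum_j h j x).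
Proof.
move=> hi; rewrite (_ : (fun x => _) =
    (fun x => \sum_(j <- index_enum J) (h j x)%:E)%E).
  exact: (integrable_sum mD _ (fun j _ => hi j)).
by apply/funext => x; rewrite sumEFin.
Qed.

Lemma integrable_cst (c : R) : (mu D < +oo)%E -> I (cst c).
Proof.
move=> Dfin; apply: measurable_bounded_integrable => //.
exists `|c|; split; first exact: num_real.
by move=> M cM x _; exact: ltW.
Qed.

Lemma ae_dominated_integrable f g : measurable_fun D f -> I g ->
  {ae mu, forall x, D x -> `|f x| <= g x} -> I f.
Proof.
move=> mf gi fg.
have mg := integrable_measurable gi.
apply/integrableP; split; first exact/measurable_EFinP.
have /integrableP[_] := gi; apply: le_lt_trans.
have H : (\int[mu]_(x in D) `|(f x)%:E| =
    \int[mu]_(x in D) (Num.min `|f x| `|g x|)%:E)%E.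
  apply: (@ae_eq_integral _ _ _ mu D (fun x => (Num.min `|f x| `|g x|)%:E)
    (fun x => `|(f x)%:E|)%E mD).
  - by apply/measurableT_comp => //; exact/measurable_EFinP.
  - by apply/measurable_EFinP; apply: measurable_minr; exact: measurableT_comp.
  - apply: filterS fg => x fgx /fgx fg; rewrite abse_EFin min_l//.
    exact: (le_trans fg (ler_norm _)).
(* The minimum with [g] changes [f] on a null set only and makes the bound hold
   everywhere. *)
rewrite H; apply: ge0_le_integral => //.
- by apply/measurable_EFinP; apply: measurable_minr; exact: measurableT_comp.
- by apply: measurableT_comp => //; exact/measurable_EFinP.
- by move=> x _; rewrite abse_EFin lee_fin ge_min lexx orbT.
Qed.

Lemma ae_le_integral f g : I f -> I g ->
  {ae mu, forall x, D x -> f x <= g x} ->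
  (\int[mu]_(x in D) (f x)%:E <= \int[mu]_(x in D) (g x)%:E)%E.
Proof.
move=> fi gi fg; have mf := integrable_measurable fi.
have mg := integrable_measurable gi.
rewrite (@ae_eq_integral _ _ _ mu D (fun x => (Num.min (f x) (g x))%:E) _ mD).
- apply: le_integral => //.
    apply: (ae_dominated_integrable (measurable_minr mf mg)
      (integrable_funD (integrable_abse fi) (integrable_abse gi))).
    apply: aeW => x _ /=.
    by rewrite /Order.min; case: ifP => _; rewrite ?lerDl ?lerDr.
  by move=> x _; rewrite lee_fin ge_min lexx orbT.
- exact/measurable_EFinP.
- by apply/measurable_EFinP; exact: measurable_minr.
- by apply: filterS fg => x fgx /fgx fg; rewrite min_l.
Qed.

Lemma cvg_dominated (f_ : nat -> T -> R) f g :
  (forall k, measurable_fun D (f_ k)) -> measurable_fun D f -> I g ->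
  {ae mu, forall x, D x -> f_ ^~ x @ \oo --> f x /\ forall k, `|f_ k x| <= g x} ->
  I f /\ (fun k => \int[mu]_(x in D) (f_ k x)%:E)%E @ \oo -->
    (\int[mu]_(x in D) (f x)%:E)%E.
Proof.
move=> mf_ mf gi H.
have [] := @dominated_convergence _ _ _ mu D mD (fun k x => (f_ k x)%:E)
  (fun x => (f x)%:E) (fun x => (g x)%:E).
- by move=> k; exact/measurable_EFinP.
- exact/measurable_EFinP.
- by apply: filterS H => x Hx /Hx[? _]; apply: cvg_EFin => //; exact: nearW.
- exact: gi.
- by apply: filterS H => x Hx k /Hx[_ /(_ k)]; rewrite abse_EFin lee_fin.
- by [].
Qed.

End real_integrable.

Lemma ler_sqr_norm (R : realDomainType) (x y : R) : `|x| <= y -> x ^+ 2 <= y ^+ 2.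
Proof.
move=> xy; rewrite -[x ^+ 2]real_normK ?num_real// lerXn2r// nnegrE.
exact: le_trans xy.
Qed.

Section energy_limit.
Context d (T : measurableType d) (R : realType) (mu : {measure set T -> \bar R}).
Context (D : set T) (mD : measurable D) (Dfin : (mu D < +oo)%E).
Context (n : nat) (a : T -> 'M[R]_n) (p b dchi : 'I_n -> T -> R).
Context (V u chi : T -> R) (lambda delta B : R) (l0 : 0 < lambda) (d0 : 0 < delta).
Local Notation I f := (mu.-integrable D (fun x => (f x)%:E)).
Context (ma : forall i j, measurable_fun D (fun x => a x i j)).
Context (mp : forall i, measurable_fun D (p i)).
Context (mb : forall i, measurable_fun D (b i)).
Context (mdchi : forall i, measurable_fun D (dchi i)).
Context (mV : measurable_fun D V) (mu_ : measurable_fun D u)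
  (mchi : measurable_fun D chi).
Context (ell : {ae mu, forall x, D x -> (a x)^T = a x /\
  forall xi : 'rV[R]_n, lambda * enorm xi ^+ 2
    <= \sum_i \sum_j a x i j * xi ord0 i * xi ord0 j
    <= lambda^-1 * enorm xi ^+ 2}).
Context (ip : forall i, I (fun x => p i x ^+ 2)).
Context (ib : forall i, I (fun x => chi x ^+ 2 * b i x ^+ 2)).
Context (Bchi : forall x, D x -> `|chi x| <= B /\ forall j, `|dchi j x| <= B).

Local Notation quadratic q := (fun x => form (a x) (p^~ x) (q^~ x)).
Local Notation drift s := (fun x => \sum_i b i x * p i x * s x).

Lemma measurable_quadratic (q : 'I_n -> T -> R) :
  (forall j, measurable_fun D (q j)) -> measurable_fun D (quadratic q).
Proof.
move=> mq; apply: measurable_sum => i; apply: measurable_sum => j.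
by apply: measurable_funM => //; exact: measurable_funM.
Qed.

Lemma measurable_drift (s : T -> R) : measurable_fun D s -> measurable_fun D (drift s).
Proof.
move=> ms; apply: measurable_sum => i.
by apply: measurable_funM => //; exact: measurable_funM.
Qed.

Lemma integrable_sqnorm (q : 'I_n -> T -> R) : (forall j, I (fun x => q j x ^+ 2)) ->
  I (fun x => sqnorm (q^~ x)).
Proof. exact: integrable_funsum. Qed.

Lemma integrable_quadratic (q : 'I_n -> T -> R) :
  (forall j, measurable_fun D (q j)) -> (forall j, I (fun x => q j x ^+ 2)) ->
  I (quadratic q).
Proof.
move=> mq iq.
apply: (ae_dominated_integrable mD (measurable_quadratic mq) (integrable_funZ mD lambda^-1
  (integrable_funD mD (integrable_sqnorm ip) (integrable_sqnorm iq)))).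
by apply: filterS ell => x H /H[aT e]; exact: form_bound.
Qed.

Lemma drift_bound (c : R) (s : T -> R) x : 0 <= c -> `|s x| <= c * chi x ^+ 2 -> D x ->
  `|drift s x| <= c * (\sum_i chi x ^+ 2 * b i x ^+ 2 + B ^+ 2 * sqnorm (p^~ x)).
Proof.
move=> c0 sc /Bchi[cB _].
rewrite (le_trans (ler_norm_sum _ _ _))// /sqnorm mulr_sumr -big_split/= mulr_sumr.
apply: ler_sum => i _; rewrite !normrM.
have h1 : `|b i x| * `|p i x| * `|s x| <= `|b i x| * `|p i x| * (c * chi x ^+ 2).
  by rewrite ler_wpM2l// mulr_ge0.
apply: (le_trans h1); rewrite mulrCA ler_wpM2l//.
have h2 : chi x ^+ 2 <= B ^+ 2.
  by rewrite -[chi x ^+ 2]real_normK ?num_real// lerXn2r ?nnegrE// (le_trans _ cB).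
have h3 : `|b i x| * `|p i x| <= b i x ^+ 2 + p i x ^+ 2.
  have := sqr_ge0 (`|b i x| - `|p i x|); rewrite sqrrB !real_normK ?num_real//.
  have := sqr_ge0 (b i x); have := sqr_ge0 (p i x); lra.
apply: (@le_trans _ _ ((b i x ^+ 2 + p i x ^+ 2) * chi x ^+ 2)).
  by rewrite ler_wpM2r// sqr_ge0.
by rewrite mulrDl [chi x ^+ 2 * _]mulrC lerD2l mulrC ler_wpM2r// sqr_ge0.
Qed.

Lemma integrable_drift (c : R) (s : T -> R) : 0 <= c -> measurable_fun D s ->
  (forall x, D x -> `|s x| <= c * chi x ^+ 2) -> I (drift s).
Proof.
move=> c0 ms sc.
apply: (ae_dominated_integrable mD (measurable_drift ms) (integrable_funZ mD c
  (integrable_funD mD (integrable_funsum mD ib)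
     (integrable_funZ mD (B ^+ 2) (integrable_sqnorm ip))))).
by apply: aeW => x Dx; apply: drift_bound => //; exact: sc.
Qed.

Context (iV : I (fun x => chi x ^+ 2 * `|V x|)).
Context (iVu : I (fun x => V x * u x * chi x ^+ 2)).
Context (u0 : {ae mu, forall x, D x -> 0 <= u x}).
Context (phi : nat -> T -> R) (dphi : nat -> 'I_n -> T -> R) (M : T -> R).
Context (mphi : forall k, measurable_fun D (phi k)).
Context (mdphi : forall k j, measurable_fun D (dphi k j)).
Context (iM : I M).
Context (phiu : {ae mu, forall x, D x -> phi ^~ x @ \oo --> u x}).
Context (dphip : forall j, {ae mu, forall x, D x ->
  (fun k => dphi k j x) @ \oo --> p j x /\ forall k, dphi k j x ^+ 2 <= M x}).

Let g := gtest delta.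
Let dg := dgtest delta.

(** The gradient and the value of the test function [chi ^+ 2 * g t], where [t]
    is [phi k] or its limit [u]. *)
Let grad (t : T -> R) (dt : 'I_n -> T -> R) (j : 'I_n) (x : T) : R :=
  2 * chi x * dchi j x * g (t x) + chi x ^+ 2 * (dg (t x) * dt j x).
Let val (t : T -> R) (x : T) : R := chi x ^+ 2 * g (t x).
Let total (t : T -> R) (dt : 'I_n -> T -> R) (x : T) : R :=
  form (a x) (p^~ x) (grad t dt ^~ x) + \sum_i b i x * p i x * val t x
  + V x * u x * val t x.

Context (phi_zero : forall k,
  (\int[mu]_(x in D) (total (phi k) (dphi k) x)%:E = 0)%E).

Let continuous_g : continuous g. Proof. exact: continuous_gtest. Qed.

Let continuous_dg : continuous dg. Proof. exact: continuous_dgtest. Qed.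

Let mg t : measurable_fun D t -> measurable_fun D (fun x => g (t x)).
Proof.
by move=> mt; apply: (measurableT_comp (continuous_measurable_fun continuous_g) mt).
Qed.

Let mgrad t dt j : measurable_fun D t -> (forall j, measurable_fun D (dt j)) ->
  measurable_fun D (grad t dt j).
Proof.
move=> mt mdt; apply: measurable_funD.
  by apply: measurable_funM (mg mt); apply: measurable_funM => //; exact: measurable_funM.
apply: measurable_funM; first exact: measurable_funX.
apply: measurable_funM => //.
exact: (measurableT_comp (continuous_measurable_fun continuous_dg) mt).
Qed.

Let mval t : measurable_fun D t -> measurable_fun D (val t).
Proof.
by move=> mt; apply: measurable_funM (mg mt); exact: measurable_funX.
Qed.

Let mtotal t dt : measurable_fun D t -> (forall j, measurable_fun D (dt j)) ->
  measurable_fun D (total t dt).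
Proof.
move=> mt mdt; apply: measurable_funD.
  apply: measurable_funD; last exact: measurable_drift (mval mt).
  by apply: measurable_quadratic => j; exact: mgrad.
by apply: measurable_funM (mval mt); exact: measurable_funM.
Qed.

Let C1 := 3 / delta.
Let C2 := 8 / (delta * delta).
Let C1_ge0 : 0 <= C1. Proof. by rewrite divr_ge0// ltW. Qed.

Let Cgrad (m : R) : R := 8 * (B ^+ 2 * C1) ^+ 2 + 2 * (B ^+ 2 * C2) ^+ 2 * m.

Let grad_bound t dt j x m : D x -> dt j x ^+ 2 <= m ->
  grad t dt j x ^+ 2 <= Cgrad m.
Proof.
move=> Dx dtm; have [cB /(_ j) dcB] := Bchi Dx.
have B0 : 0 <= B by exact: le_trans cB.
have h1 : (2 * chi x * dchi j x * g (t x)) ^+ 2 <= 4 * (B ^+ 2 * C1) ^+ 2.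
  rewrite (_ : 4 * _ = (2 * (B ^+ 2 * C1)) ^+ 2); last by ring.
  apply: ler_sqr_norm; rewrite -!mulrA normrM ger0_norm// ler_wpM2l//.
  rewrite normrM; apply: ler_pM => //.
  by rewrite normrM; apply: ler_pM => //; exact: gtest_bound.
have h2 : (chi x ^+ 2 * (dg (t x) * dt j x)) ^+ 2 <= (B ^+ 2 * C2) ^+ 2 * m.
  rewrite mulrA exprMn ler_pM ?sqr_ge0//; apply: ler_sqr_norm.
  rewrite normrM ler_pM//; last exact: dgtest_bound.
  by rewrite normrX lerXn2r ?nnegrE.
rewrite /grad /Cgrad; set X := (X in (X + _) ^+ 2); set Y := (Y in (_ + Y) ^+ 2).
have := sqr_ge0 (X - Y); rewrite -/X in h1; rewrite -/Y in h2.
move: h1 h2; lra.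
Qed.

Let val_bound t x : `|val t x| <= C1 * chi x ^+ 2.
Proof.
rewrite /val normrM mulrC (ger0_norm (sqr_ge0 (chi x))) ler_wpM2r ?sqr_ge0//.
exact: gtest_bound.
Qed.

Let dom (x : T) : R :=
  lambda^-1 * (sqnorm (p^~ x) + n%:R * Cgrad (M x)) +
  C1 * (\sum_i chi x ^+ 2 * b i x ^+ 2 + B ^+ 2 * sqnorm (p^~ x)) +
  C1 * `|V x * u x * chi x ^+ 2|.

Let idom : I dom.
Proof.
have ipn := integrable_sqnorm ip.
apply: (integrable_funD mD); last exact: (integrable_funZ mD _ (integrable_abse iVu)).
apply: (integrable_funD mD).
  apply/(integrable_funZ mD)/(integrable_funD mD ipn)/(integrable_funZ mD).
  apply: (integrable_funD mD); first exact: integrable_cst.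
  exact: (integrable_funZ mD _ iM).
apply/(integrable_funZ mD)/(integrable_funD mD); first exact: integrable_funsum.
exact: (integrable_funZ mD _ ipn).
Qed.

Let total_bound t dt x : D x -> (a x)^T = a x ->
  (forall xi : 'rV[R]_n, lambda * enorm xi ^+ 2
    <= \sum_i \sum_j a x i j * xi ord0 i * xi ord0 j
    <= lambda^-1 * enorm xi ^+ 2) ->
  (forall j, dt j x ^+ 2 <= M x) -> `|total t dt x| <= dom x.
Proof.
move=> Dx aT e dtM; rewrite /total /dom.
rewrite (le_trans (ler_normD _ _))// lerD//; last first.
  rewrite /val mulrA normrM mulrC ler_wpM2r//; exact: gtest_bound.
rewrite (le_trans (ler_normD _ _))// lerD//; last first.
  exact: (drift_bound C1_ge0 (val_bound t x) Dx).
apply: (le_trans (form_bound l0 aT e _ _)).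
rewrite ler_wpM2l ?invr_ge0 ?(ltW l0)// lerD2l /sqnorm.
rewrite (@le_trans _ _ (\sum_(j < n) Cgrad (M x)))//.
  by apply: ler_sum => j _; exact: grad_bound.
by rewrite sumr_const card_ord mulr_natl.
Qed.
(** The equation holds exactly for the test functions [chi ^+ 2 * g (phi k)], and
    dominated convergence carries it over to [u]. Only then does [energy_pointwise]
    apply, because it requires the nonnegativity that the [phi k] may lack. *)
Lemma energy_limit :
  (\int[mu]_(x in D) (lambda / 16 *
     (chi x ^+ 2 * sqnorm (fun i => gtest delta (u x) * p i x)))%:E <=
   \int[mu]_(x in D) (8 / lambda * sqnorm (dchi^~ x) +
     4 / lambda * (chi x ^+ 2 * sqnorm (b^~ x)) +
     2 * (chi x ^+ 2 * `|V x|))%:E)%E.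
Proof.
have [||||it cv] := @cvg_dominated _ _ R mu D mD
  (fun k => total (phi k) (dphi k)) (total u p) dom.
- by move=> k; exact: mtotal.
- exact: mtotal.
- exact: idom.
- have aeP : {ae mu, forall x, forall j, D x ->
      (fun k => dphi k j x) @ \oo --> p j x /\
      forall k, dphi k j x ^+ 2 <= M x}.
    exact: (@filter_forall _ _ (fun j x => D x ->
      (fun k => dphi k j x) @ \oo --> p j x /\
      forall k, dphi k j x ^+ 2 <= M x) (almost_everywhere mu)).
  apply: filterS3 ell phiu aeP => x E phix P Dx; have [aT e] := E Dx.
  have U := phix Dx.
  have px j := proj1 (P j Dx); have pM j := proj2 (P j Dx).
  have gu : (fun k => g (phi k x)) @ \oo --> g (u x).
    by apply: continuous_cvg; [exact: continuous_g|exact: U].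
  have dgu : (fun k => dg (phi k x)) @ \oo --> dg (u x).
    by apply: continuous_cvg; [exact: continuous_dg|exact: U].
  have vu : (fun k => val (phi k) x) @ \oo --> val u x.
    by apply: cvgM => //; exact: cvg_cst.
  split; last by move=> k; apply: total_bound => // j; exact: pM.
  apply: cvgD; last by apply: cvgM => //; exact: cvg_cst.
  apply: cvgD; last first.
    by apply: cvg_big => [|i _]; [exact: add_continuous|apply: cvgM => //; exact: cvg_cst].
  apply: cvg_big => [|i _]; first exact: add_continuous.
  apply: cvg_big => [|j _]; first exact: add_continuous.
  apply: cvgM; first exact: cvg_cst.
  apply: cvgD; first by apply: cvgM => //; exact: cvg_cst.
  by apply: cvgM; [exact: cvg_cst|exact: cvgM].
have zero : (\int[mu]_(x in D) (total u p x)%:E = 0)%E.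
  move: cv; rewrite (_ : (fun k => _) = cst 0%E); last exact/funext.
  by move=> /cvg_lim <-//; rewrite lim_cst.
pose lhs x := lambda / 16 * (chi x ^+ 2 * sqnorm (fun i => g (u x) * p i x)).
have ilhs : I lhs.
  have ml : measurable_fun D lhs.
    apply: measurable_funM => //; apply: measurable_funM; first exact: measurable_funX.
    apply: measurable_sum => i; apply: measurable_funX; apply: measurable_funM => //.
    exact: mg.
  apply: (ae_dominated_integrable mD ml (integrable_funZ mD
    (lambda / 16 * (B ^+ 2 * C1 ^+ 2)) (integrable_sqnorm ip))).
  apply: aeW => x /Bchi[cB _]; have l16 : 0 <= lambda / 16 by rewrite divr_ge0 ?ltW.
  rewrite /lhs sqnormZ ger0_norm; last first.
    by rewrite mulr_ge0// mulr_ge0 ?sqr_ge0// mulr_ge0 ?sqr_ge0 ?sqnorm_ge0.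
  rewrite -[leRHS]mulrA ler_wpM2l// mulrA ler_wpM2r ?sqnorm_ge0//.
  rewrite ler_pM ?sqr_ge0//; apply: ler_sqr_norm => //.
  exact: gtest_bound.
have irhs : I (fun x => 8 / lambda * sqnorm (dchi^~ x) +
     4 / lambda * (chi x ^+ 2 * sqnorm (b^~ x)) + 2 * (chi x ^+ 2 * `|V x|)).
  apply: (integrable_funD mD); last exact: (integrable_funZ mD _ iV).
  apply: (integrable_funD mD); apply: (integrable_funZ mD).
    apply: (ae_dominated_integrable mD _
      (integrable_cst mD (n%:R * B ^+ 2) Dfin)).
      by apply: measurable_sum => j; exact: measurable_funX.
    apply: aeW => x /Bchi[_ dB] /=; rewrite ger0_norm ?sqnorm_ge0// /sqnorm.
    rewrite mulr_natl -[X in _ *+ X](card_ord n) -sumr_const.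
    by apply: ler_sum => j _; apply: ler_sqr_norm; exact: dB.
  by under eq_fun do rewrite /sqnorm mulr_sumr; exact: integrable_funsum.
rewrite -[leLHS]add0e -zero -(integralD mD it ilhs).
apply: (ae_le_integral mD (integrable_funD mD it ilhs) irhs).
apply: filterS2 ell u0 => x E U0 Dx; have [aT e] := E Dx.
have ux := U0 Dx.
have := @energy_pointwise _ _ _ _ l0 aT e (chi x) (g (u x)) (dg (u x)) (dchi^~ x)
  (p^~ x) (b^~ x) (V x) (u x) (gtest_ge0 d0 ux) (gtest_decay d0 ux) (gtest_mul_le d0 ux).
by rewrite -[X in X <= _]/(total u p x) /lhs; lra.
Qed.

End energy_limit.

(** * Growth of the coefficients on cubes *)

Section balls.
Context (R : realType) (n : nat).
Implicit Types (x q : 'rV[R]_n) (r : R).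

Lemma enorm_ge0 x : 0 <= enorm x. Proof. exact: sqrtr_ge0. Qed.

Lemma sqr_enorm x : enorm x ^+ 2 = \sum_i x ord0 i ^+ 2.
Proof. by rewrite /enorm sqr_sqrtr// sumr_ge0// => i _; exact: sqr_ge0. Qed.

Lemma continuous_enorm_sub q : continuous (fun x : 'rV[R]_n => enorm (q - x)).
Proof.
have -> : (fun x : 'rV[R]_n => enorm (q - x)) =
    Num.sqrt \o (fun x : 'rV[R]_n => \sum_(i < n) (q ord0 i - x ord0 i) ^+ 2).
  by apply/funext => x; rewrite /enorm/=; under eq_bigr do rewrite !mxE.
apply: continuous_fun_comp; last exact: sqrt_continuous.
apply: (@Ck_continuous R n 0); elim: (index_enum 'I_n) => [|i s IH].
  by rewrite (_ : (fun _ => _) = cst 0); [exact: Ck_cst|apply/funext => x; rewrite big_nil].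
rewrite (_ : (fun _ => _) = (fun x => (q ord0 i - x ord0 i) * (q ord0 i - x ord0 i)) \+
    (fun x => \sum_(j <- s) (q ord0 j - x ord0 j) ^+ 2)); last first.
  by apply/funext => x; rewrite big_cons expr2.
apply: CkD => //; by apply: CkM; apply: CkB; solve [exact: Ck_cst|exact: Ck_coord].
Qed.

Lemma measurable_eball q r : measurable (eball q r).
Proof.
apply: open_measurable_rV; rewrite /eball.
by have /continuousP/(_ _ (@open_lt R r)) := @continuous_enorm_sub q.
Qed.

Lemma eball_cube q r : eball q r `<=` cube q r.
Proof.
move=> x; rewrite /eball/= => xr i; have r0 : 0 <= r.
  by rewrite ltW// (le_lt_trans _ xr)// enorm_ge0.
apply: le_trans (ltW xr); rewrite -(ler_pXn2r (n := 2)) ?nnegrE ?enorm_ge0//.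
rewrite real_normK ?num_real// sqr_enorm (bigD1 i)//= !mxE -sqrrN opprB lerDl.
by apply: sumr_ge0 => j _; exact: sqr_ge0.
Qed.

Lemma cube_eball q r : 0 < r -> cube q r `<=` eball q (n.+1%:R * r).
Proof.
move=> r0 x cx; rewrite /eball/=; have s0 : 0 <= n.+1%:R * r by rewrite mulr_ge0// ltW.
rewrite -(ltr_pXn2r (n := 2)) ?nnegrE ?enorm_ge0// sqr_enorm.
apply: (@le_lt_trans _ _ (\sum_(i < n) r ^+ 2)).
  apply: ler_sum => i _; rewrite !mxE -sqrrN opprB; apply: ler_sqr_norm; exact: cx.
rewrite sumr_const card_ord exprMn -[X in X < _]mulr_natl ltr_pM2r ?exprn_gt0// -natrX ltr_nat.
by rewrite expnS expn1 (leq_trans (ltnSn n))// leq_pmulr.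
Qed.

Lemma eball0 x y : enorm (x - y) = 0 -> y = x.
Proof.
move=> xy; apply/rowP => i; apply/eqP; rewrite -subr_eq0 -normr_le0.
have [//|pos] := leP `|y ord0 i - x ord0 i| 0.
suff : eball x (`|y ord0 i - x ord0 i| / 2) y.
  move=> /eball_cube/(_ i); rewrite leNgt => /negP; case.
  by rewrite ltr_pdivrMr// ltr_pMr// ltr1n.
by rewrite /eball/= xy divr_gt0.
Qed.

End balls.

(** The integral of a nonnegative function is a supremum over the simple functions
    below it; this form also applies to functions that may fail to be measurable,
    such as the integrand of the third growth condition. *)
Lemma ge0_integral_mono d (T : measurableType d) (R : realType)
    (mu : {measure set T -> \bar R}) (f g : T -> \bar R) :
  (forall x, 0 <= f x)%E -> (forall x, f x <= g x)%E ->
  (\int[mu]_x f x <= \int[mu]_x g x)%E.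
Proof.
move=> f0 fg; have g0 x : (0 <= g x)%E by exact: le_trans (fg x).
rewrite !ge0_integralTE//; apply: ereal_sup_le => _ [h fh <-].
by exists h => // x; exact: le_trans (fh x) (fg x).
Qed.

Lemma measurable_fun_powR d (T : measurableType d) (R : realType) (D : set T)
    (f : T -> R) (p : R) :
  measurable_fun D f -> measurable_fun D (fun x => f x `^ p).
Proof. by move=> mf; exact: (measurableT_comp (measurable_powR p) mf). Qed.

(** The two summands dominate [t] on either side of the height [s]. *)
Lemma young_split (R : realType) (p t s : R) : 1 < p -> 0 < s -> 0 <= t ->
  t <= s + t `^ p * s `^ (1 - p).
Proof.
move=> p1 s0 t0; have [ts|st] := leP t s.
  by apply: (le_trans ts); rewrite lerDl mulr_ge0// powR_ge0.
have tp : 0 < t by exact: lt_trans st.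
apply: (@le_trans _ _ (t `^ p * s `^ (1 - p))); last by rewrite lerDr ltW.
rewrite -mulr_powRB1// ?(lt_trans ltr01 p1)// -mulrA ler_peMr//.
rewrite (_ : s `^ (1 - p) = (s `^ (p - 1))^-1); last by rewrite -powRN opprB.
rewrite ler_pdivlMr ?powR_gt0// mul1r ge0_ler_powR ?nnegrE ?subr_ge0 ?ltW//.
Qed.

Lemma integral_young d (T : measurableType d) (R : realType)
    (mu : {measure set T -> \bar R}) (A B : set T) (f : T -> R) (p s m L : R) :
  1 < p -> 0 < s -> measurable A -> measurable B -> mu A = m%:E -> A `<=` B ->
  measurable_fun setT f ->
  (\int[mu]_(x in B) (`|f x| `^ p)%:E <= L%:E)%E ->
  (\int[mu]_(x in A) `|f x|%:E <= (s * m + s `^ (1 - p) * L)%:E)%E.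
Proof.
move=> p1 s0 mA mB muA AB mf fL.
have mp D : measurable_fun D (fun y => `|f y| `^ p).
  apply: measurable_fun_powR; apply: measurable_funTS; exact: measurableT_comp.
have pp y : 0 <= `|f y| `^ p by exact: powR_ge0.
have sp : 0 <= s `^ (1 - p) by exact: powR_ge0.
apply: (@le_trans _ _ (\int[mu]_(x in A)
   (s%:E + (s `^ (1 - p))%:E * (`|f x| `^ p)%:E))%E).
  apply: ge0_le_integral => //.
  - by apply: measurable_funTS; apply/measurable_EFinP; exact: measurableT_comp.
  - apply: emeasurable_funD => //; apply: emeasurable_funM => //.
    by apply/measurable_EFinP.
  - by move=> x _; rewrite -EFinM -EFinD lee_fin mulrC; exact: young_split.
rewrite ge0_integralD//; last 3 first.
- by move=> x _; rewrite lee_fin ltW.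
- by move=> x _; rewrite -EFinM lee_fin mulr_ge0.
- by apply: emeasurable_funM => //; apply/measurable_EFinP.
rewrite ge0_integralZl//; last by apply/measurable_EFinP.
rewrite integral_cst// muA EFinD [in X in (_ <= _ + X)%E]EFinM; apply: leeD => //.
apply: lee_wpmul2l; first by rewrite lee_fin.
apply: le_trans fL; apply: ge0_subset_integral => //.
by apply/measurable_EFinP.
Qed.

Section growth.
Context (R : realType) (n : nat).
Implicit Types (f V : 'rV[R]_n -> R) (q x : 'rV[R]_n) (r K alpha p : R).

(** The common consequence of the two sets of assumptions: on the scale [r], the
    function weighs no more than an inverse-square potential. *)
Definition cube_growth K f := forall q r, 0 < r -> r <= 1 ->
  (\int[lebesgue_rV]_(x in cube q r) `|f x|%:E <= (K * (r ^+ n / r ^+ 2))%:E)%E.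

Lemma powR_le_sqr (r s : R) : 0 < r -> r <= 1 -> n%:R - 2 <= s ->
  r `^ s <= r ^+ n / r ^+ 2.
Proof.
move=> r0 r1 s2; rewrite -!powR_mulrn ?(ltW r0)// -powRB; last first.
  by apply/implyP => _; rewrite gt_eqF.
by apply: ger_powR => //; rewrite r0.
Qed.

(** On the cube of radius [r] the kernel is at least a multiple of
    [r ^ (alpha - n)], and [r ^ (n - alpha) <= r ^ (n - 2)] because [alpha <= 2]. *)
Lemma stummel_growth alpha f : (0 < n)%N -> alpha <= 2 -> alpha < n%:R ->
  measurable_fun setT f -> stummel alpha f -> exists2 K, 0 <= K & cube_growth K f.
Proof.
move=> n0 a2 an mf [_ eta]; set c : R := n.+1%:R.
have c0 : 0 < c by rewrite ltr0n.
have := eta c c0; set E := stummel_eta alpha f c => Efin.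
have E0 : (0 <= E)%E.
  apply: (@le_trans _ _ (\int[lebesgue_rV]_(y in eball 0 c)
      (`|f y| / enorm (0 - y) `^ (n%:R - alpha))%:E)%E).
    by apply: integral_ge0 => y _; rewrite lee_fin divr_ge0// powR_ge0.
  by apply: ereal_sup_ubound; exists 0.
exists (c `^ (n%:R - alpha) * fine E).
  by rewrite mulr_ge0 ?powR_ge0 ?fine_ge0.
move=> q r r0 r1; set e := n%:R - alpha.
have e0 : 0 < e by rewrite subr_gt0.
have s0 : 0 < c * r by rewrite mulr_gt0.
have mint : measurable_fun setT (fun y => `|f y| / enorm (q - y) `^ e).
  apply: measurable_funM; first exact: measurableT_comp.
  under eq_fun do rewrite -powRN.
  apply: measurable_fun_powR.
  exact/continuous_measurable_rV/continuous_enorm_sub.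
have q1 : cube q 0 = [set q].
    apply/seteqP; split => [x cx|_ -> i]; last by rewrite subrr normr0.
    apply/rowP => i; apply/eqP; rewrite -subr_eq0 -normr_eq0 eq_le normr_ge0 andbT.
    exact: cx.
have qq0 : lebesgue_rV [set q] = 0%E.
  rewrite -q1 lebesgue_cube// mulr0 expr0n; case: (n) n0 => //.
pose h y := ((c * r) `^ e * (`|f y| / enorm (q - y) `^ e))%:E.
have h0 y : (0 <= h y)%E by rewrite lee_fin mulr_ge0 ?divr_ge0 ?powR_ge0.
have mh D : measurable_fun D h.
  apply: measurable_funTS; apply/measurable_EFinP.
  by apply: measurable_funM.
have mcq := measurable_cube q r.
have step1 : (\int[lebesgue_rV]_(x in cube q r) `|f x|%:E <=
    \int[lebesgue_rV]_(x in cube q r) h x)%E.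
  apply: (ae_ge0_le_integral mcq) => [||x _|//|].
  - by move=> x _; rewrite lee_fin.
  - apply: measurable_funTS; apply/measurable_EFinP; exact: measurableT_comp.
  - exact: h0.
  exists [set q]; split; [by rewrite -q1; exact: measurable_cube|exact: qq0|].
  move=> x /= xh; apply: contrapT => xq; apply: xh => cx.
  rewrite lee_fin mulrCA ler_peMr// ler_pdivlMr ?mul1r.
    apply: ge0_ler_powR; rewrite ?nnegrE ?(ltW e0) ?(ltW s0) ?enorm_ge0//.
    exact/ltW/(cube_eball r0 cx).
  rewrite powR_gt0// lt_neqAle enorm_ge0 andbT eq_sym; apply/eqP => xq0; apply: xq.
  exact: eball0.
apply: (le_trans step1).
apply: (@le_trans _ _ (\int[lebesgue_rV]_(x in eball q (c * r)) h x)%E).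
  apply: ge0_subset_integral => //; [exact: measurable_eball|exact: cube_eball].
rewrite /h; under eq_integral do rewrite EFinM.
rewrite ge0_integralZl//; last 4 first.
- exact: measurable_eball.
- by apply: measurable_funTS; apply/measurable_EFinP.
- by move=> x _; rewrite lee_fin divr_ge0 ?powR_ge0.
- by rewrite lee_fin powR_ge0.
have le1 : (\int[lebesgue_rV]_(x in eball q (c * r))
    (`|f x| / enorm (q - x) `^ e)%:E <= E)%E.
  apply: (@le_trans _ _ (\int[lebesgue_rV]_(x in eball q c)
    (`|f x| / enorm (q - x) `^ e)%:E)%E).
    apply: ge0_subset_integral; [exact: measurable_eball|exact: measurable_eball| | |].
    + by apply: measurable_funTS; apply/measurable_EFinP.
    + by move=> x _; rewrite lee_fin divr_ge0 ?powR_ge0.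
    + move=> x; rewrite /eball/= => /lt_le_trans; apply.
      by rewrite ger_pMr.
  by apply: ereal_sup_ubound; exists q.
apply: (@le_trans _ _ (((c * r) `^ e)%:E * E)%E).
  by rewrite lee_pmul2l ?lte_fin ?powR_gt0.
rewrite -(@fineK _ E); last by rewrite ge0_fin_numE.
rewrite -EFinM lee_fin powRM ?(ltW r0)// ?(ltW c0)// mulrAC.
rewrite ler_wpM2l ?mulr_ge0 ?powR_ge0 ?fine_ge0//.
by apply: powR_le_sqr => //; rewrite lerD2l lerN2.
Qed.

(** Between [d] and [2 d] the integrand of the third growth condition is bounded below by
    a multiple of its value at [d], by the first condition. *)
Lemma phi_growth alpha p phi C1 C2 C3 : 0 < C1 -> 0 < C3 ->
  (forall t, 0 < t -> 0 < phi t) -> growth n alpha p phi C1 C2 C3 ->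
  exists2 C, 0 < C & forall d, 0 < d -> phi d <= C * d `^ (n%:R - p * alpha).
Proof.
move=> C10 C30 phi0 [g1 _ g3]; set b := n.+1%:R - p / 2 * (alpha + 1).
pose k := Num.max 1 (2 `^ b).
have k0 : 0 < k by rewrite lt_max ltr01.
exists (C1 * k * C3); first by rewrite !mulr_gt0.
move=> d d0; set w := phi d / C1 / (k * d `^ b).
have w0 : 0 <= w by rewrite !divr_ge0 ?mulr_ge0 ?powR_ge0 ?ltW// phi0.
have low t : d < t -> t <= 2 * d -> w <= phi t / t `^ b.
  move=> dt t2; have t0 : 0 < t by exact: lt_trans dt.
  rewrite /w ler_pM ?divr_ge0 ?invr_ge0 ?mulr_ge0 ?powR_ge0 ?(ltW k0) ?(ltW C10)//.
  - exact/ltW/phi0.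
  - by rewrite ler_pdivrMr// mulrC; apply: g1 => //; exact: ltW.
  rewrite lef_pV2 ?posrE ?mulr_gt0 ?powR_gt0//.
  have -> : t `^ b = (t / d) `^ b * d `^ b.
    by rewrite -powRM ?divr_ge0 ?ltW// divfK// gt_eqF.
  rewrite ler_wpM2r ?powR_ge0// /k le_max.
  have td1 : 1 <= t / d by rewrite ler_pdivlMr// mul1r ltW.
  have td2 : t / d <= 2 by rewrite ler_pdivrMr.
  have [b0|b0] := leP 0 b.
    by apply/orP; right; apply: ge0_ler_powR => //; rewrite nnegrE// (le_trans ler01).
  apply/orP; left; rewrite -(powRr0 (t / d)).
  by apply: ler_powR => //; exact: ltW.
pose d2 := 2 * d; have : (\int[lebesgue_measure]_(t in `]d, d2]) w%:E <=
   \int[lebesgue_measure]_(t in `]d, +oo[) (phi t / t `^ b)%:E)%E.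
  rewrite integral_mkcond [leRHS]integral_mkcond; apply: ge0_integral_mono => t.
    by rewrite /patch; case: ifP => _; rewrite lee_fin.
  rewrite /patch; case: ifPn => [|_].
    rewrite inE/= in_itv/= => /andP[dt td]; rewrite ifT ?inE/= ?in_itv/= ?dt//.
    by rewrite lee_fin; exact: low.
  case: ifPn => //; rewrite inE/= in_itv/= andbT => dt.
  by rewrite lee_fin divr_ge0 ?powR_ge0// ltW// phi0// (lt_trans d0).
move=> /le_trans/(_ (g3 _ d0)); rewrite integral_cst//.
have vol : lebesgue_measure `]d, d2]%classic = d%:E.
  rewrite lebesgue_measure_itv/= /d2 lte_fin ltr_pMl// ltr1n/= -EFinB.
  by rewrite mulr_natl mulr2n addrK.
rewrite [X in (_ * X)%E]vol -EFinM lee_fin.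
move=> wd; rewrite -[leRHS]mulrA [leRHS]mulrC.
have -> : d `^ (n%:R - p * alpha) = d `^ b * d `^ (p / 2 * (1 - alpha)) / d.
  rewrite -[X in _ / X](powRr1 (ltW d0)) -powRD ?(gt_eqF d0) ?implybT//.
  rewrite -powRB ?(gt_eqF d0) ?implybT//; congr (_ `^ _).
  by rewrite /b -natr1; lra.
move: wd; rewrite /w; set A := d `^ b; set B := d `^ _ => wd.
have A0 : 0 < A by exact: powR_gt0.
have -> : C3 * (A * B / d) * (C1 * k) = C3 * B * (C1 * (k * A) / d).
  by field; exact: lt0r_neq0.
have -> : phi d = phi d / C1 / (k * A) * d * (C1 * (k * A) / d).
  by field; rewrite !lt0r_neq0.
by rewrite ler_wpM2r// divr_ge0 ?mulr_ge0 ?ltW.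
Qed.

Lemma morrey_ball p phi f : 1 < p -> (forall t, 0 < t -> 0 < phi t) ->
  morrey p phi f -> exists2 M, 0 <= M & forall q s, 0 < s ->
    (\int[lebesgue_rV]_(y in eball q s) (`|f y| `^ p)%:E <= (M * phi s)%:E)%E.
Proof.
move=> p1 phi0 [_]; set N := morrey_norm p phi f => Nfin.
have p0 : 0 < p by exact: lt_trans p1.
have N0 : (0 <= N)%E.
  apply: (@le_trans _ _ (((phi 1)^-1%:E * \int[lebesgue_rV]_(y in eball 0 1)
     (`|f y| `^ p)%:E) `^ p^-1)%E); first exact: poweR_ge0.
  by apply: ereal_sup_ubound; exists 0, 1; split.
exists (fine N `^ p); first exact: powR_ge0.
move=> q s s0; set I := (X in (X <= _)%E).
have I0 : (0 <= I)%E by apply: integral_ge0 => y _; rewrite lee_fin powR_ge0.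
have ps := phi0 s s0.
have IN : (((phi s)^-1%:E * I) `^ p^-1 <= N)%E.
  by apply: ereal_sup_ubound; exists q, s; split.
have J0 : (0 <= (phi s)^-1%:E * I)%E by rewrite mule_ge0// lee_fin invr_ge0 ltW.
have : ((phi s)^-1%:E * I <= N `^ p)%E.
  have -> : ((phi s)^-1%:E * I = (((phi s)^-1%:E * I) `^ p^-1) `^ p)%E.
    by rewrite -poweRrM mulVf ?gt_eqF// poweRe1.
  have in0 (x : \bar R) : (0 <= x)%E -> x \in `[0, +oo]%E.
    by move=> x0; rewrite in_itv/= x0 leey.
  by apply: (gt0_ler_poweR (ltW p0)) => //; apply: in0 => //; exact: poweR_ge0.
rewrite -(@fineK _ N) ?ge0_fin_numE// poweR_EFin.
by rewrite -lee_pdivlMl ?invr_gt0// invrK -EFinM mulrC.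
Qed.

(** The height [r ^ (-2)] in [young_split] makes the first term of the order
    [r ^ (n - 2)]; the second is then of the order [r ^ (n - 2 + p (2 - alpha))],
    by the bound of [phi_growth]. *)
Lemma morrey_growth alpha p phi C1 C2 C3 f : alpha <= 2 -> 1 < p ->
  0 < C1 -> 0 < C3 -> (forall t, 0 < t -> 0 < phi t) ->
  growth n alpha p phi C1 C2 C3 -> measurable_fun setT f ->
  morrey p phi f -> exists2 K, 0 <= K & cube_growth K f.
Proof.
move=> a2 p1 C10 C30 phi0 gr mf mor.
have [C C0 phiC] := phi_growth C10 C30 phi0 gr.
have [M M0 fM] := morrey_ball p1 phi0 mor.
set c : R := n.+1%:R; have c0 : 0 < c by rewrite ltr0n.
set b := n%:R - p * alpha.
exists (2 ^+ n + M * (C * c `^ b)).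
  by rewrite addr_ge0 ?mulr_ge0 ?exprn_ge0 ?powR_ge0 ?(ltW C0).
move=> q r r0 r1; pose s := r `^ (- 2); have s0 : 0 < s by exact: powR_gt0.
have mcq := measurable_cube q r.
have cr : 0 < c * r by exact: mulr_gt0.
have mes := measurable_eball q (c * r).
have vol : (lebesgue_rV (cube q r) = ((2 * r) ^+ n)%:E)%E by exact/lebesgue_cube/ltW.
apply: (le_trans (integral_young p1 s0 mcq mes vol (cube_eball r0) mf (fM q _ cr))).
have r2 : r `^ (n%:R - 2) = r ^+ n / r ^+ 2.
  by rewrite -!powR_mulrn ?(ltW r0)// -powRB// (gt_eqF r0) implybT.
rewrite lee_fin [leRHS]mulrDl; apply: lerD.
  rewrite exprMn mulrCA ler_wpM2l ?exprn_ge0// -r2 /s.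
  by rewrite -powR_mulrn ?(ltW r0)// -powRD ?(gt_eqF r0) ?implybT// addrC.
apply: (@le_trans _ _ (s `^ (1 - p) * (M * (C * (c * r) `^ b)))).
  by apply: ler_wpM2l; [exact: powR_ge0|apply: ler_wpM2l => //; exact: phiC].
rewrite powRM ?(ltW c0) ?(ltW r0)//.
have -> : s `^ (1 - p) * (M * (C * (c `^ b * r `^ b))) =
  M * (C * c `^ b) * (s `^ (1 - p) * r `^ b) by ring.
rewrite ler_wpM2l ?mulr_ge0 ?powR_ge0 ?(ltW C0)//.
rewrite /s -powRrM -powRD ?(gt_eqF r0) ?implybT//.
by apply: powR_le_sqr => //; rewrite /b; nra.
Qed.

End growth.

(** * The energy estimate on cubes *)

Section energy_compare.
Context d (T : measurableType d) (R : realType) (mu : {measure set T -> \bar R}).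
Context (n : nat) (D Q E : set T) (b dchi : 'I_n -> T -> R) (V chi s : T -> R).
Context (l B m L : R).

(** The left-hand side is restricted to the set where [chi] equals one, the
    right-hand side to the set outside of which [chi] vanishes. *)
Lemma energy_compare : 0 < l ->
  measurable D -> measurable Q -> measurable E -> Q `<=` E -> E `<=` D ->
  measurable_fun D s -> (forall x, 0 <= s x) ->
  measurable_fun D chi -> (forall i, measurable_fun D (dchi i)) ->
  (forall i, measurable_fun D (b i)) -> measurable_fun D V ->
  (forall x, Q x -> chi x = 1) -> (forall x, `|chi x| <= 1) ->
  (forall x, ~ E x -> chi x = 0 /\ forall i, dchi i x = 0) ->
  (forall x i, `|dchi i x| <= B) -> mu E = m%:E ->
  (forall i, (\int[mu]_(x in E) `|b i x ^+ 2|%:E <= L%:E)%E) ->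
  (\int[mu]_(x in E) `|V x|%:E <= L%:E)%E ->
  (\int[mu]_(x in D) (l / 16 * (chi x ^+ 2 * s x))%:E <=
   \int[mu]_(x in D) (8 / l * sqnorm (dchi^~ x) +
     4 / l * (chi x ^+ 2 * sqnorm (b^~ x)) + 2 * (chi x ^+ 2 * `|V x|))%:E)%E ->
  (\int[mu]_(x in Q) (s x)%:E <=
    (16 / l * (8 / l * (n%:R * B ^+ 2) * m + (4 / l * n%:R + 2) * L))%:E)%E.
Proof.
move=> l0 mD mQ mE QE ED ms s0 mchi mdchi mb mV chi1 chile chi0 dchile muE bL VL.
have l16 : 0 < l / 16 by rewrite divr_gt0.
have c8 : 0 <= 8 / l by rewrite divr_ge0// ltW.
have B0 : 0 <= 8 / l * (n%:R * B ^+ 2).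
  by apply: mulr_ge0 => //; apply: mulr_ge0 => //; exact: sqr_ge0.
have c4 : 0 <= 4 / l by rewrite divr_ge0// ltW.
have left_le : ((l / 16)%:E * \int[mu]_(x in Q) (s x)%:E <=
    \int[mu]_(x in D) (l / 16 * (chi x ^+ 2 * s x))%:E)%E.
  rewrite -ge0_integralZl//; last 3 first.
  - by apply/measurable_EFinP; apply: measurable_funS ms => // x /QE/ED.
  - by move=> x _; rewrite lee_fin.
  - by rewrite lee_fin ltW.
  apply: (@le_trans _ _ (\int[mu]_(x in Q) (l / 16 * (chi x ^+ 2 * s x))%:E)%E).
    rewrite le_eqVlt; apply/orP; left; apply/eqP.
    apply: eq_integral => x; rewrite inE => Qx.
    by rewrite -EFinM (chi1 _ Qx) expr1n mul1r.
  apply: ge0_subset_integral => //.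
  - apply/measurable_EFinP; apply: measurable_funM => //.
    by apply: measurable_funM => //; exact: measurable_funX.
  - move=> x _; rewrite lee_fin; apply: mulr_ge0; first exact: ltW.
    by apply: mulr_ge0 => //; exact: sqr_ge0.
  - by move=> x /QE/ED.
move=> /(le_trans left_le) H.
have {}H : ((l / 16)%:E * \int[mu]_(x in Q) (s x)%:E <=
    \int[mu]_(x in E) ((8 / l * (n%:R * B ^+ 2))%:E +
      \sum_(i < n) (4 / l)%:E * `|b i x ^+ 2|%:E + 2%:E * `|V x|%:E))%E.
  apply: (le_trans H); rewrite (_ : (\int[mu]_(x in D) _ = \int[mu]_(x in E) 
      (8 / l * sqnorm (dchi^~ x) + 4 / l * (chi x ^+ 2 * sqnorm (b^~ x)) +
       2 * (chi x ^+ 2 * `|V x|))%:E)%E); last first.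
    rewrite integral_mkcond [RHS]integral_mkcond.
    apply: eq_integral => x _; rewrite !patchE.
    case: ifPn => xD; case: ifPn => xE //; last first.
      by move: xD; rewrite notin_setE; case; apply: ED; rewrite inE in xE.
    have [-> dc] := chi0 x (elimN (asboolP _) xE).
    rewrite /sqnorm big1 => [|i _]; last by rewrite dc expr0n.
    by rewrite expr0n /= !mul0r !mulr0 !addr0.
  apply: ge0_le_integral => //.
  - move=> x _; rewrite lee_fin; apply: addr_ge0; last first.
      by apply: mulr_ge0 => //; apply: mulr_ge0 => //; exact: sqr_ge0.
    apply: addr_ge0; first by apply: mulr_ge0 => //; exact: sqnorm_ge0.
    apply: mulr_ge0 => //; apply: mulr_ge0; [exact: sqr_ge0|exact: sqnorm_ge0].
  - apply/measurable_EFinP; apply: (measurable_funS mD ED).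
    apply: measurable_funD; last first.
      apply: measurable_funM => //; apply: measurable_funM; first exact: measurable_funX.
      exact: measurableT_comp.
    apply: measurable_funD; apply: measurable_funM => //.
      by apply: measurable_sum => i; exact: measurable_funX.
    apply: measurable_funM; first exact: measurable_funX.
    by apply: measurable_sum => i; exact: measurable_funX.
  - apply: (measurable_funS mD ED); apply: emeasurable_funD.
      apply: emeasurable_funD => //; apply: emeasurable_sum => i.
      apply: emeasurable_funM => //; apply/measurable_EFinP.
      by apply: measurableT_comp => //; exact: measurable_funX.
    apply: emeasurable_funM => //; apply/measurable_EFinP; exact: measurableT_comp.
  - move=> x _; under eq_bigr do rewrite -EFinM; rewrite sumEFin -EFinM -!EFinD lee_fin.
    have c2 : chi x ^+ 2 <= 1.
      by rewrite -(expr1n _ 2); apply: ler_sqr_norm; exact: chile.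
    rewrite !lerD//; last by rewrite ler_wpM2l// ler_piMl.
      rewrite ler_wpM2l// /sqnorm mulr_natl -[X in _ *+ X](card_ord n) -sumr_const.
      by apply: ler_sum => i _; apply: ler_sqr_norm; exact: dchile.
    rewrite -mulr_sumr ler_wpM2l// (@le_trans _ _ (sqnorm (b^~ x)))//.
      by rewrite ler_piMl// sqnorm_ge0.
    by apply: ler_sum => i _; rewrite ler_norm.
have mEb i : measurable_fun E (fun x => `|b i x ^+ 2|%:E).
  apply/measurable_EFinP; apply: (measurable_funS mD ED).
  by apply: measurableT_comp => //; exact: measurable_funX.
have mEV : measurable_fun E (fun x => `|V x|%:E).
  by apply/measurable_EFinP; apply: (measurable_funS mD ED); exact: measurableT_comp.
move: H; rewrite ge0_integralD//; last 3 first.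
- move=> x _; apply: adde_ge0; first by rewrite lee_fin B0.
  by apply: sume_ge0 => i _; apply: mule_ge0; rewrite lee_fin.
- apply: emeasurable_funD => //; apply: emeasurable_sum => i.
  by apply: emeasurable_funM.
- by apply: emeasurable_funM.
rewrite ge0_integralD//; last 2 first.
- by move=> x _; apply: sume_ge0 => i _; apply: mule_ge0; rewrite lee_fin.
- by apply: emeasurable_sum => i; exact: emeasurable_funM.
rewrite integral_cst// muE ge0_integral_sum//; last 2 first.
- by move=> i; exact: emeasurable_funM.
- by move=> i x _; apply: mule_ge0; rewrite lee_fin.
rewrite ge0_integralZl// => H.
have sumle : (\sum_(i < n) \int[mu]_(x in E) ((4 / l)%:E * `|b i x ^+ 2|%:E) <=
    (4 / l * n%:R * L)%:E)%E.
  apply: (@le_trans _ _ (\sum_(i < n) (4 / l * L)%:E)%E).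
    apply: lee_sum => i _; rewrite ge0_integralZl// [leRHS]EFinM.
    by apply: lee_wpmul2l; [rewrite lee_fin|exact: bL].
  by rewrite sumEFin sumr_const card_ord lee_fin [leRHS]mulrAC [leRHS]mulr_natr.
have Vle : (2%:E * \int[mu]_(x in E) `|V x|%:E <= (2 * L)%:E)%E.
  by rewrite [leRHS]EFinM; apply: lee_wpmul2l; [rewrite lee_fin|].
have {H}H := le_trans H (leeD (leeD (le_refl _) sumle) Vle).
rewrite -lee_pdivlMl// in H; apply: (le_trans H).
by rewrite -EFinM lee_fin invf_div -addrA -mulrDl.
Qed.

End energy_compare.

Section energy_cube.
Context (R : realType) (n : nat) (Omega : set 'rV[R]_n).
Context (a : 'rV[R]_n -> 'M[R]_n) (b : 'I_n -> 'rV[R]_n -> R)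
  (V u : 'rV[R]_n -> R).
Context (oO : open Omega) (Ofin : (lebesgue_rV Omega < +oo)%E).
Context (ell : elliptic Omega a).
Context (mb : forall i, measurable_fun setT (b i)) (mV : measurable_fun setT V).
Context (sol : weak_solution Omega a b V u).
Context (u0 : {ae lebesgue_rV, forall x, Omega x -> 0 <= u x}).
Context (K : R) (gb : forall i, cube_growth K (fun x => b i x ^+ 2)).
Context (gV : cube_growth K V).

Let mO : measurable Omega. Proof. exact: open_measurable_rV. Qed.
Let p i := weak_partial Omega i u.
Local Notation I f := (lebesgue_rV.-integrable Omega (fun x => (f x)%:E)).

Let mp i : measurable_fun Omega (p i).
Proof.
have [[Hu _] _] := sol.
by have /(Lp2_integrable _ mO)[] := H1_weak_partial_Lp2 i oO Hu.
Qed.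

Let ip i : I (fun x => p i x ^+ 2).
Proof.
have [[Hu _] _] := sol.
by have /(Lp2_integrable _ mO)[] := H1_weak_partial_Lp2 i oO Hu.
Qed.

Let muO : measurable_fun Omega u.
Proof.
by have [[[/(Lp2_integrable _ mO)[mu _] _] _] _] := sol.
Qed.

Let ma i j : measurable_fun Omega (fun x => a x i j).
Proof. by have [La _ _] := ell; have [] := La i j. Qed.

Let mbO i : measurable_fun Omega (b i). Proof. exact: measurable_funTS. Qed.
Let mVO : measurable_fun Omega V. Proof. exact: measurable_funTS. Qed.

Let mtest f : test_function Omega f -> measurable_fun Omega f.
Proof. by move=> tf; exact/continuous_measurable_rV/(test_function_continuous tf). Qed.

Definition test_integrand (psi : 'rV[R]_n -> R) (x : 'rV[R]_n) : R :=
  form (a x) (p^~ x) (fun j => partial j psi x) + \sum_i b i x * p i x * psi x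
  + V x * u x * psi x.

Lemma measurable_test_integrand psi : test_function Omega psi ->
  measurable_fun Omega (test_integrand psi).
Proof.
move=> tpsi; apply: measurable_funD; last first.
  by apply: measurable_funM (mtest tpsi); exact: measurable_funM.
apply: measurable_funD; last exact: (measurable_drift mp mbO (mtest tpsi)).
apply: (measurable_quadratic ma mp) => j.
exact: (mtest (test_function_partial j tpsi)).
Qed.

(** By uniqueness, the weak derivatives of a test function are its classical
    partials. *)
Lemma weak_solution_test psi : test_function Omega psi ->
  I (test_integrand psi) /\
  (\int[lebesgue_rV]_(x in Omega) (test_integrand psi x)%:E = 0)%E.
Proof.
move=> tpsi; have [_ /(_ psi (H10_test oO tpsi))[it z]] := sol.
have mW := measurable_test_integrand tpsi.
have E : {ae lebesgue_rV, forall x, Omega x ->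
    weak_integrand Omega a b V u psi x = test_integrand psi x}.
  have ae_partial j := weak_partial_unique oO
    (weak_partialP (is_weak_partial_test j oO tpsi)) (is_weak_partial_test j oO tpsi).
  have ae_all : {ae lebesgue_rV, forall x, forall j, Omega x ->
      weak_partial Omega j psi x = partial j psi x}.
    exact: (@filter_forall _ _ (fun j x => Omega x ->
      weak_partial Omega j psi x = partial j psi x) (almost_everywhere lebesgue_rV)).
  apply: filterS ae_all => x H Ox; rewrite /weak_integrand /test_integrand /form.
  congr (_ + _ + _); apply: eq_bigr => i _; apply: eq_bigr => j _.
  by rewrite (H j Ox).
have mw := integrable_measurable it.
have eqint : (\int[lebesgue_rV]_(x in Omega) (weak_integrand Omega a b V u psi x)%:E =
    \int[lebesgue_rV]_(x in Omega) (test_integrand psi x)%:E)%E.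
  apply: (@ae_eq_integral _ _ _ lebesgue_rV Omega
    (fun x => (test_integrand psi x)%:E)
    (fun x => (weak_integrand Omega a b V u psi x)%:E) mO).
  - exact/measurable_EFinP.
  - exact/measurable_EFinP.
  - by apply: filterS E => x H /H ->.
split.
  apply: (ae_dominated_integrable mO mW (integrable_abse it)).
  by apply: filterS E => x H /H <-.
rewrite -eqint -[LHS](fineK (integrable_fin_num mO it)).
by rewrite [fine _]z.
Qed.

Lemma test_function_sqr_integrable f : test_function Omega f -> I (fun x => f x ^+ 2).
Proof. by move=> tf; have /(Lp2_integrable _ mO)[] := test_function_Lp2 mO tf. Qed.

Lemma smooth_gtest (delta : R) (f : 'rV[R]_n -> R) : 0 < delta -> smooth f ->
  smooth (fun x => gtest delta (f x)).
Proof.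
move=> d0 sf; apply: Ck_smooth => k; have Cf := smooth_Ck k sf.
rewrite /gtest; apply: CkM; first exact: (CkD Cf (Ck_cst _ _ _)).
apply: CkV => [x|]; first by rewrite gt_eqF ?quad_gt0.
rewrite /quad; apply: CkD; last exact: Ck_cst.
by apply: CkD; apply: CkM => //; exact: Ck_cst.
Qed.

Lemma partial_log_test (delta : R) (chi f : 'rV[R]_n -> R) j x : 0 < delta ->
  Ck 1 chi -> Ck 1 f ->
  partial j (fun x => gtest delta (f x) * (chi x * chi x)) x =
  2 * chi x * partial j chi x * gtest delta (f x) +
  chi x ^+ 2 * (dgtest delta (f x) * partial j f x).
Proof.
move=> d0 Cc Cf; apply: is_derive_partial.
have Dg := is_derive_comp1 (Ck_derivable j x Cf) (is_derive_gtest d0 (f x)).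
have Dc := Ck_derivable j x Cc.
apply: (is_derive_eq (is_deriveM Dg (is_deriveM Dc Dc))).
have -> : (chi * chi) x = chi x * chi x by [].
by rewrite /GRing.scale/=; ring.
Qed.

(** The gradient of the cutoff contributes [r ^- 2] times the measure of the cube,
    the coefficients contribute a multiple of [r ^+ n / r ^+ 2] by their growth,
    and neither depends on the regularization [delta]. *)
Lemma energy_cube : exists2 C : R, 0 <= C & forall (q : 'rV[R]_n) (r delta : R),
  0 < delta -> 0 < r -> 2 * r <= 1 -> cube q (2 * r) `<=` Omega ->
  (\int[lebesgue_rV]_(x in cube q r)
     (sqnorm (fun i => gtest delta (u x) * p i x))%:E <= (C * (r ^+ n / r ^+ 2))%:E)%E.
Proof.
have [_ _ [l l0 ellae]] := ell; have [_ aT _] := ell.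
have ell2 : {ae lebesgue_rV, forall x, Omega x -> (a x)^T = a x /\
    forall xi : 'rV[R]_n, l * enorm xi ^+ 2
      <= \sum_i \sum_j a x i j * xi ord0 i * xi ord0 j
      <= l^-1 * enorm xi ^+ 2}.
  by apply: filterS ellae => x H Ox; split; [exact: aT|exact: H].
have [Hu _] := sol.
have [phi [M [tphi iM phiM dphiM]]] := H10_sequence oO Hu.
have [C0 C00 HC0] := unit_cutoff_partial_bounded R n.
exists (16 / l * (8 / l * (n%:R * C0 ^+ 2) * 4 ^+ n +
   (4 / l * n%:R + 2) * (`|K| * 2 ^+ n))).
  by rewrite !(mulr_ge0, addr_ge0) ?sqr_ge0 ?exprn_ge0 ?invr_ge0 ?(ltW l0) ?(ltW C00).
move=> q r delta d0 r0 r1 qO.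
pose chi := cutoff q r; pose dchi j := partial j chi.
have tchi : test_function Omega chi by exact: test_function_cutoff.
have tchi2 : test_function Omega (fun x => chi x * chi x).
  exact: (test_functionM (test_function_smooth tchi) tchi).
have mchi := mtest tchi.
have mdchi j : measurable_fun Omega (dchi j) := mtest (test_function_partial j tchi).
have mE := measurable_cube q (2 * r); have mQ := measurable_cube q r.
have r20 : 0 < 2 * r by rewrite mulr_gt0.
have chile x : `|chi x| <= 1.
  by have /andP[c0 c1] := cutoff_itv q r x; rewrite ger0_norm.
have dchile x i : `|dchi i x| <= C0 / r.
  rewrite /dchi partial_cutoff normrM mulrC (@gtr0_norm _ r^-1) ?invr_gt0//.
  by rewrite ler_pM2r ?invr_gt0.
have chi0 x : ~ cube q (2 * r) x -> chi x = 0 /\ forall i, dchi i x = 0.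
  move=> nx; split=> [|i]; first exact: cutoff0.
  apply: (@partial_eq0 _ _ _ (cube q (2 * r))) => //; last by move=> y; exact: cutoff0.
  by apply: compact_closed (@compact_cube _ _ _ _); exact: norm_hausdorff.
have gE f : cube_growth K f -> (\int[lebesgue_rV]_(x in cube q (2 * r)) `|f x|%:E
    <= (`|K| * ((2 * r) ^+ n / (2 * r) ^+ 2))%:E)%E.
  move=> gf; apply: (le_trans (gf q (2 * r) r20 r1)); rewrite lee_fin ler_wpM2r ?ler_norm//.
  by rewrite divr_ge0// exprn_ge0// ltW.
have iE f : measurable_fun setT f -> cube_growth K f -> I (fun x => chi x ^+ 2 * `|f x|).
  move=> mf gf.
  apply: (@integrable_off _ _ Omega (cube q (2 * r))) => //.
    by move=> x _ /chi0[-> _]; rewrite expr0n/= mul0r.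
  have mfE : measurable_fun (cube q (2 * r)) f by exact: measurable_funTS.
  have fi : lebesgue_rV.-integrable (cube q (2 * r)) (fun x => (f x)%:E).
    apply/integrableP; split; first exact/measurable_EFinP.
    by apply: le_lt_trans (gE f gf) _; rewrite ltry.
  apply: (ae_dominated_integrable mE _ (integrable_abse fi)).
    apply: measurable_funM; last exact: measurableT_comp.
    by apply: measurable_funX; apply: measurable_funS mchi.
  apply: aeW => x _ /=; rewrite normrM normr_id ler_piMl//.
  by rewrite normrX exprn_ile1.
have ib i : I (fun x => chi x ^+ 2 * b i x ^+ 2).
  have := iE _ (measurable_funX 2 (mb i)) (gb i).
  by under eq_fun do rewrite ger0_norm ?sqr_ge0//.
have B0 : 0 <= C0 / r by rewrite divr_ge0// ltW.
have Bchi x : Omega x -> `|chi x| <= 1 + C0 / r /\ forall j, `|dchi j x| <= 1 + C0 / r.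
  move=> _; split=> [|j]; first by rewrite (le_trans (chile x))// lerDl.
  by rewrite (le_trans (dchile x j))// lerDr.
have [it _] := weak_solution_test tchi2.
(* The product [V u] is not integrable a priori; the equation tested with
   [chi ^+ 2] makes it so. *)
have iVu : I (fun x => V x * u x * chi x ^+ 2).
  have iq : I (fun x => form (a x) (p^~ x) (fun j => partial j (fun x => chi x * chi x) x)).
    apply: (integrable_quadratic mO l0 ma mp ell2 ip) => j.
      exact: (mtest (test_function_partial j tchi2)).
    exact: (test_function_sqr_integrable (test_function_partial j tchi2)).
  have id : I (fun x => \sum_i b i x * p i x * (chi x * chi x)).
    apply: (integrable_drift mO mp mbO ip ib Bchi ler01 (mtest tchi2)) => x _.
    by rewrite mul1r -expr2 ger0_norm// sqr_ge0.
  have := integrable_funB mO (integrable_funB mO it iq) id.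
  apply: eq_integrable => // x _; rewrite /test_integrand /= -expr2; congr EFin; ring.
have tlog k : test_function Omega (fun x => gtest delta (phi k x) * (chi x * chi x)).
  exact: (test_functionM (smooth_gtest d0 (test_function_smooth (tphi k))) tchi2).
have dphik j : {ae lebesgue_rV, forall x, Omega x ->
  (fun k => partial j (phi k) x) @ \oo --> p j x /\
  forall k, partial j (phi k) x ^+ 2 <= M x} by exact: dphiM.
have phiu : {ae lebesgue_rV, forall x, Omega x -> phi ^~ x @ \oo --> u x}.
  by apply: filterS phiM => x H /H[].
have := @energy_limit _ _ R lebesgue_rV Omega mO Ofin n a p b dchi V u chi l delta
  (1 + C0 / r) l0 d0 ma mp mbO mdchi mVO muO mchi ell2 ip ib Bchi
  (iE _ mV gV) iVu u0 phi (fun k j => partial j (phi k)) M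
  (fun k => mtest (tphi k)) (fun k j => mtest (test_function_partial j (tphi k)))
  iM phiu dphik.
have phi_zero k : (\int[lebesgue_rV]_(x in Omega)
   (form (a x) (p^~ x) (fun j => 2 * chi x * dchi j x * gtest delta (phi k x) +
      chi x ^+ 2 * (dgtest delta (phi k x) * partial j (phi k) x))
    + \sum_i b i x * p i x * (chi x ^+ 2 * gtest delta (phi k x))
    + V x * u x * (chi x ^+ 2 * gtest delta (phi k x)))%:E = 0)%E.
  have [_ <-] := weak_solution_test (tlog k).
  apply: eq_integral => x _; congr EFin; rewrite /test_integrand.
  rewrite -expr2 [gtest _ _ * _ in RHS]mulrC; congr (_ + _ + _).
  apply: eq_bigr => i _; apply: eq_bigr => j _; congr (_ * _).
  rewrite (partial_log_test j x d0)//; first exact: (test_function_Ck 1 tchi).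
  exact: (test_function_Ck 1 (tphi k)).
move=> /(_ phi_zero) En.
have := @energy_compare _ _ R lebesgue_rV n Omega (cube q r) (cube q (2 * r)) b dchi V chi
  (fun x => sqnorm (fun i => gtest delta (u x) * p i x)) l (C0 / r) ((2 * (2 * r)) ^+ n)
  (`|K| * ((2 * r) ^+ n / (2 * r) ^+ 2)) l0 mO mQ mE.
have rr : r <= 2 * r by rewrite ler_peMl ?ler1n// ltW.
have ms : measurable_fun Omega (fun x => sqnorm (fun i => gtest delta (u x) * p i x)).
  apply: measurable_sum => i; apply: measurable_funX; apply: measurable_funM (mp i).
  exact: (measurableT_comp (continuous_measurable_fun (continuous_gtest d0)) muO).
have chi1 x : cube q r x -> chi x = 1 by exact: cutoff1.
have vol : lebesgue_rV (cube q (2 * r)) = ((2 * (2 * r)) ^+ n)%:E.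
  by apply: lebesgue_cube; exact: ltW.
move=> /(_ (subset_cube rr) qO ms (fun x => sqnorm_ge0 _) mchi mdchi mbO mVO chi1 chile
  chi0 dchile vol (fun i => gE _ (gb i)) (gE _ gV) En) /le_trans; apply.
rewrite lee_fin -[leRHS]mulrA ler_wpM2l ?divr_ge0 ?(ltW l0)//.
rewrite [leRHS]mulrDl.
have rn : 0 <= r ^+ n / r ^+ 2 by rewrite divr_ge0 ?exprn_ge0// ltW.
apply: lerD.
  rewrite le_eqVlt; apply/orP; left; apply/eqP.
  rewrite [2 * (2 * r)]mulrA -[2 * 2]natrM [(_ * r) ^+ n]exprMn expr_div_n.
  by move: (r ^+ n) (4%:R ^+ n) => A B; field; rewrite !gt_eqF.
rewrite -[leRHS]mulrA ler_wpM2l ?addr_ge0 ?mulr_ge0 ?invr_ge0 ?(ltW l0)//.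
rewrite -mulrA ler_wpM2l// !exprMn invfM mulrACA -mulrA ler_wpM2l ?exprn_ge0//.
by rewrite ler_piMl// invf_le1// ?exprn_ege1// ?ler1n// exprn_gt0.
Qed.

End energy_cube.

(** * The Poincare inequality on cubes *)

Section poincare.
Context (R : realType).
Local Notation mu := (@lebesgue_measure R).

Lemma continuous_norm_fun (T : topologicalType) (f : T -> R) :
  continuous f -> continuous (fun x => `|f x|).
Proof. by move=> cf; apply: (continuous_fun_comp cf); exact: norm_continuous. Qed.

Lemma continuous_funsum (T : topologicalType) (J : Type) (s : seq J)
    (f : J -> T -> R) :
  (forall j, continuous (f j)) -> continuous (fun x => \sum_(j <- s) f j x).
Proof.
move=> cf; elim: s => [|j s IH].
  rewrite (_ : (fun _ => _) = cst 0); first exact: cst_continuous.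
  by apply/funext => x; rewrite big_nil.
rewrite (_ : (fun _ => _) = (fun x => f j x + \sum_(k <- s) f k x)).
  exact: continuous_funD.
by apply/funext => x; rewrite big_cons.
Qed.

(** The centre of a slice of the cube with centre [q]. *)
Definition tail n (q : 'rV[R]_n.+1) : 'rV[R]_n := \row_j q ord0 (lift ord0 j).

Lemma cube_cons_center n (q : 'rV[R]_n.+1) r t (x : 'rV[R]_n) :
  cube q r (cons_rV (t, x) : 'rV[R]_n.+1) <->
  [set` `[q ord0 ord0 - r, q ord0 ord0 + r]] t /\ cube (tail q) r x.
Proof.
rewrite /= in_itv/= -ler_distl; split=> [c|[tr c] k].
  split; first by have := c ord0; rewrite !mxE unlift_none.
  by move=> j; have := c (lift ord0 j); rewrite !mxE liftK.
rewrite !mxE; case: (unliftP ord0 k) => [l ->|->] //.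
by have := c l; rewrite mxE.
Qed.

Section slice.
Context (n : nat) (q : 'rV[R]_n.+1) (r : R).
Local Notation J := [set` `[q ord0 ord0 - r, q ord0 ord0 + r]].

Lemma measure_slice : 0 <= r -> mu J = (2 * r)%:E.
Proof.
move=> r0; rewrite lebesgue_measure_itv/= lte_fin.
case: ifPn => [_|]; first by rewrite -EFinB; congr EFin; ring.
rewrite -leNgt => h; have -> : r = 0 by lra.
by rewrite mulr0.
Qed.

Let patch_cons (f : 'rV[R]_n.+1 -> R) t x :
  (((fun x => (f x)%:E) \_ (cube q r)) (cons_rV (t, x)) =
  ((fun t => ((fun x => (f (cons_rV (t, x)))%:E) \_ (cube (tail q) r)) x) \_ J) t)%E.
Proof.
rewrite !patchE; case: ifPn => [|]; rewrite ?inE ?notin_setE => h.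
  have [tJ xc] := (cube_cons_center q r t x).1 h.
  by rewrite !ifT// inE.
case: ifPn => // tJ; case: ifPn => // xc; case: h; apply/cube_cons_center.
by split; [rewrite inE in tJ|rewrite inE in xc].
Qed.

Let measurable_patch (f : 'rV[R]_n.+1 -> R) : continuous f ->
  @measurable_fun _ _ (borel_rV R n.+1) (\bar R) setT
    ((fun x => (f x)%:E) \_ (cube q r)).
Proof.
move=> cf; apply/(measurable_restrictT _ (borel_cube q r)).
by apply/measurable_EFinP/measurable_funTS; exact: continuous_borel.
Qed.

Lemma integral_cube_cons (f : 'rV[R]_n.+1 -> R) : continuous f ->
  (forall x, 0 <= f x) ->
  (\int[borel_lebesgue R n.+1]_(x in cube q r) (f x)%:E =
   \int[mu]_(t in J) \int[borel_lebesgue R n]_(x in cube (tail q) r)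
     (f (cons_rV (t, x)))%:E)%E.
Proof.
move=> cf f0; rewrite integral_mkcond ge0_integral_cons; last 2 first.
- exact: measurable_patch.
- by move=> x; rewrite patchE; case: ifP => // _; rewrite lee_fin.
rewrite [RHS]integral_mkcond; apply: eq_integral => t _.
rewrite patchE; case: ifPn => tJ.
  rewrite [RHS]integral_mkcond; apply: eq_integral => x _.
  by rewrite patch_cons patchE tJ.
by apply: integral0_eq => x _; rewrite patch_cons patchE (negbTE tJ).
Qed.

Lemma integral_cube_cons2 (f : 'rV[R]_n.+1 -> R) : continuous f ->
  (forall x, 0 <= f x) ->
  (\int[borel_lebesgue R n.+1]_(x in cube q r) (f x)%:E =
   \int[borel_lebesgue R n]_(x in cube (tail q) r) \int[mu]_(t in J)
     (f (cons_rV (t, x)))%:E)%E.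
Proof.
move=> cf f0; rewrite integral_mkcond ge0_integral_cons2; last 2 first.
- exact: measurable_patch.
- by move=> x; rewrite patchE; case: ifP => // _; rewrite lee_fin.
rewrite [RHS]integral_mkcond; apply: eq_integral => x _.
rewrite patchE; case: ifPn => xc.
  rewrite [RHS]integral_mkcond; apply: eq_integral => t _.
  by rewrite patch_cons !patchE xc.
apply: integral0_eq => t _; rewrite patch_cons !patchE (negbTE xc).
by case: ifP.
Qed.

Lemma measurable_slice_integral (f : 'rV[R]_n.+1 -> R) : continuous f ->
  (forall x, 0 <= f x) ->
  @measurable_fun _ _ (borel_rV R n) (\bar R) setT
    (fun x => (\int[mu]_(t in J) (f (cons_rV (t, x)))%:E)%E).
Proof.
move=> cf f0.
pose g (z : measurableTypeR R * borel_rV R n) :=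
  ((fun z => (f (cons_rV z))%:E) \_ (J `*` setT)) z.
have mg : measurable_fun setT g.
  have mJ : measurable (J `*` setT : set (measurableTypeR R * borel_rV R n)).
    exact: measurableX.
  apply/(measurable_restrictT _ mJ).
  apply/measurable_funTS/measurable_EFinP.
  exact: (measurableT_comp (continuous_borel cf) (@measurable_cons_rV R n)).
have g0 z : (0 <= g z)%E by rewrite /g patchE; case: ifP => // _; rewrite lee_fin.
have := @measurable_fun_fubini_tonelli_G _ _ _ _ R mu g mg g0.
congr measurable_fun; apply/funext => x; rewrite /fubini_G [RHS]integral_mkcond.
apply: eq_integral => t _; rewrite /g !patchE; congr (if _ then _ else _).
by apply/idP/idP; rewrite !inE/= => -[].
Qed.

Lemma slice_oscillation (v : 'rV[R]_n.+1 -> R) (x : 'rV[R]_n) s t : Ck 1 v ->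
  J s -> J t ->
  (`|v (cons_rV (t, x)) - v (cons_rV (s, x))|%:E <=
   \int[mu]_(t in J) `|partial ord0 v (cons_rV (t, x))|%:E)%E.
Proof.
move=> Cv; wlog st : s t / s < t => [H|Js Jt].
  have [st|ts|->] := ltgtP s t; [exact: H| |].
  - by move=> Js Jt; rewrite distrC; exact: H.
  - by move=> _ _; rewrite subrr normr0; apply: integral_ge0 => y _; rewrite lee_fin.
have cd : continuous (fun t => partial ord0 v (cons_rV (t, x))).
  by apply: continuous_slice; exact: (Ck_continuous (Ck_partial ord0 Cv)).
have md D : measurable_fun D (fun t => (partial ord0 v (cons_rV (t, x)))%:E).
  by apply/measurable_EFinP/measurable_funTS; exact: continuous_measurable_fun.
rewrite -abse_EFin -(FTC_slice x Cv st).
apply: (le_trans (le_abse_integral _ _ (md _))) => //.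
apply: ge0_subset_integral => //.
  by apply: measurableT_comp => //; exact: md.
move: Js Jt; rewrite /= !in_itv/= => /andP[s1 s2] /andP[t1 t2] y.
by rewrite /= !in_itv/= => /andP[y1 y2]; rewrite (le_trans s1)// (le_trans y2).
Qed.

End slice.

(** Induction on the dimension. The slice of index [t0] is chosen by averaging,
    so that its gradient exceeds the mean by no more than the room that the strict
    bound [S] leaves; every other slice differs from it by at most the integral of
    the first partial. *)
Lemma poincare_borel n (v : 'rV[R]_n -> R) q r (S : R) : 0 < r -> Ck 1 v ->
  (\int[borel_lebesgue R n]_(x in cube q r) (\sum_i `|partial i v x|)%:E < S%:E)%E ->
  exists c : R, (\int[borel_lebesgue R n]_(x in cube q r) `|v x - c|%:E <=
    (2 * r * S)%:E)%E.
Proof.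
move=> r0; elim: n v q S => [|n IH] v q S Cv.
  move=> S0; exists (v 0); rewrite integral0_eq => [|x _]; last first.
    by rewrite (_ : x = 0) ?subrr ?normr0//; apply/rowP => -[].
  rewrite lee_fin mulr_ge0 ?mulr_ge0 ?(ltW r0)// -lee_fin ltW// (le_lt_trans _ S0)//.
  by apply: integral_ge0 => x _; rewrite lee_fin sumr_ge0.
have r20 : 0 < 2 * r by rewrite mulr_gt0.
have cp i : continuous (fun x => `|partial i v x|).
  by apply: continuous_norm_fun; exact: (Ck_continuous (Ck_partial i Cv)).
set J := [set` `[q ord0 ord0 - r, q ord0 ord0 + r]].
have muJ : mu J = (2 * r)%:E by exact/measure_slice/ltW.
have intJ (c : R) : (\int[mu]_(_ in J) c%:E = (2 * r * c)%:E)%E.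
  have mJ : measurable J by exact: measurable_itv.
  by rewrite [2 * r * c]mulrC EFinM -muJ; exact: integral_cst.
pose F0 (x : 'rV[R]_n.+1) : R := `|partial ord0 v x|.
pose F1 (x : 'rV[R]_n.+1) : R := \sum_(j < n) `|partial (lift ord0 j) v x|.
have cF1 : continuous F1 by apply: continuous_funsum => j; exact: cp.
have F00 x : 0 <= F0 x by exact: normr_ge0.
have F10 x : 0 <= F1 x by apply: sumr_ge0.
have mcont m (f : 'rV[R]_m -> R) D : continuous f ->
    @measurable_fun _ _ (borel_rV R m) (\bar R) D (fun x => (f x)%:E).
  by move=> cf; apply/measurable_EFinP/measurable_funTS; exact: continuous_borel.
rewrite (eq_integral (fun x : borel_rV R n.+1 => (F0 x)%:E + (F1 x)%:E)%E); last first.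
  by move=> x _; rewrite big_ord_recl.
rewrite ge0_integralD//; last 5 first.
- exact: borel_cube.
- by move=> x _; rewrite lee_fin.
- by apply: mcont; exact: cp.
- by move=> x _; rewrite lee_fin.
- exact: mcont.
pose S0 := (\int[borel_lebesgue R n.+1]_(x in cube q r) (F0 x)%:E)%E.
pose S1 := (\int[borel_lebesgue R n.+1]_(x in cube q r) (F1 x)%:E)%E.
rewrite -[X in (X < _)%E]/(S0 + S1)%E => S01.
have S0ge : (0 <= S0)%E by apply: integral_ge0 => x _; rewrite lee_fin.
have S1ge : (0 <= S1)%E by apply: integral_ge0 => x _; rewrite lee_fin.
have S0fin : S0 \is a fin_num.
  by rewrite ge0_fin_numE// (le_lt_trans _ (lt_trans S01 (ltry _)))// leeDl.
pose s0 := fine S0; have S0E : S0 = s0%:E by rewrite fineK.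
have S1lt : (S1 < (S - s0)%:E)%E by rewrite EFinB lteBrDl// -S0E.
have Ss0 : 0 < S - s0 by rewrite -lte_fin (le_lt_trans S1ge).
pose S' := (S - s0) / (2 * r).
pose h t := (\int[borel_lebesgue R n]_(x in cube (tail q) r) (F1 (cons_rV (t, x)))%:E)%E.
have [t0 [Jt0 ht0]] : exists t0, J t0 /\ (h t0 < S'%:E)%E.
  apply: contrapT => /forallNP none.
  suff : ((S - s0)%:E <= S1)%E by rewrite leNgt S1lt.
  rewrite /S1 (integral_cube_cons _ _ cF1 F10).
  have -> : ((S - s0)%:E = \int[mu]_(t in J) S'%:E)%E.
    by rewrite intJ /S' mulrC divfK// gt_eqF.
  rewrite integral_mkcond [leRHS]integral_mkcond; apply: ge0_integral_mono => t.
    by rewrite patchE; case: ifP => // _; rewrite lee_fin divr_ge0// ltW.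
  rewrite !patchE; case: ifPn => // tJ; rewrite leNgt; apply/negP => lt.
  by apply: (none t); split => //; rewrite inE in tJ.
have Cw := Ck_cons_tail t0 Cv.
have [|c Hc] := IH (fun x => v (cons_rV (t0, x))) (tail q) S' Cw.
  apply: le_lt_trans ht0; rewrite le_eqVlt; apply/orP; left; apply/eqP.
  apply: eq_integral => x _; congr EFin; apply: eq_bigr => j _.
  by rewrite (partial_cons_tail t0 j x Cv).
exists c.
have cvc : continuous (fun x => `|v x - c|).
  apply: continuous_norm_fun; apply: continuous_funD (Ck_continuous Cv) _.
  exact: cst_continuous.
rewrite (integral_cube_cons _ _ cvc)//.
rewrite -intJ.
have S_ge0 : 0 <= S.
  by rewrite -lee_fin ltW// (le_lt_trans _ S01)// adde_ge0.
rewrite integral_mkcond [leRHS]integral_mkcond; apply: ge0_integral_mono => t.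
  by rewrite patchE; case: ifP => // _; apply: integral_ge0 => x _; rewrite lee_fin.
rewrite !patchE; case: ifPn => // /set_mem Jt.
pose G x := (\int[mu]_(t in J) (F0 (cons_rV (t, x)))%:E)%E.
have mG : @measurable_fun _ _ (borel_rV R n) (\bar R) setT G.
  by apply: measurable_slice_integral => //; exact: cp.
have G0 x : (0 <= G x)%E by apply: integral_ge0 => y _; rewrite lee_fin.
have mc : measurable (cube (tail q) r : set (borel_rV R n)) by exact: borel_cube.
have cw : continuous (fun x => `|v (cons_rV (t0, x)) - c|).
  apply: continuous_norm_fun; apply: continuous_funD (Ck_continuous Cw) _.
  exact: cst_continuous.
have ct : continuous (fun x => `|v (cons_rV (t, x)) - c|).
  apply: continuous_norm_fun.
  apply: continuous_funD (Ck_continuous (Ck_cons_tail t Cv)) _.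
  exact: cst_continuous.
apply: (@le_trans _ _ (\int[borel_lebesgue R n]_(x in cube (tail q) r)
    (`|v (cons_rV (t0, x)) - c|%:E + G x))%E).
  apply: ge0_le_integral => //.
  - exact: mcont ct.
  - apply: emeasurable_funD; [exact: mcont cw|exact: measurable_funTS].
  - move=> x _; apply: (@le_trans _ _ (`|v (cons_rV (t0, x)) - c|%:E +
      `|v (cons_rV (t, x)) - v (cons_rV (t0, x))|%:E)%E).
      by rewrite -EFinD lee_fin [leRHS]addrC; exact: ler_distD.
    by rewrite leeD2l//; exact: slice_oscillation.
rewrite ge0_integralD//; last 2 first.
- exact: mcont cw.
- exact: measurable_funTS.
rewrite -(integral_cube_cons2 _ _ (cp ord0) F00) -/S0 S0E.
apply: (@le_trans _ _ ((2 * r * S')%:E + s0%:E)%E); first by rewrite leeD2r.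
by rewrite -EFinD lee_fin /S' mulrC divfK ?gt_eqF// subrK.
Qed.

End poincare.

Section mean.
Context d (T : measurableType d) (R : realType) (mu : {measure set T -> \bar R}).
Context (Q : set T) (mQ : measurable Q) (m : R) (m0 : 0 < m) (muQ : mu Q = m%:E).
Implicit Types f g : T -> R.
Local Notation I f := (mu.-integrable Q (fun x => (f x)%:E)).

Definition mean f : R := m^-1 * \int[mu]_(x in Q) f x.

Let Qfin : (mu Q < +oo)%E. Proof. by rewrite muQ ltry. Qed.

Lemma integral_mean f : I f -> (\int[mu]_(x in Q) (f x)%:E = (m * mean f)%:E)%E.
Proof.
move=> fi; rewrite /mean mulrA divff ?gt_eqF// mul1r.
by rewrite fineK//; exact: integrable_fin_num.
Qed.

Lemma mean_dist f c : I f ->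
  ((m * `|mean f - c|)%:E <= \int[mu]_(x in Q) `|f x - c|%:E)%E.
Proof.
move=> fi; have ic := integrable_cst mQ c Qfin.
have ifc := integrable_funB mQ fi ic.
have -> : (m * `|mean f - c|)%:E = (`| \int[mu]_(x in Q) (f x - c)%:E |)%E.
  have -> : (\int[mu]_(x in Q) (f x - c)%:E = (m * (mean f - c))%:E)%E.
    rewrite (integralB mQ fi ic) (integral_mean fi).
    by rewrite (integral_cst mu mQ c%:E) muQ -EFinM -EFinB mulrBr [c * m]mulrC.
  by rewrite abse_EFin normrM (gtr0_norm m0).
by apply: le_abse_integral => //; case/integrableP: ifc.
Qed.

(** The mean differs from [c] by at most the average of [|f - c|]. *)
Lemma mean_oscillation f c (B : R) : I f ->
  (\int[mu]_(x in Q) `|f x - c|%:E <= B%:E)%E ->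
  (\int[mu]_(x in Q) `|f x - mean f|%:E <= (2 * B)%:E)%E.
Proof.
move=> fi fB; have mf := integrable_measurable fi.
have mfc (a : R) : measurable_fun Q (fun x => `|f x - a|%:E).
  by apply/measurable_EFinP; apply: measurableT_comp => //; exact: measurable_funB.
apply: (@le_trans _ _ (\int[mu]_(x in Q) (`|f x - c|%:E + `|mean f - c|%:E))%E).
  apply: ge0_le_integral => //; first exact: emeasurable_funD.
  by move=> x _; rewrite -EFinD lee_fin [`|mean f - c|]distrC ler_distD.
rewrite ge0_integralD// integral_cst// muQ mulrDl mul1r EFinD.
apply: leeD => //; apply: le_trans fB; rewrite -EFinM mulrC; exact: mean_dist.
Qed.

(** For one large [k], the constant [c] of [v_ k] is also good for [v], and the
    mean of [v] is as good up to a factor two. *)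
Lemma poincare_limit (v_ g_ : nat -> T -> R) (v g h : T -> R) (r : R) :
  0 < r ->
  (forall k, measurable_fun Q (v_ k)) -> (forall k, measurable_fun Q (g_ k)) ->
  measurable_fun Q v -> measurable_fun Q g -> I h ->
  {ae mu, forall x, Q x -> v_ ^~ x @ \oo --> v x /\ forall k, `|v_ k x| <= h x} ->
  {ae mu, forall x, Q x -> g_ ^~ x @ \oo --> g x /\ forall k, `|g_ k x| <= h x} ->
  (forall k (S : R), (\int[mu]_(x in Q) (g_ k x)%:E < S%:E)%E ->
    exists c, (\int[mu]_(x in Q) `|v_ k x - c|%:E <= (2 * r * S)%:E)%E) ->
  (\int[mu]_(x in Q) `|v x - mean v|%:E <=
    (4 * r)%:E * \int[mu]_(x in Q) (g x)%:E)%E.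
Proof.
move=> r0 mv_ mg_ mv mg hi vh gh P.
have [ig cg] := cvg_dominated mQ mg_ mg hi gh.
have [iv _] := cvg_dominated mQ mv_ mv hi vh.
have h2i := integrable_funZ mQ 2 hi.
have mdiff k : measurable_fun Q (fun x => `|v_ k x - v x|).
  by apply: measurableT_comp => //; exact: measurable_funB.
have dh : {ae mu, forall x, Q x -> (fun k => `|v_ k x - v x|) @ \oo --> (0 : R) /\
    forall k, `| `|v_ k x - v x| | <= 2 * h x}.
  apply: filterS vh => x H /H[cv vle]; split.
    rewrite -(normr0 R) -(subrr (v x)); apply: cvg_norm; apply: cvgB => //.
    exact: cvg_cst.
  move=> k; rewrite normr_id mulr_natl mulr2n (le_trans (ler_normB _ _))//.
  apply: lerD => //; have cn : (fun k => `|v_ k x|) @ \oo --> `|v x| by exact: cvg_norm.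
  rewrite -(cvg_lim (@Rhausdorff R) cn).
  by apply: limr_le; [apply/cvg_ex; exists (`|v x|)|exact: nearW].
have [_ cd] := cvg_dominated mQ mdiff (measurable_cst (0 : R)) h2i dh.
rewrite integral0_eq// in cd.
have near_lt (a : nat -> \bar R) (l b : \bar R) : a @ \oo --> l -> (l < b)%E ->
    \forall k \near \oo, (a k < b)%E.
  move=> al lb; have U : nbhs l [set y | (y < b)%E].
    by apply: open_nbhs_nbhs; split; [exact: open_ereal_lt_ereal|].
  exact: (al _ U).
set s := (\int[mu]_(x in Q) (g x)%:E)%E in cg *.
have sfin : s \is a fin_num by exact: integrable_fin_num.
rewrite -(fineK sfin) in cg *.
apply/lee_addgt0Pr => e e0.
pose e1 : R := e / (2 + 4 * r).
have e10 : 0 < e1 by rewrite divr_gt0// addr_gt0// mulr_gt0.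
have ev1 : \forall k \near \oo, (\int[mu]_(x in Q) (g_ k x)%:E < (fine s + e1)%:E)%E.
  by apply: near_lt cg _; rewrite lte_fin ltrDl.
have ev2 : \forall k \near \oo, (\int[mu]_(x in Q) `|v_ k x - v x|%:E < e1%:E)%E.
  by apply: near_lt cd _; rewrite lte_fin.
have [k [/P[c Hc] H2]] := @filter_ex _ _ _ _ (filterI ev1 ev2).
have mnorm (f : T -> R) : measurable_fun Q f -> measurable_fun Q (fun x => `|f x|%:E).
  by move=> mf; apply/measurable_EFinP; exact: measurableT_comp.
have mvkc : measurable_fun Q (fun x => v_ k x - c) by exact: measurable_funB.
have mvkv : measurable_fun Q (fun x => v_ k x - v x) by exact: measurable_funB.
have mvc : measurable_fun Q (fun x => v x - c) by exact: measurable_funB.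
have vc : (\int[mu]_(x in Q) `|v x - c|%:E <= (e1 + 2 * r * (fine s + e1))%:E)%E.
  apply: (@le_trans _ _ (\int[mu]_(x in Q) (`|v_ k x - v x|%:E + `|v_ k x - c|%:E))%E).
    apply: ge0_le_integral => //; [exact: mnorm|apply: emeasurable_funD; exact: mnorm|].
    by move=> x _; rewrite -EFinD lee_fin [`|v_ k x - v x|]distrC ler_distD.
  rewrite ge0_integralD//; [|exact: mnorm|exact: mnorm].
  by rewrite EFinD; apply: leeD Hc; exact: ltW.
apply: (le_trans (mean_oscillation iv vc)).
rewrite -EFinM -EFinD lee_fin le_eqVlt; apply/orP; left; apply/eqP.
rewrite /e1; field; rewrite gt_eqF// addr_gt0// mulr_gt0//.
Qed.

End mean.

(** * Oscillation of the logarithm *)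

Lemma integral_le_affine d (T : measurableType d) (R : realType)
    (mu : {measure set T -> \bar R}) (Q : set T) (g s : T -> R) (m k A B S : R) :
  measurable Q -> mu Q = m%:E -> 0 <= k -> 0 <= A -> 0 <= B ->
  measurable_fun Q g -> measurable_fun Q s ->
  (forall x, 0 <= g x) -> (forall x, 0 <= s x) ->
  {ae mu, forall x, Q x -> k * g x <= A + B * s x} ->
  (\int[mu]_(x in Q) (s x)%:E <= S%:E)%E ->
  (k%:E * \int[mu]_(x in Q) (g x)%:E <= (A * m + B * S)%:E)%E.
Proof.
move=> mQ muQ k0 A0 B0 mg ms g0 s0 H sS.
have mgE : measurable_fun Q (fun x => (g x)%:E) by exact/measurable_EFinP.
have msE : measurable_fun Q (fun x => (s x)%:E) by exact/measurable_EFinP.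
rewrite -ge0_integralZl//; last by move=> x _; rewrite lee_fin.
apply: (@le_trans _ _ (\int[mu]_(x in Q) (A%:E + B%:E * (s x)%:E))%E).
  apply: ae_ge0_le_integral => //.
  - by move=> x _; rewrite -EFinM lee_fin mulr_ge0.
  - exact: emeasurable_funM.
  - by move=> x _; rewrite -EFinM -EFinD lee_fin addr_ge0// mulr_ge0.
  - by apply: emeasurable_funD => //; exact: emeasurable_funM.
rewrite ge0_integralD//; last 2 first.
- by move=> x _; rewrite -EFinM lee_fin mulr_ge0.
- exact: emeasurable_funM.
rewrite (integral_cst mu mQ A%:E) muQ EFinD ge0_integralZl//; last first.
  by move=> x _; rewrite lee_fin.
by apply: leeD => //; rewrite [leRHS]EFinM; apply: lee_wpmul2l.
Qed.

Section log_oscillation.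
Context (R : realType) (n : nat) (Omega : set 'rV[R]_n) (u : 'rV[R]_n -> R).
Context (oO : open Omega).
Context (Hu : H10 Omega u).
Context (u0 : {ae lebesgue_rV, forall x, Omega x -> 0 <= u x}).

Let mO : measurable Omega. Proof. exact: open_measurable_rV. Qed.
Let p i := weak_partial Omega i u.

Let mp i : measurable_fun Omega (p i).
Proof.
have [Hu1 _] := Hu.
by have /(Lp2_integrable _ mO)[] := H1_weak_partial_Lp2 i oO Hu1.
Qed.

Let muO : measurable_fun Omega u.
Proof. by have [[/(Lp2_integrable _ mO)[mu _] _] _] := Hu. Qed.

Lemma poincare_rV (v : 'rV[R]_n -> R) q r (S : R) : 0 < r -> Ck 1 v ->
  (\int[lebesgue_rV]_(x in cube q r) (\sum_i `|partial i v x|)%:E < S%:E)%E ->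
  exists c : R, (\int[lebesgue_rV]_(x in cube q r) `|v x - c|%:E <=
    (2 * r * S)%:E)%E.
Proof.
move=> r0 Cv.
have borel_cont (f : 'rV[R]_n -> R) : continuous f ->
    @measurable_fun _ _ (borel_rV R n) (\bar R) (cube q r) (fun x => (f x)%:E).
  by move=> cf; apply/measurable_EFinP/measurable_funTS; exact: continuous_borel.
rewrite ge0_integral_borel; last 3 first.
- exact: borel_cube.
- apply: borel_cont; apply: continuous_funsum => i; apply: continuous_norm_fun.
  exact: (Ck_continuous (Ck_partial i Cv)).
- by move=> x _; rewrite lee_fin sumr_ge0.
move=> /(poincare_borel r0 Cv)[c Hc]; exists c; rewrite ge0_integral_borel//.
- exact: borel_cube.
- apply: borel_cont; apply: continuous_norm_fun.
  by apply: continuous_funD (Ck_continuous Cv) _; exact: cst_continuous.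
Qed.

Lemma Ck_vlog (delta : R) (f : 'rV[R]_n -> R) : 0 < delta -> Ck 1 f ->
  Ck 1 (fun x => vlog delta (f x)) /\
  forall i x, partial i (fun x => vlog delta (f x)) x = dvlog delta (f x) * partial i f x.
Proof.
move=> d0 Cf.
have D i x := is_derive_comp1 (Ck_derivable i x Cf) (is_derive_vlog d0 (f x)).
split=> [|i x]; last exact: is_derive_partial (D i x).
apply: (Ck_intro _ D).
  exact: (continuous_fun_comp (Ck_continuous Cf) (continuous_vlog d0)).
move=> i; apply: CkM; last exact: (Ck_partial i Cf).
exact: (continuous_fun_comp (Ck_continuous Cf) (continuous_dvlog d0)).
Qed.

Section cube.
Context (q : 'rV[R]_n) (r delta : R) (d0 : 0 < delta) (r0 : 0 < r).
Context (qO : cube q r `<=` Omega).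
Local Notation Q := (cube q r).
Local Notation vol := ((2 * r) ^+ n).
Local Notation I f := (lebesgue_rV.-integrable Q (fun x => (f x)%:E)).
Let v x := vlog delta (u x).

Let mQ : measurable Q. Proof. exact: measurable_cube. Qed.

Let mv : measurable_fun Q v.
Proof.
apply: (measurable_funS mO qO).
exact: (measurableT_comp (continuous_measurable_fun (continuous_vlog d0)) muO).
Qed.

Let mg (i : 'I_n) : measurable_fun Q (fun x => `|dvlog delta (u x) * p i x|).
Proof.
apply: (measurable_funS mO qO).
apply: (measurableT_comp (@normr_measurable R setT)).
apply: measurable_funM (mp i).
exact: (measurableT_comp (continuous_measurable_fun (continuous_dvlog d0)) muO).
Qed.

(** The logarithm is taken of the approximating test functions, to which calculus
    applies, and the limit is taken in the Poincare inequality. *)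
Lemma poincare_log : I v /\
  (\int[lebesgue_rV]_(x in Q) `|v x - mean lebesgue_rV Q vol v|%:E <=
   (4 * r)%:E * \int[lebesgue_rV]_(x in Q) (\sum_i `|dvlog delta (u x) * p i x|)%:E)%E.
Proof.
have [phi [M [tphi iM phiM dphiM]]] := H10_sequence oO Hu.
have iMQ : I M by exact: (integrableS mO mQ qO iM).
have Qvol : lebesgue_rV Q = vol%:E by apply: lebesgue_cube; exact: ltW.
have Qfin : (lebesgue_rV Q < +oo)%E by rewrite Qvol ltry.
have vol0 : 0 < vol by rewrite exprn_gt0// mulr_gt0.
have Cphi k := test_function_Ck 1 (tphi k).
pose v_ k x := vlog delta (phi k x).
pose g_ k x := \sum_i `|partial i (v_ k) x|.
pose g x := \sum_i `|dvlog delta (u x) * p i x|.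
pose h x := `|vlog delta 0| + n.+1%:R * (1 / delta * (1 + M x)).
have hi : I h.
  apply: (integrable_funD mQ); first exact: integrable_cst.
  apply/(integrable_funZ mQ)/(integrable_funZ mQ).
  by apply: (integrable_funD mQ) iMQ; exact: integrable_cst.
have mv_ k : measurable_fun Q (v_ k).
  apply: continuous_measurable_rV; exact: (Ck_continuous (Ck_vlog d0 (Cphi k)).1).
have mg_ k : measurable_fun Q (g_ k).
  apply: continuous_measurable_rV; apply: continuous_funsum => i.
  apply: continuous_norm_fun.
  exact: (Ck_continuous (Ck_partial i (Ck_vlog d0 (Cphi k)).1)).
have mgs : measurable_fun Q g by apply: measurable_sum => i; exact: mg.
have id0 : 0 <= 1 / delta by rewrite divr_ge0// ltW.
have sqM (a m : R) : a ^+ 2 <= m -> 1 / delta * `|a| <= 1 / delta * (1 + m).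
  move=> am; rewrite ler_wpM2l//; have := sqr_ge0 (`|a| - 1).
  by rewrite sqrrB real_normK ?num_real//; have := normr_ge0 a; lra.
have vh : {ae lebesgue_rV, forall x, Q x -> v_ ^~ x @ \oo --> v x /\
    forall k, `|v_ k x| <= h x}.
  apply: filterS phiM => x H Qx; have [cx bx] := H (qO Qx); split.
    by apply: continuous_cvg cx; exact: (continuous_vlog d0).
  move=> k; apply: (le_trans (vlog_bound d0 _)); rewrite /h lerD2l.
  apply: (le_trans (sqM _ _ (bx k))); rewrite ler_peMl ?ler1n// mulr_ge0//.
  by rewrite addr_ge0// (le_trans (sqr_ge0 _) (bx k)).
have gh : {ae lebesgue_rV, forall x, Q x -> g_ ^~ x @ \oo --> g x /\
    forall k, `|g_ k x| <= h x}.
  have ae_all : {ae lebesgue_rV, forall x, forall i, Omega x ->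
      (fun k => partial i (phi k) x) @ \oo --> weak_partial Omega i u x /\
      forall k, partial i (phi k) x ^+ 2 <= M x}.
    exact: (@filter_forall _ _ (fun i x => Omega x ->
      (fun k => partial i (phi k) x) @ \oo --> weak_partial Omega i u x /\
      forall k, partial i (phi k) x ^+ 2 <= M x) (almost_everywhere lebesgue_rV)).
  apply: filterS2 phiM ae_all => x H H' Qx; have Ox := qO Qx.
  have [cx bx] := H Ox.
  have gE k : g_ k x = \sum_i `|dvlog delta (phi k x) * partial i (phi k) x|.
    by apply: eq_bigr => i _; rewrite (Ck_vlog d0 (Cphi k)).2.
  split.
    rewrite (_ : g_ ^~ x = fun k => \sum_i `|dvlog delta (phi k x) * partial i (phi k) x|);
      last exact/funext.
    apply: cvg_big => [|i _]; first exact: add_continuous.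
    have [dx _] := H' i Ox.
    apply: cvg_norm; apply: cvgM dx.
    by apply: continuous_cvg cx; exact: (continuous_dvlog d0).
  move=> k; rewrite gE ger0_norm ?sumr_ge0//.
  have M0 : 0 <= 1 / delta * (1 + M x).
    by rewrite mulr_ge0// addr_ge0// (le_trans (sqr_ge0 _) (bx k)).
  apply: (@le_trans _ _ (\sum_(i < n) (1 / delta * (1 + M x)))).
    apply: ler_sum => i _; have [_ di] := H' i Ox; apply: le_trans (sqM _ _ (di k)).
    by rewrite normrM ler_wpM2r// dvlog_bound.
  rewrite sumr_const card_ord /h -[leLHS]mulr_natl.
  apply: (@le_trans _ _ (n.+1%:R * (1 / delta * (1 + M x)))); last by rewrite lerDr.
  by rewrite ler_wpM2r// ler_nat.
split.
  by have [] := cvg_dominated mQ mv_ mv hi vh.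
apply: (poincare_limit mQ vol0 Qvol r0 mv_ mg_ mv mgs hi vh gh) => k S.
by apply: (poincare_rV r0); exact: (Ck_vlog d0 (Cphi k)).1.
Qed.

(** [4 a <= 2 + 2 a ^ 2] with [a = r g(u) |p i|] turns the bound of [|grad log u|]
    in L2 into the scale-invariant bound of the mean oscillation. *)
Lemma log_oscillation_cube (C : R) : 0 <= C ->
  (\int[lebesgue_rV]_(x in Q) (sqnorm (fun i => gtest delta (u x) * p i x))%:E
     <= (C * (r ^+ n / r ^+ 2))%:E)%E ->
  (\int[lebesgue_rV]_(x in Q) `|v x - mean lebesgue_rV Q vol v|%:E <=
   ((2 * n%:R + 2 * C) * vol)%:E)%E.
Proof.
move=> C0 En; have [_ P] := poincare_log; apply: (le_trans P).
have Qvol : lebesgue_rV Q = vol%:E by apply: lebesgue_cube; exact: ltW.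
have mgs : measurable_fun Q (fun x => \sum_i `|dvlog delta (u x) * p i x|).
  by apply: measurable_sum => i; exact: mg.
have ms : measurable_fun Q (fun x => sqnorm (fun i => gtest delta (u x) * p i x)).
  apply: (measurable_funS mO qO).
  apply: measurable_sum => i; apply: measurable_funX; apply: measurable_funM (mp i).
  exact: (measurableT_comp (continuous_measurable_fun (continuous_gtest d0)) muO).
have r20 : 0 <= 2 * r ^+ 2 by rewrite mulr_ge0// sqr_ge0.
have r40 : 0 <= 4 * r by rewrite mulr_ge0// ltW.
have n20 : 0 <= 2 * n%:R :> R by rewrite mulr_ge0.
have gs0 x : 0 <= \sum_i `|dvlog delta (u x) * p i x| by apply: sumr_ge0.
apply: (le_trans (integral_le_affine mQ Qvol r40 n20 r20 mgs ms gs0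
  (fun x => sqnorm_ge0 _) _ En)).
  apply: filterS u0 => x H Qx; have ux := H (qO Qx).
  rewrite /sqnorm !mulr_sumr.
  rewrite [2 * n%:R]mulr_natr -[X in _ *+ X + _](card_ord n) -sumr_const -big_split/=.
  apply: ler_sum => i _.
  have := dvlog_le_gtest d0 ux; have := gtest_ge0 d0 ux.
  move: (gtest delta (u x)) => g g0 dg.
  apply: (@le_trans _ _ (4 * r * `|g * p i x|)).
    by rewrite ler_wpM2l// (normrM g) (normrM (dvlog _ _)) ler_wpM2r// (ger0_norm g0).
  have := sqr_ge0 (r * `|g * p i x| - 1); rewrite -[(g * p i x) ^+ 2]real_normK ?num_real//.
  by move: (`|g * p i x|) => A; nra.
rewrite lee_fin [leRHS]mulrDl lerD2l.
have -> : 2 * r ^+ 2 * (C * (r ^+ n / r ^+ 2)) = 2 * C * r ^+ n.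
  by move: (r ^+ n) => A; field; rewrite gt_eqF.
rewrite ler_wpM2l ?mulr_ge0// lerXn2r ?nnegrE ?mulr_ge0 ?(ltW r0)//.
by rewrite ler_peMl ?ler1n// ltW.
Qed.

End cube.
End log_oscillation.

(** * Decay of the means *)

Section means.
Context d (T : measurableType d) (R : realType) (mu : {measure set T -> \bar R}).
Implicit Types (Q E : set T) (f u v : T -> R) (m : R).

(** For a cube and the cube of half the size, the factor [m / m'] is fixed: each
    halving changes the mean by at most a multiple of the mean oscillation. *)
Lemma mean_subset Q Q' m m' v (K : R) : measurable Q -> measurable Q' -> Q' `<=` Q ->
  0 < m -> 0 < m' -> mu Q = m%:E -> mu Q' = m'%:E ->
  mu.-integrable Q (fun x => (v x)%:E) ->
  (\int[mu]_(x in Q) `|v x - mean mu Q m v|%:E <= (K * m)%:E)%E ->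
  `|mean mu Q' m' v - mean mu Q m v| <= K * (m / m').
Proof.
move=> mQ mQ' Q'Q m0 m'0 muQ muQ' iv osc.
have iv' : mu.-integrable Q' (fun x => (v x)%:E) by exact: integrableS iv.
have := mean_dist mQ' m'0 muQ' (mean mu Q m v) iv'.
have le : (\int[mu]_(x in Q') `|v x - mean mu Q m v|%:E <= (K * m)%:E)%E.
  apply: le_trans osc; apply: ge0_subset_integral => //.
  apply/measurable_EFinP; apply: measurableT_comp => //.
  by apply: measurable_funB => //; exact: integrable_measurable iv.
move=> /le_trans/(_ le); rewrite lee_fin => h.
by rewrite mulrA ler_pdivlMr// mulrC.
Qed.

(** Jensen's inequality, from the tangent line of the exponential at the mean. *)
Lemma jensen_expR Q m u v (c : R) : measurable Q -> 0 < m -> mu Q = m%:E ->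
  mu.-integrable Q (fun x => (u x)%:E) -> mu.-integrable Q (fun x => (v x)%:E) ->
  {ae mu, forall x, Q x -> expR (v x) <= u x + c} ->
  expR (mean mu Q m v) <= mean mu Q m u + c.
Proof.
move=> mQ m0 muQ iu iv H; set t := mean mu Q m v.
have Qfin : (mu Q < +oo)%E by rewrite muQ ltry.
have ic (a : R) := integrable_cst mQ a Qfin.
have : (\int[mu]_(x in Q) (expR t * (1 - t) + expR t * v x)%:E <=
        \int[mu]_(x in Q) (u x + c)%:E)%E.
  apply: (ae_le_integral mQ).
  - exact: (integrable_funD mQ (ic _) (integrable_funZ mQ (expR t) iv)).
  - exact: (integrable_funD mQ iu (ic c)).
  - apply: filterS H => x H /H; apply: le_trans.
    rewrite -[v x in leRHS](subrKC t) expRD -mulrDr ler_wpM2l ?expR_ge0//.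
    by have := expR_ge1Dx (v x - t); lra.
rewrite (integralD mQ (ic _) (integrable_funZ mQ (expR t) iv)) (integralD mQ iu (ic c)).
rewrite (integral_cst mu mQ (expR t * (1 - t))%:E) (integral_cst mu mQ c%:E) muQ.
have -> : (\int[mu]_(x in Q) (expR t * v x)%:E = (expR t * (m * t))%:E)%E.
  under eq_integral do rewrite EFinM.
  by rewrite (integralZl mQ iv) (integral_mean mQ m0 iv).
rewrite (integral_mean mQ m0 iu) -EFinM -!EFinD lee_fin => h.
rewrite -(ler_pM2l m0); move: h; lra.
Qed.

(** On [E] the gap between [a] and the mean is part of the oscillation. *)
Lemma mean_lower_bound Q E m v (a K : R) : measurable Q -> measurable E -> E `<=` Q ->
  0 < m -> mu Q = m%:E -> mu.-integrable Q (fun x => (v x)%:E) ->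
  {ae mu, forall x, E x -> a <= v x} -> (0 < mu E)%E ->
  (\int[mu]_(x in Q) `|v x - mean mu Q m v|%:E <= (K * m)%:E)%E ->
  a - K * m / fine (mu E) <= mean mu Q m v.
Proof.
move=> mQ mE EQ m0 muQ iv aE muE osc; set t := mean mu Q m v.
have Efin : (mu E < +oo)%E.
  by apply: (@le_lt_trans _ _ (mu Q)); [apply: le_measure; rewrite ?inE|rewrite muQ ltry].
have e0 : 0 < fine (mu E) by rewrite fine_gt0// muE Efin.
have EE : mu E = (fine (mu E))%:E by rewrite fineK// ge0_fin_numE.
have mv := integrable_measurable iv.
have mvt : measurable_fun Q (fun x => `|v x - t|%:E).
  by apply/measurable_EFinP; apply: measurableT_comp => //; exact: measurable_funB.
have ivE : mu.-integrable E (fun x => (v x)%:E) by exact: integrableS iv.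
have ic (b : R) := integrable_cst mE b Efin.
have : (\int[mu]_(x in E) (a - t)%:E <= (K * m)%:E)%E.
  apply: le_trans osc.
  apply: (@le_trans _ _ (\int[mu]_(x in E) `|v x - t|%:E)%E); last first.
    exact: ge0_subset_integral.
  apply: (ae_le_integral mE (ic (a - t))).
    exact: (integrable_abse (integrable_funB mE ivE (ic t))).
  apply: filterS aE => x H /H ax; apply: le_trans (ler_norm _).
  by rewrite lerD2r.
rewrite (integral_cst mu mE (a - t)%:E) EE -EFinM lee_fin -ler_pdivlMr//.
by rewrite lerBlDr addrC -lerBlDr.
Qed.

End means.

Lemma geometric_contradiction (R : realType) (A C x y : R) (k0 : nat) :
  0 < A -> 0 < x -> 0 <= y -> 2 * y <= x ->
  (forall k, (k0 <= k)%N -> A * x ^+ k <= C * y ^+ k) -> False.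
Proof.
move=> A0 x0 y0 yx H.
have P k : (k0 <= k)%N -> A * 2 ^+ k <= C.
  move=> /H h; have xk : 0 < x ^+ k by rewrite exprn_gt0.
  have yk : 2 ^+ k * y ^+ k <= x ^+ k.
    by rewrite -exprMn lerXn2r ?nnegrE ?mulr_ge0// ltW.
  have C0 : 0 < C.
    rewrite ltNge; apply/negP => C0.
    have : C * y ^+ k <= 0 by rewrite mulr_le0_ge0// exprn_ge0.
    by move=> /(le_trans h); rewrite leNgt mulr_gt0.
  rewrite -(ler_pM2r xk); apply: (@le_trans _ _ (C * y ^+ k * 2 ^+ k)).
    by rewrite mulrAC ler_wpM2r// exprn_ge0.
  by rewrite -mulrA ler_wpM2l ?(ltW C0)// mulrC.
pose k := maxn k0 (Num.truncn (C / A)).+1.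
have := P k (leq_maxl _ _); rewrite leNgt => /negP; apply.
rewrite mulrC -ltr_pdivrMr//; apply: (@lt_le_trans _ _ (Num.truncn (C / A)).+1%:R).
  exact: truncnS_gt.
apply: (@le_trans _ _ k%:R); first by rewrite ler_nat leq_maxr.
by rewrite -natrX ler_nat ltnW// ltn_expl.
Qed.

Lemma infinite_order_bound (R : realType) (n : nat) (Omega : set 'rV[R]_n)
    (u : 'rV[R]_n -> R) (x0 : 'rV[R]_n) (N : nat) :
  vanishes_infinite_order Omega u x0 -> exists2 d : R, 0 < d &
  forall r, 0 < r -> r < d ->
    `|\int[lebesgue_rV]_(x in eball x0 r) u x| <= ((2 * r) ^+ n) ^+ N.+1.
Proof.
move=> [_ _ _ /(_ N.+1%:R (ltr0Sn _ _)) lim0].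
have := (@cvgrPdist_lt _ _ _ _ _ _ _).1 lim0 1 ltr01.
move=> [d /= d0 Hd]; exists d => // r r0 rd.
have vc (s : R) : 0 <= s -> lebesgue_rV (cube x0 s) = ((2 * s) ^+ n)%:E by exact: lebesgue_cube.
pose s := r / n.+1%:R; have s0 : 0 < s by rewrite divr_gt0.
have me := measurable_eball x0 r.
have up : (lebesgue_rV (eball x0 r) <= ((2 * r) ^+ n)%:E)%E.
  rewrite -vc ?(ltW r0)//; apply: le_measure; rewrite ?inE//; last exact: eball_cube.
  exact: measurable_cube.
have lo : (((2 * s) ^+ n)%:E <= lebesgue_rV (eball x0 r))%E.
  rewrite -vc ?(ltW s0)//; apply: le_measure; rewrite ?inE//; first exact: measurable_cube.
  by have := cube_eball (q := x0) s0; rewrite /s [_ * (r / _)]mulrC divfK ?pnatr_eq0.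
have fin : lebesgue_rV (eball x0 r) \is a fin_num.
  by rewrite ge0_fin_numE// (le_lt_trans up)// ltry.
pose m := fine (lebesgue_rV (eball x0 r)).
have mup : m <= (2 * r) ^+ n by rewrite -lee_fin fineK.
have m0 : 0 < m.
  apply: (@lt_le_trans _ _ ((2 * s) ^+ n)); first by rewrite exprn_gt0// mulr_gt0.
  by rewrite -lee_fin fineK.
have := Hd r _ r0; rewrite /= !sub0r !normrN gtr0_norm// => /(_ rd).
rewrite -/m powR_mulrn ?(ltW m0)// normrM gtr0_norm ?invr_gt0 ?exprn_gt0//.
rewrite mulrC ltr_pdivrMr ?exprn_gt0// mul1r => /ltW /le_trans; apply.
by rewrite lerXn2r ?nnegrE ?(ltW m0)// exprn_ge0// mulr_ge0// ltW.
Qed.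

(** * Unique continuation *)

Section unique_continuation.
Context (R : realType) (n : nat) (Omega : set 'rV[R]_n) (u : 'rV[R]_n -> R)
  (x0 : 'rV[R]_n) (K r0 : R).
Context (n0 : (0 < n)%N) (oO : open Omega) (Ofin : (lebesgue_rV Omega < +oo)%E).
Context (Hu : H10 Omega u).
Context (u0 : {ae lebesgue_rV, forall x, Omega x -> 0 <= u x}).
Context (r00 : 0 < r0) (rO : cube x0 (2 * r0) `<=` Omega).
Local Notation rho k := (r0 * 2^-1 ^+ k).
Local Notation Q k := (cube x0 (rho k)).
Local Notation vol k := ((2 * rho k) ^+ n).
Local Notation mu := (@lebesgue_rV R n).
(** [log u] has bounded mean oscillation on the cubes around [x0], uniformly in
    the regularization. *)
Context (osc : forall k delta, 0 < delta ->
  mu.-integrable (Q k) (fun x => (vlog delta (u x))%:E) /\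
  (\int[mu]_(x in Q k) `|vlog delta (u x) -
      mean mu (Q k) (vol k) (fun x => vlog delta (u x))|%:E <= (K * vol k)%:E)%E).

Let rho_gt0 k : 0 < rho k.
Proof. by rewrite mulr_gt0// exprn_gt0// invr_gt0. Qed.

Let rho_le k : rho k <= r0.
Proof. by rewrite ler_piMr ?(ltW r00)// exprn_ile1// ?invr_ge0// invf_le1// ler1n. Qed.

Let vol_gt0 k : 0 < vol k.
Proof. by rewrite exprn_gt0// mulr_gt0. Qed.

Let mQ k : measurable (Q k). Proof. exact: measurable_cube. Qed.

Let muQ k : mu (Q k) = (vol k)%:E.
Proof. by apply: lebesgue_cube; exact: ltW. Qed.

Let QO k : Q k `<=` Omega.
Proof.
apply: subset_trans rO; apply: subset_cube; apply: (le_trans (rho_le k)).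
by rewrite ler_peMl ?ler1n// ltW.
Qed.

Let mO : measurable Omega. Proof. exact: open_measurable_rV. Qed.

Let iu : mu.-integrable Omega (fun x => (u x)%:E).
Proof.
have [[/(Lp2_integrable _ mO)[muO iu2] _] _] := Hu.
apply: (ae_dominated_integrable mO muO
  (integrable_funD mO (integrable_cst mO 1 Ofin) iu2)).
apply: aeW => x _; have := sqr_ge0 (`|u x| - 1).
by rewrite sqrrB real_normK ?num_real//=; have := normr_ge0 (u x); lra.
Qed.

Let iuQ k : mu.-integrable (Q k) (fun x => (u x)%:E).
Proof. by exact: (integrableS mO (mQ k) (@QO k) iu). Qed.

Let m_ delta k := mean mu (Q k) (vol k) (fun x => vlog delta (u x)).

Lemma mean_log_decay delta k : 0 < delta ->
  m_ delta 0 - k%:R * (2 ^+ n * K) <= m_ delta k.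
Proof.
move=> d0; elim: k => [|k IH]; first by rewrite mul0r subr0.
have [iv ok] := osc k d0.
have QS : Q k.+1 `<=` Q k.
  apply: subset_cube; rewrite exprS mulrCA ler_piMl ?(ltW (rho_gt0 k))//.
  by rewrite invf_le1// ler1n.
have := mean_subset (mQ k) (mQ k.+1) QS (vol_gt0 k) (vol_gt0 k.+1) (muQ k) (muQ k.+1) iv ok.
have -> : vol k / vol k.+1 = 2 ^+ n.
  rewrite -expr_div_n; congr (_ ^+ _); rewrite exprS.
  by move: (rho_gt0 k) => /gt_eqF; rewrite mulf_eq0 => /norP[a b]; field; rewrite a b.
rewrite [K * _]mulrC -/(m_ delta k.+1) -/(m_ delta k) ler_norml => /andP[h _].
by move: IH h; rewrite -natr1; lra.
Qed.

(** By Jensen's inequality the linear decay of the means of [log u] becomes a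
    geometric lower bound for the means of [u]. It does not depend on [delta],
    which therefore can tend to zero. *)
Lemma mean_lower_decay E e : 0 < e -> measurable E -> E `<=` Q 0 ->
  (forall x, E x -> e <= u x) -> (0 < mu E)%E ->
  exists2 A, 0 < A & forall k, A * expR (- (2 ^+ n * K)) ^+ k <= mean mu (Q k) (vol k) u.
Proof.
move=> e0 mE EQ eu muE; pose a := ln e - K * vol 0 / fine (mu E).
exists (expR a); first exact: expR_gt0.
move=> k; apply/ler_addgt0Pr => delta d0.
have [iv0 o0] := osc 0 d0.
have lo : a <= m_ delta 0.
  apply: (mean_lower_bound (mQ 0) mE EQ (vol_gt0 0) (muQ 0) iv0 _ muE o0).
  apply: aeW => x /eu ex; have ux : 0 < u x by exact: lt_le_trans ex.
  by apply: le_trans (ln_le_vlog d0 (ltW ux) ux); rewrite ler_ln ?posrE.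
have [ivk _] := osc k d0.
apply: le_trans (jensen_expR (mQ k) (vol_gt0 k) (muQ k) (iuQ k) ivk _); last first.
  by apply: filterS u0 => x H /QO /H ux; exact: expR_vlog_le.
rewrite -expRM_natl -expRD ler_expR -/(m_ delta k).
by have := mean_log_decay k d0; move: lo; rewrite -mulr_natl; lra.
Qed.

Lemma mean_upper_decay N : vanishes_infinite_order Omega u x0 ->
  exists k0 C, forall k, (k0 <= k)%N ->
    mean mu (Q k) (vol k) u <= C * ((2^-1) ^+ (n * N)) ^+ k.
Proof.
move=> /(@infinite_order_bound _ _ _ _ _ N)[d d0 Hd].
pose c : R := n.+1%:R; have c0 : 0 < c by rewrite ltr0n.
pose d1 := Num.min d (2 * r0); have d10 : 0 < d1 by rewrite lt_min d0 mulr_gt0.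
pose k0 := (Num.truncn (c * r0 / d1)).+1.
exists k0, (c ^+ (n * N.+1) * (2 * r0) ^+ (n * N)) => k kk.
pose s := c * rho k; have s0 : 0 < s by rewrite mulr_gt0.
have sd : s < d1.
  rewrite /s mulrA exprVn ltr_pdivrMr ?exprn_gt0// [d1 * _]mulrC -ltr_pdivrMr//.
  apply: (@lt_le_trans _ _ k0%:R); first exact: truncnS_gt.
  apply: (@le_trans _ _ k%:R); first by rewrite ler_nat.
  by rewrite -natrX ler_nat ltnW// ltn_expl.
have [sd' sr] : s < d /\ s < 2 * r0 by move: sd; rewrite lt_min => /andP[].
have BO : eball x0 s `<=` Omega.
  apply: subset_trans rO; apply: subset_trans (@eball_cube _ _ _ _) _.
  by apply: subset_cube; exact: ltW.
have QB : Q k `<=` eball x0 s by exact: cube_eball.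
have mB := measurable_eball x0 s.
have iB : mu.-integrable (eball x0 s) (fun x => (u x)%:E).
  exact: (integrableS mO mB BO iu).
have le : \int[mu]_(x in Q k) u x <= \int[mu]_(x in eball x0 s) u x.
  rewrite /Rintegral fine_le//; [exact: integrable_fin_num|exact: integrable_fin_num|].
  apply: (@le_trans _ _ (\int[mu]_(x in Q k) `|u x|%:E)%E).
    apply: (ae_le_integral (mQ k) (iuQ k) (integrable_abse (iuQ k))).
    by apply: aeW => x _ /=; exact: ler_norm.
  apply: (@le_trans _ _ (\int[mu]_(x in eball x0 s) `|u x|%:E)%E).
    apply: ge0_subset_integral; [exact: mQ|exact: mB| |by move=> x _; rewrite lee_fin|exact: QB].
    apply/measurable_EFinP; apply: measurableT_comp => //; exact: integrable_measurable iB.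
  apply: (ae_le_integral mB (integrable_abse iB) iB).
  by apply: filterS u0 => x H /BO/H ux; rewrite /= ger0_norm.
rewrite /mean mulrC ler_pdivrMr//; apply: (le_trans le).
apply: le_trans (ler_norm _) (le_trans (Hd s s0 sd') _).
rewrite le_eqVlt; apply/orP; left; apply/eqP.
have -> : (2^-1 ^+ (n * N)) ^+ k = (2^-1 ^+ k) ^+ (n * N) :> R by rewrite exprAC.
rewrite -[c ^+ _ * _ * _]mulrA -exprMn -[2 * r0 * _]mulrA.
rewrite /s -exprM [2 * (c * _)]mulrCA exprMn -[RHS]mulrA -exprD.
by congr (_ * _ ^+ _); rewrite mulnS addnC.
Qed.

(** If [u] were bounded below on a set of positive measure, then the means of [u]
    could not decay faster than the fixed geometric rate of [mean_lower_decay],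
    while [mean_upper_decay] holds for every [N]. *)
Lemma vanishing_zero : vanishes_infinite_order Omega u x0 ->
  {ae mu, forall x, Q 0 x -> u x = 0}.
Proof.
move=> van; pose K' := 2 ^+ n * K.
have mu0 : measurable_fun (Q 0) u by exact: integrable_measurable (iuQ 0).
pose E (j : nat) := Q 0 `&` u @^-1` `[j.+1%:R^-1, +oo[%classic.
have mE j : measurable (E j) by exact: mu0.
have E0 j : mu (E j) = 0%E.
  apply: contrapT => /eqP; rewrite -measure_gt0 => muE.
  have e0 : 0 < j.+1%:R^-1 :> R by rewrite invr_gt0.
  have [|A A0 lo] := mean_lower_decay e0 (mE j) (@subIsetl _ _ _) _ muE.
    by move=> x [_]; rewrite /= in_itv/= andbT.
  pose N := (Num.truncn (2 * expR K')).+1.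
  have [k0 [C up]] := mean_upper_decay N van.
  apply: (@geometric_contradiction R A C (expR (- K')) ((2^-1) ^+ (n * N)) k0) => //.
  - exact: expR_gt0.
  - rewrite expRN exprVn ler_pdivrMr ?exprn_gt0// mulrC ler_pdivlMr ?expR_gt0//.
    apply: (@le_trans _ _ N%:R); first exact/ltW/truncnS_gt.
    rewrite -natrX ler_nat; apply: (@leq_trans (2 ^ N)%N); first exact/ltnW/ltn_expl.
    by rewrite leq_exp2l// leq_pmull.
  - by move=> k /up; apply: le_trans; exact: lo.
have neg : mu.-negligible (\bigcup_j E j).
  by apply: negligible_bigcup => j; exists (E j); split; [exact: mE|exact: E0|].
have : {ae mu, forall x, ~ (\bigcup_j E j) x}.
  by have [N [mN N0 EN]] := neg; exists N; split; [exact: mN|exact: N0|move=> x /= /contrapT; exact: EN].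
apply: filterS2 u0 => x H nE Qx; apply/eqP; rewrite eq_le H ?andbT; last exact: (QO Qx).
rewrite leNgt; apply/negP => ux; apply: nE.
exists (Num.truncn (u x)^-1) => //; split => //=; rewrite in_itv/= andbT.
rewrite -[leRHS]invrK lef_pV2 ?posrE ?invr_gt0//.
exact/ltW/truncnS_gt.
Qed.

End unique_continuation.

Lemma bounded_finite_measure (R : realType) (n : nat) (Omega : set 'rV[R]_n) :
  open Omega -> bounded_set Omega -> (lebesgue_rV Omega < +oo)%E.
Proof.
move=> oO [M [_ bO]]; have MM : M < `|M| + 1 by rewrite (le_lt_trans (ler_norm M))// ltrDl.
apply: (@le_lt_trans _ _ (lebesgue_rV (cube (0 : 'rV[R]_n) (`|M| + 1)))).
  apply: le_measure; rewrite ?inE; [exact: open_measurable_rV|exact: measurable_cube|].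
  move=> x Ox i; rewrite mxE subr0; apply: le_trans (bO _ MM x Ox).
  by rewrite -[leRHS]/(mx_norm x) mx_normrE (le_bigmax _ _ (ord0, i)).
by rewrite lebesgue_cube ?ltry// addr_ge0.
Qed.

Lemma cube_growthW (R : realType) (n : nat) (K K' : R) (f : 'rV[R]_n -> R) :
  K <= K' -> cube_growth K f -> cube_growth K' f.
Proof.
move=> KK g q r r0 r1; apply: (le_trans (g q r r0 r1)).
by rewrite lee_fin ler_wpM2r// divr_ge0// exprn_ge0// ltW.
Qed.

Lemma coefficient_growth (R : realType) (n : nat)
    (b : 'I_n -> 'rV[R]_n -> R) (V : 'rV[R]_n -> R) :
  (forall i, measurable_fun setT (b i)) -> measurable_fun setT V ->
  (exists alpha p phi, assumption_A alpha p phi b V) \/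
  (exists alpha, assumption_B alpha b V) ->
  (0 < n)%N /\ exists K, (forall i, cube_growth K (fun x => b i x ^+ 2)) /\ cube_growth K V.
Proof.
move=> mb mV; have mb2 i : measurable_fun setT (fun x => b i x ^+ 2) by exact: measurable_funX.
have combine : (forall i, exists2 K, 0 <= K & cube_growth K (fun x => b i x ^+ 2)) ->
    (exists2 K, 0 <= K & cube_growth K V) ->
    exists K, (forall i, cube_growth K (fun x => b i x ^+ 2)) /\ cube_growth K V.
  move=> hb [L L0 hV].
  have /choice[k hk] : forall i, exists K, 0 <= K /\ cube_growth K (fun x => b i x ^+ 2).
    by move=> i; have [k k0 hk] := hb i; exists k.
  have k0 i : 0 <= k i by have [] := hk i.
  exists (\sum_i k i + L); split=> [i|].
    apply: cube_growthW (hk i).2; rewrite (bigD1 i)//= -addrA lerDl addr_ge0// sumr_ge0//.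
  by apply: cube_growthW hV; rewrite lerDr sumr_ge0.
case=> [[alpha [p [phi [[/andP[a1 a2] an /andP[p1 _]] phi0 [C1 [C2 [C3 [C10 _ C30 gr]]]]
    hb [hV _]]]]]|[alpha [/andP[a1 a2] an hb hV]]].
  split; first by rewrite -(ltr0n R) (lt_trans _ an)// (lt_trans ltr01).
  apply: combine; last exact: (morrey_growth a2 p1 C10 C30 phi0 gr mV hV).
  by move=> i; exact: (morrey_growth a2 p1 C10 C30 phi0 gr (mb2 i) (hb i)).
have n0 : (0 < n)%N by rewrite -(ltr0n R) (lt_trans _ an)// (lt_le_trans ltr01).
split; first exact: n0.
apply: combine; last exact: (stummel_growth n0 a2 an mV hV).
by move=> i; exact: (stummel_growth n0 a2 an (mb2 i) (hb i)).
Qed.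

Theorem corollary1p5 (R : realType) (n : nat) (Omega : set 'rV[R]_n)
    (a : 'rV[R]_n -> 'M[R]_n) (b : 'I_n -> 'rV[R]_n -> R)
    (V : 'rV[R]_n -> R)
    (open_Omega : open Omega) (bounded_Omega : bounded_set Omega)
    (elliptic_a : elliptic Omega a)
    (measurable_b : forall i, measurable_fun setT (b i))
    (measurable_V : measurable_fun setT V)
    (assumption_bV :
       (exists alpha p phi, assumption_A alpha p phi b V) \/
       (exists alpha, assumption_B alpha b V)) :
  forall (u : 'rV[R]_n -> R) (x0 : 'rV[R]_n),
    weak_solution Omega a b V u ->
    {ae lebesgue_rV, forall x, Omega x -> 0 <= u x} ->
    Omega x0 ->
    vanishes_infinite_order Omega u x0 ->
    exists2 r : R, 0 < r & {ae lebesgue_rV, forall x, eball x0 r x -> u x = 0}.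
Proof.
move=> u x0 sol u0 Ox0 van.
have Ofin := bounded_finite_measure open_Omega bounded_Omega.
have [n0 [K [gb gV]]] := coefficient_growth measurable_b measurable_V assumption_bV.
have [C C0 En] := energy_cube open_Omega Ofin elliptic_a measurable_b measurable_V
  sol u0 gb gV.
have [s s0 sO] := open_cube_subset open_Omega Ox0.
pose r := Num.min s 1 / 2; have m0 : 0 < Num.min s 1 by rewrite lt_min s0 ltr01.
have r0 : 0 < r by rewrite divr_gt0.
have rE : 2 * r = Num.min s 1 by rewrite mulrC divfK.
have [ms m1] : Num.min s 1 <= s /\ Num.min s 1 <= 1 by rewrite !ge_min !lexx orbT.
have rO : cube x0 (2 * r) `<=` Omega.
  by rewrite rE; apply: subset_trans sO; exact: subset_cube.
have [Hu _] := sol.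
exists r => //.
have osc k delta : 0 < delta ->
  lebesgue_rV.-integrable (cube x0 (r * 2^-1 ^+ k)) (fun x => (vlog delta (u x))%:E) /\
  (\int[lebesgue_rV]_(x in cube x0 (r * 2^-1 ^+ k)) `|vlog delta (u x) -
      mean lebesgue_rV (cube x0 (r * 2^-1 ^+ k)) ((2 * (r * 2^-1 ^+ k)) ^+ n)
        (fun x => vlog delta (u x))|%:E <=
     ((2 * n%:R + 2 * C) * (2 * (r * 2^-1 ^+ k)) ^+ n)%:E)%E.
  move=> d0; set t := r * 2^-1 ^+ k; have t0 : 0 < t by rewrite mulr_gt0 ?exprn_gt0.
  have tr : t <= r.
    by rewrite ler_piMr ?(ltW r0)// exprn_ile1// ?invr_ge0// invf_le1// ler1n.
  have tO : cube x0 (2 * t) `<=` Omega.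
    by apply: subset_trans rO; apply: subset_cube; rewrite ler_wpM2l.
  have tO' : cube x0 t `<=` Omega.
    by apply: subset_trans tO; apply: subset_cube; rewrite ler_peMl ?ler1n// ltW.
  have t1 : 2 * t <= 1 by rewrite (le_trans _ m1)// -rE ler_wpM2l.
  split; first by have [] := poincare_log open_Omega Hu d0 t0 tO'.
  apply: (log_oscillation_cube open_Omega Hu u0 d0 t0 tO' C0).
  exact: En.
have zero := vanishing_zero n0 open_Omega Ofin Hu u0 r0 rO osc van.
apply: filterS zero => x H xr; apply: H; rewrite expr0 mulr1.
exact: eball_cube.
Qed.
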